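(* Let $(\xi,f)$ be a pair with $\xi\in L^2_T$ $\mathcal F_T$-measurable and $f$ satisfying (B) (with $\mathbb H=\mathbb F$). Let $f^0$ satisfy (B) (with $\mathbb H=\mathbb F$), let $f^1$ satisfy (B1) (with $\mathbb H=\mathbb G$), and suppose that for a positive constant $C_0$, for all $t\in[0,T]$, all $(x_i,y_i,z_i)\in\mathbb R\times\mathbb R\times \widehat L^2(\ell)$, $i=1,2$, and all $\zeta\in\mathbb R$, $$|f(t,x_1,y_1,z_1)-f^0(t,x_2,y_2,z_2)|\le C_0\big(|x_1-x_2|+|y_1-y_2|+\|z_1-z_2\|\big),$$ $$|f(t,x_1,y_1,z_1)-f^1(t,x_2,y_2,z_2,\zeta)|\le C_0\big(|x_1-x_2|+|y_1-y_2|+\|z_1-z_2\|+|\zeta|\big).$$ For $\varepsilon>0$ let $\xi^0_\varepsilon\in L^2_T$ be $\mathcal F_T$-measurable and $\xi^1_\varepsilon\in L^2_T$ be $\mathcal G_T$-measurable, with $\xi^\rho_\varepsilon\to\xi$ in $L^2$ as $\varepsilon\to0$, $\rho=0,1$. Let $X$ be the first component of the solution of the original BSDEJ with data $(\xi,f)$ and $X^\rho_\varepsilon$ the first component of the solution of the approximating BSDEJ with data $(\xi^\rho_\varepsilon,f^\rho)$. Then there is a positive constant $C$, not depending on $\varepsilon$, such that $$\mathbb E\Big[\sup_{0\le t\le T}|X(t)-X^\rho_\varepsilon(t)|^2\Big]\le C\,\mathbb E[|\xi-\xi^\rho_\varepsilon|^2]\qquad\text{for }\rho=0\text{ and }\r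ho=1.$$
   Context: $(\Omega,\mathcal F,\mathbb P)$ is a complete probability space, $T>0$, $\mathbb R_0=\mathbb R\setminus\{0\}$. $W,B$ are independent standard Brownian motions on $[0,T]$ and $N(dt,dz)$ is a Poisson random measure on $[0,T]\times\mathbb R_0$, independent of $W,B$, with $\mathbb E[N(dt,dz)]=\ell(dz)dt$, where $\int_{\mathbb R_0}z^2\ell(dz)<\infty$; $\widetilde N(dt,dz)=N(dt,dz)-\ell(dz)dt$. $\mathbb F=(\mathcal F_t)$ is the $\mathbb P$-augmented filtration generated by $W$ and $\widetilde N$; $\mathbb G=(\mathcal G_t)$ is the $\mathbb P$-augmented filtration generated by $W$, $B$ and $\widetilde N$. $\mathbb H$ denotes $\mathbb F$ or $\mathbb G$. Spaces: $L^2_T$ is the space of square integrable $\mathcal H_T$-measurable random variables; $H^2_T$ the $\mathbb H$-predictable processes $\phi$ with $\mathbb E\int_0^T|\phi(t)|^2dt<\infty$; $\widehat H^2_T$ the $\mathbb H$-predictable $\theta:\Omega\times[0,T]\times\mathbb R_0\to\mathbb R$ with $\mathbb E\int_0^T\int_{\mathbb R_0}|\theta(t,z)|^2\ell(dz)dt<\infty$; $S^2_T$ the $\mathbb H$-adapted càdlàg processes $\gamma$ with $\mathbb E[\sup_{0\le t\le T}|\gamma(t)|^2]<\infty$. $\nu=S^2_T\times H^2_T\times\widehat H^2_T$, $\widetilde\nu=S^2_T\times H^2_T\times\widehat H^2_T\times H^2_T$. $\widehat L^2(\ell)$ is the space of Borel $\psi:\mathbb R_0\to\mathbb R$ with $\|\psi\|^2=\int_{\mathbb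 R_0}|\psi(z)|^2\ell(dz)<\infty$. (B) for $f:\Omega\times[0,T]\times\mathbb R\times\mathbb R\times\widehat L^2(\ell)\to\mathbb R$: $f(\cdot,x,y,z)$ is $\mathbb H$-progressively measurable for all $x,y,z$; $f(\cdot,0,0,0)\in H^2_T$; there is a constant $C$ with $|f(t,x_1,y_1,z_1)-f(t,x_2,y_2,z_2)|\le C(|x_1-x_2|+|y_1-y_2|+\|z_1-z_2\|)$ for all $t$ and all arguments. (B1) for $f^1:\Omega\times[0,T]\times\mathbb R\times\mathbb R\times\widehat L^2(\ell)\times\mathbb R\to\mathbb R$: the same three requirements with the additional real argument $\zeta$ ($\mathbb H$-progressive measurability for fixed $(x,y,z,\zeta)$, $f^1(\cdot,0,0,0,0)\in H_T^2$, uniform Lipschitz continuity in $(x,y,z,\zeta)$). Original BSDEJ with data $(\xi,f)$ ($\mathbb H=\mathbb F$, solution $(X,Y,Z)\in\nu$): $-dX(t)=f(t,X(t),Y(t),Z(t,\cdot))dt-Y(t)dW(t)-\int_{\mathbb R_0}Z(t,z)\widetilde N(dt,dz)$, $X(T)=\xi$. Approximating BSDEJ, $\rho=0$ ($\mathbb H=\mathbb F$, solution $(X^0_\varepsilon,Y^0_\varepsilon,Z^0_\varepsilon)\in\nu$): $-dX^0_\varepsilon(t)=f^0(t,X^0_\varepsilon(t),Y^0_\varepsilon(t),Z^0_\varepsilon(t,\cdot))dt-Y^0_\varepsilon(t)dW(t)-\int_{\mathbb R_0}Z^0_\varepsilon(t,z)\widetilde N(dt,dz)$, $X^0_\varepsilon(T)=\xi^0_\varepsilon$.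 Approximating BSDEJ, $\rho=1$ ($\mathbb H=\mathbb G$, solution $(X^1_\varepsilon,Y^1_\varepsilon,Z^1_\varepsilon,\zeta^1_\varepsilon)\in\widetilde\nu$): $-dX^1_\varepsilon(t)=f^1(t,X^1_\varepsilon(t),Y^1_\varepsilon(t),Z^1_\varepsilon(t,\cdot),\zeta^1_\varepsilon(t))dt-Y^1_\varepsilon(t)dW(t)-\int_{\mathbb R_0}Z^1_\varepsilon(t,z)\widetilde N(dt,dz)-\zeta^1_\varepsilon(t)dB(t)$, $X^1_\varepsilon(T)=\xi^1_\varepsilon$. *)

(* Defs.v *)
From HB Require Import structures.
From mathcomp Require Import all_boot all_order all_algebra.
From mathcomp Require Import all_classical all_reals all_analysis.
From mathcomp Require Import measurable_realfun.
Set Implicit Arguments.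
Unset Strict Implicit.
Unset Printing Implicit Defensive.
Import Order.TTheory GRing.Theory Num.Theory.
Import numFieldNormedType.Exports.
Local Open Scope classical_set_scope.
Local Open Scope ring_scope.

(* Conventions.
   - Time-indexed objects are functions of t : R; only t in `[0, T] matters.
     Processes are written t first: X t w, Z t w z.
   - A measure on R \ {0} is given by a measure ell on R of which only the
     restriction to R0 is ever used; likewise the jump measure is a kernel from
     Omega to R * R (time, mark) of which only the restriction to
     `[0, T] `*` R0 is used.
   - A filtration is a family Fl : R -> set (set Omega) of sigma-algebras;
     measurability with respect to Fl t is measurability on the type
     g_sigma_algebraType (Fl t).
   - Path properties are required for almost all w. *)

Section noise.
Context (R : realType) (d : measure_display) (Omega : measurableType d).
Context (P : probability Omega R) (T : R) (ell : {measure set R -> \bar R}).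
Local Notation mu := (@lebesgue_measure R).

Definition R0 : set R := [set z | z != 0].

Definition gen_process (W : R -> Omega -> R) (t : R) : set (set Omega) :=
  [set E | exists u B, [/\ 0 <= u <= t, measurable B & E = W u @^-1` B]].

Definition brownian_motion (W : R -> Omega -> R) : Prop :=
  [/\ forall t, 0 <= t <= T -> measurable_fun setT (W t),
      {ae P, forall w, W 0 w = 0},
      {ae P, forall w, {within `[0, T], continuous (fun t => W t w)}},
      forall s t, 0 <= s -> s < t -> t <= T -> forall B, measurable B ->
        P [set w | B (W t w - W s w)] =
        normal_prob 0 (Num.sqrt (t - s)) B &
      forall s t, 0 <= s -> s < t -> t <= T ->
        forall A B, <<s gen_process W s >> A -> measurable B ->
        P (A `&` [set w | B (W t w - W s w)]) =
        (P A * P [set w | B (W t w - W s w)%R])%E].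

(* The measure ell(dz)dt on `[0, T] `*` R0. *)
Definition intensity (A : set (R * R)) : \bar R :=
  \int[mu]_(t in `[0, T]) ell (xsection A t `&` R0).

(* The Poisson weights are written out because the library's poisson_pmf is
   identically 1 at rate 0, a rate that does occur here. *)
Definition poisson_random_measure (N : R.-ker Omega ~> (R * R)%type) : Prop :=
  (forall A, measurable A -> A `<=` `[0, T] `*` R0 ->
     (intensity A < +oo)%E -> forall k : nat,
     P [set w | N w A = k%:R%:E] =
     (fine (intensity A) ^+ k / k`!%:R * expR (- fine (intensity A)))%:E) /\
  (forall (n : nat) (A : 'I_n -> set (R * R)) (C : 'I_n -> set (\bar R)),
     (forall i, measurable (A i) /\ A i `<=` `[0, T] `*` R0) ->
     trivIset setT A -> (forall i, measurable (C i)) ->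
     P (\bigcap_i [set w | C i (N w (A i))]) =
     (\prod_(i < n) P [set w | C i (N w (A i))])%E).

(* Only meaningful on sets of finite intensity. *)
Definition compensated (N : R.-ker Omega ~> (R * R)%type)
    (A : set (R * R)) (w : Omega) : \bar R := (N w A - intensity A)%E.

Definition gen_jumps (N : R.-ker Omega ~> (R * R)%type) (t : R)
    : set (set Omega) :=
  [set E | exists A C, [/\ measurable A, A `<=` `[0, t] `*` R0,
     (intensity A < +oo)%E, measurable C & E = compensated N A @^-1` C]].

Definition filtrationF W N (t : R) : set (set Omega) :=
  <<s gen_process W t `|` gen_jumps N t `|` P.-negligible >>.

Definition filtrationG W B N (t : R) : set (set Omega) :=
  <<s gen_process W t `|` gen_process B t `|` gen_jumps N t
      `|` P.-negligible >>.

(* Mutual independence of the sigma-algebras generated by W, B and N. *)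
Definition independent_noises W B N : Prop :=
  forall E1 E2 E3, <<s gen_process W T >> E1 -> <<s gen_process B T >> E2 ->
    <<s gen_jumps N T >> E3 ->
    P (E1 `&` E2 `&` E3) = (P E1 * P E2 * P E3)%E.

End noise.

Section spaces.
Context (R : realType) (d : measure_display) (Omega : measurableType d).
Context (P : probability Omega R) (T : R) (ell : {measure set R -> \bar R}).
Local Notation mu := (@lebesgue_measure R).
Variable Fl : R -> set (set Omega).

Definition adapted (X : R -> Omega -> R) : Prop :=
  forall t, 0 <= t <= T ->
    @measurable_fun _ _ (g_sigma_algebraType (Fl t)) R setT (X t).

Definition progressive (X : R -> Omega -> R) : Prop :=
  forall t, 0 <= t <= T ->
    @measurable_fun _ _ (R * g_sigma_algebraType (Fl t))%type R
      (`[0, t] `*` setT) (fun p => X p.1 p.2).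

Definition gen_predictable : set (set (R * Omega)) :=
  [set D | (exists A, Fl 0 A /\ D = [set 0] `*` A) \/
           (exists s t A, [/\ 0 <= s, s <= t, t <= T, Fl s A
                            & D = `]s, t] `*` A])].

Definition predictable (phi : R -> Omega -> R) : Prop :=
  @measurable_fun _ _ (g_sigma_algebraType gen_predictable) R
    (`[0, T] `*` setT) (fun p => phi p.1 p.2).

Definition predictable_field (theta : R -> Omega -> R -> R) : Prop :=
  @measurable_fun _ _ (g_sigma_algebraType gen_predictable * R)%type R
    ((`[0, T] `*` setT) `*` @R0 R) (fun q => theta q.1.1 q.1.2 q.2).

Definition cadlag (x : R -> R) : Prop :=
  (forall t, 0 <= t < T -> x s @[s --> t^'+] --> x t) /\
  (forall t, 0 < t <= T -> exists l : R, x s @[s --> t^'-] --> l).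

(* E [ sup_(0 <= t <= T) |X t|^2 ] *)
Definition Esup2 (X : R -> Omega -> R) : \bar R :=
  \int[P]_w ereal_sup [set (`|X t w| ^+ 2)%:E | t in `[0%R, T]].

(* E [ int_0^T |phi t|^2 dt ] *)
Definition Eint2 (phi : R -> Omega -> R) : \bar R :=
  \int[P]_w \int[mu]_(t in `[0%R, T]) (`|phi t w| ^+ 2)%:E.

(* E [ int_0^T int_R0 |theta t z|^2 ell(dz) dt ] *)
Definition Eintjump2 (theta : R -> Omega -> R -> R) : \bar R :=
  \int[P]_w \int[mu]_(t in `[0%R, T])
    \int[ell]_(z in @R0 R) (`|theta t w z| ^+ 2)%:E.

Definition L2T (xi : Omega -> R) : Prop :=
  @measurable_fun _ _ (g_sigma_algebraType (Fl T)) R setT xi /\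
  (\int[P]_w (`|xi w| ^+ 2)%:E < +oo)%E.

Definition H2T (phi : R -> Omega -> R) : Prop :=
  predictable phi /\ (Eint2 phi < +oo)%E.

Definition hatH2T (theta : R -> Omega -> R -> R) : Prop :=
  predictable_field theta /\ (Eintjump2 theta < +oo)%E.

Definition S2T (X : R -> Omega -> R) : Prop :=
  [/\ adapted X, {ae P, forall w, cadlag (X ^~ w)} & (Esup2 X < +oo)%E].

Definition hatL2 (psi : R -> R) : Prop :=
  measurable_fun (@R0 R) psi /\
  (\int[ell]_(z in @R0 R) (`|psi z| ^+ 2)%:E < +oo)%E.

Definition norm_ell (psi : R -> R) : R :=
  Num.sqrt (fine (\int[ell]_(z in @R0 R) (`|psi z| ^+ 2)%:E)).

(* A driver is a total function of psi : R -> R, but only its values at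
   psi in hatL2 are constrained (and used). *)
Definition condB (f : R -> Omega -> R -> R -> (R -> R) -> R) : Prop :=
  [/\ forall x y z, hatL2 z -> progressive (fun t w => f t w x y z),
      H2T (fun t w => f t w 0 0 (cst 0)) &
      exists C : R, forall t w x1 y1 z1 x2 y2 z2,
        0 <= t <= T -> hatL2 z1 -> hatL2 z2 ->
        `|f t w x1 y1 z1 - f t w x2 y2 z2| <=
          C * (`|x1 - x2| + `|y1 - y2| + norm_ell (z1 - z2))].

Definition condB1 (f1 : R -> Omega -> R -> R -> (R -> R) -> R -> R) : Prop :=
  [/\ forall x y z zeta, hatL2 z ->
        progressive (fun t w => f1 t w x y z zeta),
      H2T (fun t w => f1 t w 0 0 (cst 0) 0) &
      exists C : R, forall t w x1 y1 z1 zeta1 x2 y2 z2 zeta2,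
        0 <= t <= T -> hatL2 z1 -> hatL2 z2 ->
        `|f1 t w x1 y1 z1 zeta1 - f1 t w x2 y2 z2 zeta2| <=
          C * (`|x1 - x2| + `|y1 - y2| + norm_ell (z1 - z2)
               + `|zeta1 - zeta2|)].

(* Ito integrals, as L^2 limits of integrals of simple integrands
   sum_i c_i 1_(]l_i, r_i]) (times 1_(mark_i) for jumps), where c_i is bounded
   and Fl (l_i)-measurable. *)

Record simple_process := SimpleProcess {
  sp_size : nat;
  sp_l : 'I_sp_size -> R;
  sp_r : 'I_sp_size -> R;
  sp_c : 'I_sp_size -> Omega -> R }.

Definition simple_coef (l r : R) (c : Omega -> R) : Prop :=
  [/\ 0 <= l, l <= r, r <= T,
      @measurable_fun _ _ (g_sigma_algebraType (Fl l)) R setT c &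
      exists K : R, forall w, `|c w| <= K].

Definition sp_wf (h : simple_process) : Prop :=
  forall i, simple_coef (@sp_l h i) (sp_r i) (sp_c i).

Definition sp_val (h : simple_process) (t : R) (w : Omega) : R :=
  \sum_(i < sp_size h) @sp_c h i w * \1_(`]sp_l i, sp_r i]) t.

Definition sp_integral (W : R -> Omega -> R) (h : simple_process)
    (t : R) (w : Omega) : R :=
  \sum_(i < sp_size h)
    @sp_c h i w * (W (Num.min (sp_r i) t) w - W (Num.min (sp_l i) t) w).

Definition brownian_integral (W phi I : R -> Omega -> R) : Prop :=
  [/\ adapted I, {ae P, forall w, cadlag (I ^~ w)} &
      exists h : nat -> simple_process,
        [/\ forall n, sp_wf (h n),
            (fun n => Eint2 (fun t w => phi t w - sp_val (h n) t w))
              @ \oo --> 0%E &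
            forall t, 0 <= t <= T ->
              (fun n => (\int[P]_w
                 (`|I t w - sp_integral W (h n) t w| ^+ 2)%:E)%E)
                @ \oo --> 0%E]].

Record simple_field := SimpleField {
  sf_size : nat;
  sf_l : 'I_sf_size -> R;
  sf_r : 'I_sf_size -> R;
  sf_mark : 'I_sf_size -> set R;
  sf_c : 'I_sf_size -> Omega -> R }.

Definition sf_wf (h : simple_field) : Prop :=
  forall i, [/\ simple_coef (@sf_l h i) (sf_r i) (sf_c i),
                measurable (sf_mark i), sf_mark i `<=` @R0 R &
                (ell (sf_mark i) < +oo)%E].

Definition sf_val (h : simple_field) (t : R) (w : Omega) (z : R) : R :=
  \sum_(i < sf_size h)
    @sf_c h i w * \1_(`]sf_l i, sf_r i]) t * \1_(sf_mark i) z.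

Definition sf_integral (N : R.-ker Omega ~> (R * R)%type) (h : simple_field)
    (t : R) (w : Omega) : R :=
  \sum_(i < sf_size h)
    @sf_c h i w *
      fine (compensated T ell N
        (`]Num.min (sf_l i) t, Num.min (sf_r i) t] `*` sf_mark i) w).

Definition jump_integral (N : R.-ker Omega ~> (R * R)%type)
    (theta : R -> Omega -> R -> R) (I : R -> Omega -> R) : Prop :=
  [/\ adapted I, {ae P, forall w, cadlag (I ^~ w)} &
      exists h : nat -> simple_field,
        [/\ forall n, sf_wf (h n),
            (fun n => Eintjump2 (fun t w z => theta t w z - sf_val (h n) t w z))
              @ \oo --> 0%E &
            forall t, 0 <= t <= T ->
              (fun n => (\int[P]_w
                 (`|I t w - sf_integral N (h n) t w| ^+ 2)%:E)%E)
                @ \oo --> 0%E]].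

(* In the two equations below the processes IW, IN, IB are the stochastic
   integrals of Y, Z, zeta; the equation is written in integrated form on
   [t, T], with the drift integrable so that its Lebesgue integral is not a
   default value. *)

Definition bsdej_solution W N (xi : Omega -> R)
    (f : R -> Omega -> R -> R -> (R -> R) -> R)
    (X Y : R -> Omega -> R) (Z : R -> Omega -> R -> R) : Prop :=
  let drift w s := f s w (X s w) (Y s w) (Z s w) in
  [/\ S2T X, H2T Y, hatH2T Z &
    exists IW IN, [/\ brownian_integral W Y IW, jump_integral N Z IN &
      {ae P, forall w,
        mu.-integrable `[0, T] (EFin \o drift w) /\
        forall t, 0 <= t <= T ->
          X t w = xi w + \int[mu]_(s in `[t, T]) drift w s
                  - (IW T w - IW t w) - (IN T w - IN t w)}]].

Definition bsdej_solution1 W B N (xi : Omega -> R)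
    (f1 : R -> Omega -> R -> R -> (R -> R) -> R -> R)
    (X Y : R -> Omega -> R) (Z : R -> Omega -> R -> R)
    (zeta : R -> Omega -> R) : Prop :=
  let drift w s := f1 s w (X s w) (Y s w) (Z s w) (zeta s w) in
  [/\ S2T X, H2T Y, hatH2T Z, H2T zeta &
    exists IW IN IB, [/\ brownian_integral W Y IW, jump_integral N Z IN,
      brownian_integral B zeta IB &
      {ae P, forall w,
        mu.-integrable `[0, T] (EFin \o drift w) /\
        forall t, 0 <= t <= T ->
          X t w = xi w + \int[mu]_(s in `[t, T]) drift w s
                  - (IW T w - IW t w) - (IN T w - IN t w)
                  - (IB T w - IB t w)}]].

End spaces.

(* Main.v *)
Require Import Defs.
From mathcomp Require Import all_boot all_order all_algebra.
From mathcomp Require Import all_classical all_reals all_analysis.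
From mathcomp Require Import measurable_realfun.
From HB Require Import structures.
From mathcomp Require Import ring lra.
Import Order.TTheory GRing.Theory Num.Theory.
Import numFieldNormedType.Exports.
Local Open Scope classical_set_scope.
Local Open Scope ring_scope.
Set Implicit Arguments.
Unset Strict Implicit.
Unset Printing Implicit Defensive.

(** Let x be the difference of the two first components, u the difference of the
    integrands, g that of the drifts and M the martingale part, all seen in the
    larger filtration G.  The two Lipschitz comparisons give g^2 <= K (x^2 + |u|^2)
    with K = 4 C0^2.
    On an interval [a, b] of length h put U_t = x_a + M_t - M_a.  Then x_t + int_[a,t] g
    = U_t, so that |U - x|^2 <= r := h K (h sup x^2 + int_[a,b] |u|^2) pathwise.
    Orthogonality of martingale increments and the isometry, applied to elementary
    integrands approximating u, give
      E int_[a,b] |u|^2 <= 4 E (M_b - M_a)^2 <= 4 E U_b^2 <= 8 E x_b^2 + 8 E r,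
    and Doob's inequality on dyadic grids gives
      E sup_[a,b] x^2 <= 8 E U_b^2 + 2 E r <= 16 E x_b^2 + 18 E r.
    When 52 h K <= 1 and h <= 1 the terms in r are absorbed, whence
    E sup_[a,b] x^2 <= 48 E x_b^2; iterating backwards from T over a mesh depending
    only on T and C0 yields the constant 49^n.  No Ito formula is needed. *)

(** * Integrable and square integrable random variables *)

(** The obstacle is how little is known about a stochastic integral: it is an adapted cadlag process
    which, at each fixed time, is an L2 limit of elementary integrals. Everything about M is
    therefore extracted from approximations at two times: orthogonality of increments to the past,
    and a bound on the energy of the integrand. The factor 4 in that bound, where the isometry has
    1, is the price of two uses of (p + q)^2 <= 2 p^2 + 2 q^2; any constant independent of h would
    do. The original solution and the one with rho = 1 live in different filtrations. In G the
    increments of W, B and N after a time s are independent of the past, so a process adapted to F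
    keeps its martingale part when F is enlarged to G. Completeness of P makes null sets measurable,
    and with them the supremum over an interval, which agrees almost surely with a supremum over
    dyadic points. The left side can be absorbed only because it is finite, which is where
    membership in S2T is used. In the iteration 49 is 48 + 1: the new interval plus the part already
    treated. *)

Section expectation.
Context (R : realType) (d : measure_display) (Omega : measurableType d).
Variable P : probability Omega R.
Implicit Types f g c : Omega -> R.

Definition L1 f : Prop := P.-integrable setT (EFin \o f).
Definition L2 f : Prop := measurable_fun setT f /\ L1 (fun w => f w ^+ 2).
Definition bdd f : Prop := exists K : R, forall w, `|f w| <= K.
(** Real valued, hence a default value when the integral is infinite or undefined; this is why the
    linear rules below carry [L1] hypotheses. *)
Definition E f : R := \int[P]_w f w.

Lemma L1_measurable f : L1 f -> measurable_fun setT f.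
Proof. by move/(measurable_int P)/measurable_EFinP. Qed.

Lemma L1_le f g : measurable_fun setT f -> (forall w, `|f w| <= `|g w|) ->
  L1 g -> L1 f.
Proof.
move=> mf fg; apply: le_integrable => //; first exact/measurable_EFinP.
by move=> w _ /=; rewrite lee_fin.
Qed.

Lemma L1_cst (k : R) : L1 (fun=> k).
Proof. exact: finite_measure_integrable_cst. Qed.

Lemma L1D f g : L1 f -> L1 g -> L1 (fun w => f w + g w).
Proof. exact: integrableD. Qed.

Lemma L1N f : L1 f -> L1 (fun w => - f w).
Proof. exact: integrableN. Qed.

Lemma L1B f g : L1 f -> L1 g -> L1 (fun w => f w - g w).
Proof. by move=> L1f L1g; exact/L1D/L1N. Qed.

Lemma L1Z (k : R) f : L1 f -> L1 (fun w => k * f w).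
Proof. exact: integrableZl. Qed.

Lemma ED f g : L1 f -> L1 g -> E (fun w => f w + g w) = E f + E g.
Proof. exact: RintegralD. Qed.

Lemma EB f g : L1 f -> L1 g -> E (fun w => f w - g w) = E f - E g.
Proof. exact: RintegralB. Qed.

Lemma EZ (k : R) f : L1 f -> E (fun w => k * f w) = k * E f.
Proof. exact: RintegralZl. Qed.

Lemma E_cst (k : R) : E (fun=> k) = k.
Proof. by rewrite /E Rintegral_cst// (congr1 fine (probability_setT P)) mulr1. Qed.

Lemma E_ge0 f : (forall w, 0 <= f w) -> 0 <= E f.
Proof. by move=> f0; exact: Rintegral_ge0. Qed.

Lemma E_le f g : L1 f -> L1 g -> (forall w, f w <= g w) -> E f <= E g.
Proof. by move=> L1f L1g fg; exact: le_Rintegral. Qed.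

Lemma E_EFin f : L1 f -> (E f)%:E = (\int[P]_w (f w)%:E)%E.
Proof. by move=> L1f; rewrite fineK//; exact: integrable_fin_num. Qed.

Lemma ge0_L1 f : measurable_fun setT f -> (forall w, 0 <= f w) ->
  (\int[P]_w (f w)%:E < +oo)%E -> L1 f.
Proof.
move=> mf f0 fi; apply/integrableP; split; first exact/measurable_EFinP.
by under eq_integral => w _ do rewrite /= ger0_norm//.
Qed.

Lemma L1_ae f g : measurable_fun setT g -> {ae P, forall w, f w = g w} ->
  L1 f -> L1 g.
Proof.
move=> mg fg L1f; apply/integrableP; split; first exact/measurable_EFinP.
move/integrableP: (L1f) => [mf]; apply: le_lt_trans.
rewrite le_eqVlt; apply/orP; left; apply/eqP.
apply: ge0_ae_eq_integral => //.
- by apply: measurableT_comp => //; exact/measurable_EFinP.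
- exact: measurableT_comp.
- by apply: filterS fg => w /= ->.
Qed.

Lemma E_ae f g : measurable_fun setT f -> measurable_fun setT g ->
  {ae P, forall w, f w = g w} -> E f = E g.
Proof.
move=> mf mg fg; rewrite /E /Rintegral; congr fine.
apply: ae_eq_integral => //; [exact/measurable_EFinP..|].
by apply: filterS fg => w /= ->.
Qed.

Lemma L2_measurable f : L2 f -> measurable_fun setT f.
Proof. by case. Qed.

Lemma L2_sqr f : L2 f -> L1 (fun w => f w ^+ 2).
Proof. by case. Qed.

Lemma L2M f g : L2 f -> L2 g -> L1 (fun w => f w * g w).
Proof.
move=> [mf f2] [mg g2].
apply: (@L1_le _ (fun w => f w ^+ 2 + g w ^+ 2)).
- exact: measurable_funM.
- move=> w; rewrite [leRHS]ger0_norm ?addr_ge0 ?sqr_ge0// normrM.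
  rewrite -(real_normK (num_real (f w))) -(real_normK (num_real (g w))).
  have := sqr_ge0 (`|f w| - `|g w|).
  have := mulr_ge0 (normr_ge0 (f w)) (normr_ge0 (g w)).
  nra.
- exact: L1D.
Qed.

Lemma L2_cst (k : R) : L2 (fun=> k).
Proof. by split; [exact: measurable_cst|exact: L1_cst]. Qed.

Lemma L2_L1 f : L2 f -> L1 f.
Proof.
move=> L2f; have := L2M L2f (L2_cst 1).
by under eq_fun do rewrite mulr1.
Qed.

Lemma L2D f g : L2 f -> L2 g -> L2 (fun w => f w + g w).
Proof.
move=> L2f L2g; split; first exact: measurable_funD L2f.1 L2g.1.
have -> : (fun w => (f w + g w) ^+ 2) =
  (fun w => f w ^+ 2 + (2 * (f w * g w) + g w ^+ 2)).
  by apply/funext => w; ring.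
by apply: L1D (L2_sqr L2f) _; apply: L1D (L2_sqr L2g); exact/L1Z/L2M.
Qed.

Lemma L2Z (k : R) f : L2 f -> L2 (fun w => k * f w).
Proof.
move=> L2f; split; first exact: measurable_funM (measurable_cst _) L2f.1.
under eq_fun do rewrite exprMn; exact/L1Z/L2_sqr.
Qed.

Lemma L2N f : L2 f -> L2 (fun w => - f w).
Proof. by move/(L2Z (-1)); under eq_fun do rewrite mulN1r. Qed.

Lemma L2B f g : L2 f -> L2 g -> L2 (fun w => f w - g w).
Proof. by move=> L2f L2g; exact/L2D/L2N. Qed.

Lemma bdd_L2 f : measurable_fun setT f -> bdd f -> L2 f.
Proof.
move=> mf [K fK]; split=> //.
apply: (@L1_le _ (fun=> K ^+ 2)) (L1_cst _); first exact: measurable_funX.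
move=> w; rewrite !normrX ler_pXn2r ?nnegrE//.
by rewrite (le_trans (fK w))// ler_norm.
Qed.

Lemma L1_bddM c f : measurable_fun setT c -> bdd c -> L1 f ->
  L1 (fun w => c w * f w).
Proof.
move=> mc [K cK] L1f.
apply: (@L1_le _ (fun w => K * f w)).
- exact: measurable_funM mc (L1_measurable L1f).
- move=> w; rewrite !normrM ler_wpM2r//.
  by rewrite (le_trans (cK w))// ler_norm.
- exact: L1Z.
Qed.

Lemma L2_bddM c f : measurable_fun setT c -> bdd c -> L2 f ->
  L2 (fun w => c w * f w).
Proof.
move=> mc [K cK] [mf f2]; split; first exact: measurable_funM.
have -> : (fun w => (c w * f w) ^+ 2) = (fun w => c w ^+ 2 * f w ^+ 2).
  by apply/funext => w; rewrite exprMn.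
apply: L1_bddM => //; first exact: measurable_funX.
exists (K ^+ 2) => w; rewrite normrX lerXn2r ?nnegrE//.
exact: le_trans (cK w).
Qed.

Lemma bddM f g : bdd f -> bdd g -> bdd (fun w => f w * g w).
Proof.
move=> [K fK] [L gL]; exists (K * L) => w.
by rewrite normrM ler_pM.
Qed.

Lemma L1_sum n (f : 'I_n -> Omega -> R) : (forall i, L1 (f i)) ->
  L1 (fun w => \sum_(i < n) f i w).
Proof.
elim: n f => [|n IH] f L1f.
  by under eq_fun do rewrite big_ord0; exact: L1_cst.
under eq_fun do rewrite big_ord_recr /=.
by apply: L1D => //; exact: IH.
Qed.

Lemma E_sum n (f : 'I_n -> Omega -> R) : (forall i, L1 (f i)) ->
  E (fun w => \sum_(i < n) f i w) = \sum_(i < n) E (f i).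
Proof.
elim: n f => [|n IH] f L1f.
  by under eq_fun do rewrite big_ord0; rewrite big_ord0 E_cst.
under eq_fun do rewrite big_ord_recr /=.
by rewrite ED ?IH ?big_ord_recr//; exact: L1_sum.
Qed.

Lemma L2_sum n (f : 'I_n -> Omega -> R) : (forall i, L2 (f i)) ->
  L2 (fun w => \sum_(i < n) f i w).
Proof.
elim: n f => [|n IH] f L2f.
  by under eq_fun do rewrite big_ord0; exact: L2_cst.
under eq_fun do rewrite big_ord_recr /=.
by apply: L2D => //; exact: IH.
Qed.

Lemma L2_ae f g : measurable_fun setT g -> {ae P, forall w, f w = g w} ->
  L2 f -> L2 g.
Proof.
move=> mg fg [mf f2]; split=> //; apply: L1_ae f2; first exact: measurable_funX.
by apply: filterS fg => w ->.
Qed.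

Section independence.
Variables (c g : Omega -> R).
Hypotheses (L1c : L1 c) (L1g : L1 g).
Hypothesis indep : forall A B, measurable A -> measurable B ->
  P (c @^-1` A `&` g @^-1` B) = (P (c @^-1` A) * P (g @^-1` B))%E.

Let cX : {mfun Omega >-> R} := mfun_Sub (mem_set (L1_measurable L1c)).
Let gX : {mfun Omega >-> R} := mfun_Sub (mem_set (L1_measurable L1g)).

Let mcg : measurable_fun setT (fun w => (c w, g w)).
Proof. by apply/measurable_fun_pair => //; exact: L1_measurable. Qed.

Let cgX : {mfun Omega >-> (R * R)%type} := mfun_Sub (mem_set mcg).

(** Independence says that the joint law and the product of the marginals agree on rectangles, and
    rectangles determine a product measure. Expectations of [c w * g w] thus become iterated
    integrals. *)
Let pushE (A : set (R * R)) : measurable A ->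
  (distribution P cX \x distribution P gX)%E A = distribution P cgX A.
Proof.
by move=> mA; apply: product_measure_unique => // B C mB mC; exact: indep.
Qed.

Let mprod : measurable_fun setT (fun z : R * R => (z.1 * z.2)%:E).
Proof. by apply/measurable_EFinP/measurable_funM. Qed.

(** By Tonelli the mean of |c g| is the product of the means of |c| and |g|. Integrable factors
    suffice, which matters when [g] is the square of an increment. *)
Lemma indep_L1M : L1 (fun w => c w * g w).
Proof.
apply/integrableP; split.
  by apply/measurable_EFinP/measurable_funM; exact: L1_measurable.
rewrite -[ltLHS](@ge0_integral_distribution _ _ _ _ _ P cgX
  (fun z => `|(z.1 * z.2)%:E|%E))//; last exact: measurableT_comp.
rewrite (eq_measure_integral (distribution P cX \x distribution P gX)%E); last first.
  by move=> A mA _; exact: esym (pushE mA).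
rewrite fubini_tonelli1//; last exact: measurableT_comp.
rewrite /fubini_F /=.
have mabs : measurable_fun setT (fun y : R => `|y|%:E).
  by apply/measurable_EFinP; exact: normr_measurable.
have gi : (\int[distribution P gX]_y `|y|%:E < +oo)%E.
  rewrite ge0_integral_distribution//.
  by move/integrableP : L1g => [_].
under eq_integral => x _.
  under eq_integral => y _ do rewrite normrM EFinM.
  rewrite ge0_integralZl//.
  over.
rewrite ge0_integralZr//=; last exact: integral_ge0.
rewrite ge0_integral_distribution//.
move/integrableP : L1c => [_ ci].
have i0 : (0 <= \int[P]_x ((fun y => `|y|%:E) \o cX) x)%E.
  by apply: integral_ge0 => x _ /=; rewrite lee_fin.
by apply: lte_mul_pinfty; rewrite ?ge0_fin_numE.
Qed.

Lemma indep_EM : E (fun w => c w * g w) = E c * E g.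
Proof.
have L1m : (distribution P cX \x distribution P gX)%E.-integrable setT
    (fun z : R * R => (z.1 * z.2)%:E).
  apply/integrableP; split => //.
  rewrite (eq_measure_integral (distribution P cgX)); last first.
    by move=> A mA _; exact: pushE.
  rewrite ge0_integral_distribution//; last exact: measurableT_comp.
  by move/integrableP : indep_L1M => [_].
apply: EFin_inj; rewrite EFinM !E_EFin//; last exact: indep_L1M.
rewrite -[LHS](@integral_distribution _ _ _ _ _ P cgX
  (fun z => (z.1 * z.2)%:E))//; last exact: indep_L1M.
rewrite (eq_measure_integral (distribution P cX \x distribution P gX)%E); last first.
  by move=> A mA _; exact: esym (pushE mA).
rewrite -integral12_prod_meas1//=.
have iy (X : {mfun Omega >-> R}) : L1 X ->
    (distribution P X).-integrable setT (fun y => y%:E).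
  move=> L1X; apply: integrable_pushforward => //.
  exact/measurable_EFinP.
under eq_integral => x _.
  rewrite /fubini_F /=.
  under eq_integral => y _ do rewrite EFinM.
  rewrite integralZl//; last exact: iy.
  rewrite integral_distribution//.
  rewrite -[X in (_ * X)%E]/(\int[P]_w (g w)%:E)%E -E_EFin//.
  over.
rewrite integralZr//; last exact: iy.
rewrite integral_distribution//.
by rewrite -(E_EFin L1c) -(E_EFin L1g).
Qed.

End independence.

End expectation.

(** * Moments of Gaussian and Poisson variables *)

Section gaussian_moments.
Context (R : realType) (s : R) (s0 : 0 < s).
Local Notation mu := (@lebesgue_measure R).
Local Notation p := (normal_pdf 0 s).

Let sn0 : s != 0. Proof. by rewrite gt_eqF. Qed.

Let pE x : p x = normal_peak s * expR (- (x ^+ 2 / (s ^+ 2 *+ 2))).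
Proof. by rewrite normal_pdfE// /normal_fun subr0 mulNr. Qed.

Let p_even x : p (- x) = p x.
Proof. by rewrite !pE sqrrN. Qed.

(** The symmetry from which the zero mean is deduced later, in place of a first moment integral. *)
Lemma normal_probN (A : set R) : measurable A ->
  normal_prob 0 s (-%R @^-1` A) = normal_prob 0 s A.
Proof.
move=> mA; rewrite /normal_prob.
transitivity (\int[pushforward mu (-%R : _ -> measurableTypeR R)]_(x in A)
    (p x)%:E)%E; last first.
  by apply: eq_measure_integral => B mB _; exact: lebesgue_measureN.
rewrite ge0_integral_pushforward//=.
- by apply: eq_integral => x _ /=; rewrite p_even.
- by apply/measurable_EFinP/measurable_funTS; exact: measurable_normal_pdf.
- by move=> y _; rewrite lee_fin normal_pdf_ge0.
Qed.

(** Change of variables holds for the Radon-Nikodym derivative; it has the same integral as the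
    explicit density over every measurable set, so the two agree almost everywhere. *)
Lemma ge0_integral_normal_prob (f : R -> \bar R) :
  measurable_fun setT f -> (forall x, 0 <= f x)%E ->
  (\int[normal_prob 0 s]_x f x = \int[mu]_x (f x * (p x)%:E))%E.
Proof.
move=> mf f0.
have dom := normal_prob_dominates 0 s.
rewrite -(Radon_Nikodym_SigmaFinite.change_of_variables dom f0)//.
have mg := measurable_int _ (Radon_Nikodym_SigmaFinite.f_integrable dom).
apply: ge0_ae_eq_integral => //.
- exact: emeasurable_funM.
- apply: emeasurable_funM => //; apply/measurable_EFinP.
  exact: measurable_normal_pdf.
- by move=> x _; rewrite mule_ge0// Radon_Nikodym_SigmaFinite.f_ge0.
- by move=> x _; rewrite mule_ge0// lee_fin normal_pdf_ge0.
apply: ae_eqe_mul2l.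
apply: integral_ae_eq => //.
- exact: Radon_Nikodym_SigmaFinite.f_integrable.
- by apply/measurable_EFinP; exact: measurable_normal_pdf.
- by move=> A _ mA; rewrite -Radon_Nikodym_SigmaFinite.f_integral.
Qed.

(** An antiderivative of [(x ^+ 2 - s ^+ 2) * p x]: on a bounded interval it expresses the second
    moment by the mass and a boundary term. *)
Let F (x : R) : R := - (s ^+ 2 * x * p x).

Let dp (x : R) : is_derive x 1 p (- (x / s ^+ 2) * p x).
Proof.
rewrite (_ : p = fun y => normal_peak s * expR (- (y ^+ 2 / (s ^+ 2 *+ 2))));
  last first.
  by apply/funext => y; exact: pE.
apply: is_derive_eq.
rewrite !scaler0 ?add0r ?addr0 /GRing.scale /=.
by field.
Qed.

Let dF (x : R) : is_derive x 1 F (x ^+ 2 * p x - s ^+ 2 * p x).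
Proof.
have dpx := dp x; rewrite /F; apply: is_derive_eq.
rewrite /GRing.scale /=.
by field.
Qed.

Let cp : continuous p. Proof. exact: continuous_normal_pdf. Qed.

Let cx2p : continuous (fun x : R => x ^+ 2 * p x : R).
Proof. by move=> x; apply: cvgM; [exact: sqr_continuous|exact: cp]. Qed.

Let mp : measurable_fun setT p. Proof. exact: measurable_normal_pdf. Qed.

Let mx2p : measurable_fun setT (fun x : R => x ^+ 2 * p x).
Proof. exact: continuous_measurable_fun. Qed.

Let I (n : nat) : set R := `[- n%:R, n%:R].

Let mI n : measurable (I n). Proof. exact: measurable_itv. Qed.

Let int_cc (n : nat) :
  (\int[mu]_(x in I n) (x ^+ 2 * p x)%:E =
   (s ^+ 2)%:E * \int[mu]_(x in I n) (p x)%:E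
   - (2 * s ^+ 2 * (n%:R * p n%:R))%:E)%E.
Proof.
(* The fundamental theorem is stated for nondegenerate intervals, hence the separate case n = 0. *)
have [->|n0] := posnP n.
  by rewrite /I oppr0 set_itv1 !integral_set1 mule0 mul0r mulr0 sube0.
have csp : continuous (fun x : R => s ^+ 2 * p x : R).
  by move=> x; apply: cvgM; [exact: cvg_cst|exact: cp].
have nn : - n%:R < n%:R :> R by rewrite gtrN ?ltr0n.
have ci (f : R -> R) : continuous f ->
    mu.-integrable (I n) (EFin \o f).
  move=> cf; apply: continuous_compact_integrable; first exact: segment_compact.
  exact: continuous_subspaceT.
have := @continuous_FTC2 R (fun x : R => x ^+ 2 * p x - s ^+ 2 * p x) F _ _ nn.
have -> : ((F n%:R)%:E - (F (- n%:R))%:E = - (2 * s ^+ 2 * (n%:R * p n%:R))%:E)%E.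
  by rewrite /F p_even -EFinB -EFinN; congr EFin; ring.
move=> <-; first last.
- by move=> x _; have dFx := dF x; rewrite derive1E; exact: derive_val.
- split.
  + by move=> x _; have dFx := dF x; exact: ex_derive.
  + apply: cvg_at_right_filter; apply: differentiable_continuous.
    by apply/derivable1_diffP; have dFx := dF (- n%:R); exact: ex_derive.
  + apply: cvg_at_left_filter; apply: differentiable_continuous.
    by apply/derivable1_diffP; have dFx := dF n%:R; exact: ex_derive.
- apply: continuous_subspaceT => x; apply: cvgB; first exact: cx2p.
  by apply: cvgM; [exact: cvg_cst|exact: cp].
rewrite -integralZl//; last exact: ci.
under [X in (_ = _ + X)%E]eq_integral do rewrite EFinB EFinM.
rewrite integralB//; last 2 first.
- exact: ci.
- exact: ci.
rewrite addeCA subee ?adde0//.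
by apply: integrable_fin_num; [exact: mI|apply: integrableZl; [exact: mI|exact: ci]].
exact: mI.
Qed.

(** The bound exp u >= u at u = n^2 / (2 s^2) makes the boundary term O(1/n). Since [harmonic k] is
    1/(k+1), the index is shifted by one. *)
Let peak_bound (n : nat) : n%:R * p n%:R <= 2 * s ^+ 2 * normal_peak s * harmonic n.-1.
Proof.
case: n => [|n].
  rewrite mul0r mulr_ge0 ?harmonic_ge0// mulr_ge0 ?normal_peak_ge0//.
  by rewrite mulr_ge0// sqr_ge0.
have n0 : 0 < n.+1%:R :> R by rewrite ltr0n.
have s2 : 0 < s ^+ 2 by rewrite exprn_gt0.
rewrite pE /harmonic/= expRN.
set u := n.+1%:R ^+ 2 / _.
have u0 : 0 < u by rewrite divr_gt0 ?exprn_gt0// pmulrn_lgt0.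
have : (expR u)^-1 <= u^-1.
  rewrite lef_pV2 ?posrE ?expR_gt0//.
  by apply: le_trans (expR_ge1Dx u); rewrite lerDr.
have -> : 2 * s ^+ 2 * normal_peak s * n.+1%:R^-1 =
    normal_peak s * (n.+1%:R * u^-1).
  by rewrite /u; field; rewrite !gt_eqF.
move=> h; rewrite mulrCA; apply: ler_wpM2l; first exact: normal_peak_ge0.
by apply: ler_wpM2l.
Qed.

Lemma integral_sqr_normal_prob :
  (\int[normal_prob 0 s]_x (x ^+ 2)%:E = (s ^+ 2)%:E)%E.
Proof.
rewrite ge0_integral_normal_prob//; last 2 first.
- by apply/measurable_EFinP; exact: measurable_funX.
- by move=> x; rewrite lee_fin sqr_ge0.
under eq_integral do rewrite -EFinM.
have UT : \bigcup_n I n = [set: R].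
  apply/seteqP; split => // x _; exists (Num.truncn `|x|).+1 => //=.
  by rewrite /I /= in_itv/= -ler_norml; exact/ltW/truncnS_gt.
have nd : nondecreasing_seq I.
  move=> m n mn; apply/subsetPset; apply: subset_itv; rewrite bnd_simp.
    by rewrite lerN2 ler_nat.
  by rewrite ler_nat.
have cvgf (f : R -> R) : measurable_fun setT f -> (forall x, 0 <= f x) ->
   (\int[mu]_(x in I n) (f x)%:E)%E @[n --> \oo] -->
   (\int[mu]_x (f x)%:E)%E.
  move=> mf f0; rewrite -UT; apply: ge0_nondecreasing_set_cvg_integral => //.
    by move=> i; apply/measurable_EFinP; exact: measurable_funTS.
  by move=> i x _; rewrite lee_fin.
have h1 := cvgf _ mx2p (fun x => mulr_ge0 (sqr_ge0 x) (normal_pdf_ge0 _ _ _)).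
have h2 := cvgf _ mp (fun x => normal_pdf_ge0 _ _ _).
rewrite integral_normal_pdf in h2.
suff h3 : (\int[mu]_(x in I n) (x ^+ 2 * p x)%:E)%E @[n --> \oo] -->
    ((s ^+ 2)%:E * 1 - 0)%E.
  by rewrite (cvg_unique _ h1 h3)//= mule1 sube0.
under eq_fun do rewrite int_cc.
apply: cvgeB => //; first exact: cvgeMl.
apply: cvg_EFin; first by near=> n.
apply: (@squeeze_cvgr _ _ _ _ (cst 0) (fun n => 2 * s ^+ 2 * (2 * s ^+ 2 * normal_peak s * harmonic n.-1))).
- near=> n; apply/andP; split.
    rewrite /= mulr_ge0//; first by rewrite mulr_ge0// sqr_ge0.
    by rewrite mulr_ge0// normal_pdf_ge0.
  apply: ler_wpM2l; last exact: peak_bound.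
  by rewrite mulr_ge0// sqr_ge0.
- exact: cvg_cst.
- rewrite -[X in _ --> X](mulr0 (2 * s ^+ 2)); apply: cvgM; first exact: cvg_cst.
  rewrite -[X in _ --> X](mulr0 (2 * s ^+ 2 * normal_peak s)); apply: cvgM;
    first exact: cvg_cst.
  rewrite -(cvg_shiftn 1)/=; under eq_fun do rewrite addn1/=.
  exact: cvg_harmonic.
Unshelve. all: by end_near. Qed.

End gaussian_moments.

Section law_transfer.
Context (R : realType) (d : measure_display) (Omega : measurableType d).
Variable P : probability Omega R.

Section gaussian.
Variables (g : Omega -> R) (s : R).
Hypotheses (mg : measurable_fun setT g) (s0 : 0 < s).
Hypothesis lawg : forall B, measurable B -> P (g @^-1` B) = normal_prob 0 s B.

Let gX : {mfun Omega >-> measurableTypeR R} :=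
  @mfun_Sub _ _ _ (measurableTypeR R) g (mem_set mg).

Let gaussian_int : (\int[P]_w (g w ^+ 2)%:E = (s ^+ 2)%:E)%E.
Proof.
rewrite -(@ge0_integral_distribution _ _ _ _ _ P gX (fun x => (x ^+ 2)%:E))//.
- rewrite -integral_sqr_normal_prob//; apply: eq_measure_integral => A mA _.
  exact: lawg.
- by apply/measurable_EFinP; exact: measurable_funX.
- by move=> x; rewrite lee_fin sqr_ge0.
Qed.

Lemma gaussian_L2 : L2 P g.
Proof.
split=> //; apply: ge0_L1; first exact: measurable_funX.
- by move=> w; exact: sqr_ge0.
- by rewrite gaussian_int ltry.
Qed.

Lemma gaussian_E_sqr : E P (fun w => g w ^+ 2) = s ^+ 2.
Proof. by rewrite /E /Rintegral gaussian_int. Qed.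

(** The variables g and -g have the same law, so the mean equals its opposite. *)
Lemma gaussian_E : E P g = 0.
Proof.
have L1g := L2_L1 gaussian_L2.
have L1Ng := L1N L1g.
suff: E P g = E P (fun w => - g w).
  under [in X in _ = X -> _]eq_fun do rewrite -mulN1r.
  by rewrite EZ// => h; lra.
apply: EFin_inj; rewrite !E_EFin//.
have push (h : Omega -> R) (L1h : L1 P h) : (\int[P]_w (h w)%:E =
    \int[distribution P (mfun_Sub (mem_set (L1_measurable L1h)) : {mfun Omega >-> R})]_y y%:E)%E.
  by rewrite integral_distribution//; exact/measurable_EFinP.
rewrite (push _ L1g) (push _ L1Ng).
apply: eq_measure_integral => A mA _.
change (P (g @^-1` A) = P (g @^-1` (-%R @^-1` A))).
have mNA : measurable (-%R @^-1` A : set R).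
  by rewrite -[X in measurable X]setTI; exact: oppr_measurable.
by rewrite lawg// -normal_probN// -lawg.
Qed.

End gaussian.

Section poisson_sums.
Variable l : R.
Hypothesis l0 : 0 <= l.
Let p (k : nat) : R := l ^+ k / k`!%:R * expR (- l).

Let p_ge0 k : 0 <= p k.
Proof. by rewrite /p mulr_ge0 ?expR_ge0// divr_ge0// exprn_ge0. Qed.

(** Each factor k in a moment is traded for a factor l and a shift of the index; the first two
    moments follow from the total mass. *)
Let pS k : k.+1%:R * p k.+1 = l * p k.
Proof.
rewrite /p exprS factS natrM.
have k1 : k.+1%:R != 0 :> R by rewrite pnatr_eq0.
have kf : k`!%:R != 0 :> R by rewrite pnatr_eq0 -lt0n fact_gt0.
move: k1 kf; move: (k.+1%:R : R) (k`!%:R : R) => a b a0 b0.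
by field; rewrite a0 b0.
Qed.

Lemma poisson_sum0 : (\sum_(k <oo) (p k)%:E = 1)%E.
Proof.
rewrite [RHS](_ : _ = (expR (- l))%:E * (expR l)%:E)%E; last first.
  by rewrite -EFinM expRN mulVf ?gt_eqF ?expR_gt0.
under eq_eseriesr do rewrite /p EFinM muleC.
rewrite /= nneseriesZl/=; last first.
  by move=> n _; rewrite lee_fin divr_ge0// exprn_ge0// ltW.
congr *%E; rewrite expRE -EFin_lim; last first.
  rewrite /pseries/=; under eq_fun do rewrite mulrC.
  exact: is_cvg_series_exp_coeff.
apply/congr_lim/funext => n/=; rewrite /pseries/= /series/= -sumEFin//.
by under eq_bigr do rewrite mulrC.
Qed.

Let shift (f : nat -> R) : (forall k, 0 <= f k) -> f 0%N = 0 ->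
  (\sum_(k <oo) (f k)%:E = \sum_(k <oo) (f k.+1)%:E)%E.
Proof.
move=> f0 f00; rewrite nneseries_recl//; last by move=> k _; rewrite lee_fin.
rewrite f00 add0e -(@nneseries_addn _ (fun k => (f k)%:E) 1)//.
by apply: eq_eseriesr => k _; rewrite addn1.
Qed.

Lemma poisson_sum1 : (\sum_(k <oo) (k%:R * p k)%:E = l%:E)%E.
Proof.
rewrite shift ?mul0r//; last by move=> k; rewrite mulr_ge0.
under eq_eseriesr do rewrite pS EFinM.
rewrite nneseriesZl ?poisson_sum0 ?mule1// => k _.
by rewrite lee_fin.
Qed.

Lemma poisson_sum2 : (\sum_(k <oo) (k%:R * (k%:R * p k))%:E = (l * (l + 1))%:E)%E.
Proof.
rewrite shift ?mul0r//; last by move=> k; rewrite mulr_ge0// mulr_ge0.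
under eq_eseriesr => k _.
  rewrite pS -natr1 mulrCA mulrDl mul1r EFinM EFinD.
  over.
rewrite nneseriesZl; last by move=> k _; rewrite adde_ge0// lee_fin// mulr_ge0.
rewrite nneseriesD; last 2 first.
- by move=> k _ _; rewrite lee_fin mulr_ge0.
- by move=> k _ _; rewrite lee_fin.
by rewrite poisson_sum0 poisson_sum1.
Qed.

End poisson_sums.

Section poisson.
Variables (g : Omega -> \bar R) (l : R).
Hypotheses (mg : measurable_fun setT g) (l0 : 0 <= l).
Let p (k : nat) : R := l ^+ k / k`!%:R * expR (- l).
Hypothesis lawg : forall k : nat, P [set w | g w = k%:R%:E] = (p k)%:E.

Let D k := [set w | g w = k%:R%:E].

Let mD k : measurable (D k).
Proof.
have := mg measurableT (emeasurable_set1 k%:R%:E); rewrite setTI.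
by congr measurable; apply/seteqP; split.
Qed.

Let tD : trivIset setT D.
Proof.
apply/trivIsetP => i j _ _ ij; apply/seteqP; split => // w [Di Dj].
have [] : i%:R%:E = j%:R%:E :> \bar R by rewrite -Di -Dj.
by move=> /eqP; rewrite eqr_nat (negbTE ij).
Qed.

Let U := \bigcup_k D k.

Let mU : measurable U. Proof. exact: bigcupT_measurable. Qed.

Let PU : P U = 1%E.
Proof.
rewrite measure_bigcup//= -[RHS](poisson_sum0 l0).
rewrite (@eq_eseriesl _ _ predT); last by move=> k; rewrite in_setT.
by apply: eq_eseriesr => k _; exact: lawg.
Qed.

Let PCU : P (~` U) = 0%E.
Proof. by rewrite probability_setC// PU subee. Qed.

(** The law is prescribed only at the natural numbers, but its weights there already sum to 1, so no
    mass is left for other values, +oo included. *)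
Lemma poisson_ae_nat : {ae P, forall w, exists k : nat, g w = k%:R%:E}.
Proof.
exists (~` U); split => //; first exact: measurableC.
by move=> w /= h [k _ Dk]; apply: h; exists k.
Qed.

Let poisson_int (phi : \bar R -> \bar R) : measurable_fun setT phi ->
  (forall x, 0 <= phi x)%E ->
  (\int[P]_w phi (g w) = \sum_(k <oo) (phi k%:R%:E * (p k)%:E))%E.
Proof.
move=> mphi phi0.
have mpg : measurable_fun setT (phi \o g) by exact: measurableT_comp.
rewrite (@ge0_negligible_integral _ _ _ P setT (~` U))//; last exact: measurableC.
rewrite setTD setCK ge0_integral_bigcup//; last exact: measurable_funTS.
apply: eq_eseriesr => k _.
rewrite (eq_integral (fun=> phi k%:R%:E)); last first.
  by move=> w; rewrite inE => /= ->.
by rewrite integral_cst//; congr (_ * _)%E; exact: lawg.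
Qed.

Let h w := fine (g w).

Let mh : measurable_fun setT h. Proof. exact: measurableT_comp. Qed.

Lemma poisson_fine_L2 : L2 P h.
Proof.
split=> //; apply: ge0_L1; first exact: measurable_funX.
  by move=> w; exact: sqr_ge0.
rewrite (@poisson_int (fun x => (fine x ^+ 2)%:E)).
- under eq_eseriesr do rewrite /= -EFinM expr2 -mulrA.
  by rewrite poisson_sum2// ltry.
- by apply/measurable_EFinP/measurable_funX.
- by move=> x; rewrite lee_fin sqr_ge0.
Qed.

Let Eh2 : E P (fun w => h w ^+ 2) = l * (l + 1).
Proof.
rewrite /E /Rintegral (@poisson_int (fun x => (fine x ^+ 2)%:E)).
- under eq_eseriesr do rewrite /= -EFinM expr2 -mulrA.
  by rewrite poisson_sum2.
- by apply/measurable_EFinP/measurable_funX.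
- by move=> x; rewrite lee_fin sqr_ge0.
Qed.

Lemma poisson_E : E P h = l.
Proof.
(* The series formula is for nonnegative functions of [g]; the absolute value changes nothing almost
   surely. *)
transitivity (E P (fun w => `|h w|)).
  apply: E_ae => //; first exact: measurableT_comp.
  by apply: filterS poisson_ae_nat => w [k]; rewrite /h => -> /=; rewrite normr_nat.
rewrite /E /Rintegral (@poisson_int (fun x => (`|fine x|)%:E)).
- under eq_eseriesr do rewrite /= -EFinM normr_nat.
  by rewrite poisson_sum1.
- by apply/measurable_EFinP/measurableT_comp.
- by move=> x; rewrite lee_fin.
Qed.

Lemma poisson_variance : E P (fun w => (h w - l) ^+ 2) = l.
Proof.
have L2h := poisson_fine_L2.
have -> : (fun w => (h w - l) ^+ 2) = (fun w => h w ^+ 2 - ((2 * l) * h w - l ^+ 2)).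
  by apply/funext => w; ring.
have L1h := L2_L1 L2h.
have LA := L1Z (2 * l) L1h.
have LB := L1_cst P (l ^+ 2).
by rewrite (EB (L2_sqr L2h) (L1B LA LB)) (EB LA LB) EZ// E_cst Eh2 poisson_E; ring.
Qed.

End poisson.

End law_transfer.

(** * Sub-sigma-algebras and independence *)

Section sub_sigma_algebras.
Context (R : realType) (d : measure_display) (Omega : measurableType d).
Implicit Types (S : set (set Omega)) (f g : Omega -> R).

(** Measurability with respect to the sigma-algebra generated by [S]; the parameter may be a bare
    generating family as well as a member of a filtration. *)
Definition mwrt S f := @measurable_fun _ _ (g_sigma_algebraType S) R setT f.

Lemma mwrt_preimage S f (B : set R) : mwrt S f -> measurable B ->
  <<s S >> (f @^-1` B).
Proof. by move=> mf mB; have := mf measurableT B mB; rewrite setTI. Qed.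

Lemma mwrt_sub S S' f : S `<=` <<s S' >> -> mwrt S f -> mwrt S' f.
Proof.
move=> SS' mf _ B mB; rewrite setTI; change (<<s S' >> (f @^-1` B)).
apply: (smallest_sub (smallest_sigma_algebra _ _) SS').
exact: mwrt_preimage.
Qed.

Lemma mwrtP S f : (forall B : set R, measurable B -> <<s S >> (f @^-1` B)) ->
  mwrt S f.
Proof. by move=> Sf _ B mB; rewrite setTI; exact: Sf. Qed.

Lemma mwrt_measurable S f : S `<=` measurable -> mwrt S f ->
  measurable_fun setT f.
Proof.
move=> SM mf _ B mB; rewrite setTI.
apply: (smallest_sub (@sigma_algebra_measurable _ Omega) SM).
exact: mwrt_preimage.
Qed.

Lemma mwrtM S f g : mwrt S f -> mwrt S g -> mwrt S (fun w => f w * g w).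
Proof. exact: measurable_funM. Qed.

Lemma mwrtD S f g : mwrt S f -> mwrt S g -> mwrt S (fun w => f w + g w).
Proof. exact: measurable_funD. Qed.

Lemma mwrtB S f g : mwrt S f -> mwrt S g -> mwrt S (fun w => f w - g w).
Proof. exact: measurable_funB. Qed.

Lemma mwrt_cst S (k : R) : mwrt S (fun=> k).
Proof. exact: measurable_cst. Qed.

Lemma smallestT S : <<s S >> setT.
Proof. exact: (@measurableT _ (g_sigma_algebraType S)). Qed.

Lemma smallestI S A B : <<s S >> A -> <<s S >> B -> <<s S >> (A `&` B).
Proof. exact: (@measurableI _ (g_sigma_algebraType S)). Qed.

Lemma smallest_gen_sub S S' : S `<=` <<s S' >> -> <<s S >> `<=` <<s S' >>.
Proof. exact: smallest_sub (smallest_sigma_algebra _ _). Qed.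

Lemma smallest_measurable S : S `<=` measurable -> <<s S >> `<=` measurable.
Proof. exact: smallest_sub (@sigma_algebra_measurable _ Omega). Qed.

End sub_sigma_algebras.

Section independence.
Context (R : realType) (d : measure_display) (Omega : measurableType d).
Variable P : probability Omega R.
Implicit Types (S G : set (set Omega)).

Definition indep_of S (D : set Omega) :=
  forall A, S A -> P (A `&` D) = (P A * P D)%E.

(** Dynkin's argument: for fixed [D] the events with the product property form a lambda-system. *)
Lemma indep_of_smallest G D : measurable D -> G `<=` measurable ->
  setI_closed G -> indep_of G D -> indep_of <<s G >> D.
Proof.
move=> mD Gm GI GD.
suff: <<s G >> `<=` [set A | measurable A /\ P (A `&` D) = (P A * P D)%E].
  by move=> h A /h[].
apply: lambda_system_subset => //; last by move=> A GA; split; [exact: Gm|exact: GD].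
have fD (A : set Omega) : measurable A -> P A \is a fin_num.
  by move=> mA; exact: fin_num_measure.
apply/dynkin_lambda_system; split.
- by split=> //; rewrite setTI probability_setT mul1e.
- move=> A [mA PA]; split; first exact: measurableC.
  have mAD : measurable (A `&` D) by exact: measurableI.
  have -> : ~` A `&` D = D `\` (A `&` D).
    by rewrite setDIr setDv setU0 setIC.
  rewrite measureD//; last by rewrite -ge0_fin_numE// fD.
  have -> : D `&` (A `&` D) = A `&` D by rewrite setIC -setIA setIid.
  rewrite [X in (_ - X)%E = _]PA probability_setC//.
  by rewrite muleBl ?mul1e ?fD// fin_num_adde_defr// fD.
- move=> F tF HF; split; first by apply: bigcupT_measurable => n; case: (HF n).
  rewrite setI_bigcupl measure_bigcup//; last 2 first.
  + by move=> k _; apply: measurableI => //; case: (HF k).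
  + by under eq_fun do rewrite setIC; exact: trivIset_setIl.
  rewrite measure_bigcup//; last by move=> k _; case: (HF k).
  have -> : (\sum_(k <oo | k \in setT) P (F k `&` D) =
     \sum_(k <oo | k \in setT) (fine (P D))%:E * P (F k))%E.
    by apply: eq_eseriesr => k _; case: (HF k) => _ ->; rewrite fineK ?fD// muleC.
  by rewrite nneseriesZl// fineK ?fD// muleC.
Qed.

Definition join4 S1 S2 S3 : set (set Omega) :=
  S1 `|` S2 `|` S3 `|` P.-negligible.

(* Intersections E1 E2 E3 of members of the three sigma-algebras, possibly
   intersected with a null set, form a pi-system generating their join with
   the null sets. *)
Lemma indep_of_join S1 S2 S3 D : measure_is_complete P -> measurable D ->
  S1 `<=` measurable -> S2 `<=` measurable -> S3 `<=` measurable ->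
  (forall E1 E2 E3, <<s S1 >> E1 -> <<s S2 >> E2 -> <<s S3 >> E3 ->
     P (E1 `&` E2 `&` E3 `&` D) = (P (E1 `&` E2 `&` E3) * P D)%E) ->
  indep_of <<s join4 S1 S2 S3 >> D.
Proof.
move=> cP mD mS1 mS2 mS3 hD.
pose G : set (set Omega) := [set A | exists E1 E2 E3 M, [/\ <<s S1 >> E1, <<s S2 >> E2,
  <<s S3 >> E3, M = setT \/ P.-negligible M & A = E1 `&` E2 `&` E3 `&` M]].
have mM M : M = setT \/ P.-negligible M -> measurable M.
  by move=> [->//|]; exact: cP.
have mE E1 E2 E3 : <<s S1 >> E1 -> <<s S2 >> E2 -> <<s S3 >> E3 ->
    measurable (E1 `&` E2 `&` E3).
  move=> h1 h2 h3; apply: measurableI; last exact: smallest_measurable h3.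
  by apply: measurableI; [exact: smallest_measurable h1|exact: smallest_measurable h2].
suff: indep_of <<s G >> D.
  move=> h A SA; apply: h; apply: smallest_gen_sub SA => {}A.
  move=> SA; apply: sub_sigma_algebra; case: SA => [[[SA|SA]|SA]|SA].
  - exists A, setT, setT, setT; split; [exact: sub_sigma_algebra|exact: smallestT|
      exact: smallestT|by left|by rewrite !setIT].
  - exists setT, A, setT, setT; split; [exact: smallestT|exact: sub_sigma_algebra|
      exact: smallestT|by left|by rewrite !setIT setTI].
  - exists setT, setT, A, setT; split; [exact: smallestT|exact: smallestT|
      exact: sub_sigma_algebra|by left|by rewrite !setIT setTI].
  - exists setT, setT, setT, A; split; [exact: smallestT|exact: smallestT|
      exact: smallestT|by right|by rewrite !setIT setTI].
apply: indep_of_smallest => //.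
- move=> _ [E1 [E2 [E3 [M [h1 h2 h3 hM ->]]]]].
  by apply: measurableI; [exact: mE|exact: mM].
- move=> _ _ [E1 [E2 [E3 [M [h1 h2 h3 hM ->]]]]] [E1' [E2' [E3' [M' [h1' h2' h3' hM' ->]]]]].
  exists (E1 `&` E1'), (E2 `&` E2'), (E3 `&` E3'), (M `&` M').
  split; [exact: smallestI|exact: smallestI|exact: smallestI| |].
  + case: hM => [->|hM]; first by rewrite setTI.
    right; exact: negligibleS hM.
  + by rewrite [in LHS]setIACA; congr (_ `&` _); rewrite setIACA; congr (_ `&` _);
      rewrite setIACA.
- move=> _ [E1 [E2 [E3 [M [h1 h2 h3 [->|hM] ->]]]]].
    by rewrite setIT; exact: hD.
  have null A : measurable A -> A `<=` M -> P A = 0%E.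
    move=> mA AM; apply: measure_negligible => //.
    exact: negligibleS AM hM.
  have mM' := mM _ (or_intror hM).
  have mEM : measurable (E1 `&` E2 `&` E3 `&` M).
    by apply: measurableI => //; exact: mE.
  rewrite (null (E1 `&` E2 `&` E3 `&` M))//.
  by rewrite mul0e null//; [exact: measurableI|move=> w [[]]].
Qed.

Lemma indep_of_E S c g : S `<=` measurable -> mwrt S c ->
  L1 P c -> L1 P g ->
  (forall B, measurable B -> indep_of <<s S >> (g @^-1` B)) ->
  L1 P (fun w => c w * g w) /\ E P (fun w => c w * g w) = E P c * E P g.
Proof.
move=> Sm Sc L1c L1g ind.
have h A B : measurable A -> measurable B ->
    P (c @^-1` A `&` g @^-1` B) = (P (c @^-1` A) * P (g @^-1` B))%E.
  by move=> mA mB; apply: ind => //; exact: mwrt_preimage.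
by split; [exact: indep_L1M|exact: indep_EM].
Qed.

End independence.

Lemma measurable_R0 (R : realType) : measurable (@R0 R).
Proof.
rewrite (_ : @R0 R = ~` [set 0]); first exact: measurableC.
by apply/seteqP; split => z /eqP.
Qed.

(** * Independence of the jump counts of disjoint sets *)

Section jump_independence.
Context (R : realType) (d : measure_display) (Omega : measurableType d).
Context (P : probability Omega R) (T : R) (ell : {measure set R -> \bar R}).
Variable N : R.-ker Omega ~> (R * R)%type.
Hypothesis hN : poisson_random_measure P T ell N.

Local Notation Q := (`[0, T] `*` @R0 R).

Lemma measurable_jump_count (A : set (R * R)) : measurable A ->
  measurable_fun setT (fun w => N w A).
Proof. by move=> mA; exact: measurable_kernel. Qed.

(** Events about jumps outside [D0] at any time in [0, T], later ones included. Such a large family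
    is needed for products of increments over the same time interval with different marks. *)
Definition jump_off (D0 : set (R * R)) : set (set Omega) :=
  [set E | exists A C, [/\ measurable A, A `<=` Q, A `&` D0 = set0,
     (intensity T ell A < +oo)%E /\ measurable C &
     E = compensated T ell N A @^-1` C]].

Section disjoint_family.
Variables (m : nat) (B : 'I_m -> set (R * R)) (D0 : set (R * R)).
Hypotheses (mB : forall j, measurable (B j)) (BQ : forall j, B j `<=` Q).
Hypotheses (tB : trivIset setT B) (mD0 : measurable D0) (D0Q : D0 `<=` Q).
Hypothesis BD0 : forall j, B j `&` D0 = set0.

Let V : set (set Omega) := [set E | exists2 C : 'I_m -> set (\bar R),
  (forall j, measurable (C j)) & E = [set w | forall j, C j (N w (B j))]].

Let mcount A (C : set (\bar R)) : measurable A -> measurable C ->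
  measurable [set w | C (N w A)].
Proof.
by move=> mA mC; have := measurable_jump_count mA measurableT mC; rewrite setTI.
Qed.

(** The product formula for Poisson counts is used twice, for the sets [B j] and for the same sets
    with [D0] added; comparing both gives the factorisation on the pi-system [V]. *)
Let indepV C : measurable C -> indep_of P <<s V >> [set w | C (N w D0)].
Proof.
move=> mC; apply: indep_of_smallest; first exact: mcount.
- move=> _ [K mK ->].
  have -> : [set w | forall j, K j (N w (B j))] =
      \bigcap_(j in [set: 'I_m]) [set w | K j (N w (B j))].
    by apply/seteqP; split => w /= h j; [move=> _; exact: h|exact: h].
  by apply: fin_bigcap_measurable => // j _; exact: mcount.
- move=> _ _ [K mK ->] [L mL ->]; exists (fun j => K j `&` L j).
    by move=> j; exact: measurableI.
  apply/seteqP; split => w /=; first by move=> [hK hL] j; split; [exact: hK|exact: hL].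
  by move=> h; split => j; case: (h j).
- move=> _ [K mK ->].
  (* [D0] takes index 0 and the family [B] is shifted by one. *)
  pose A' (i : 'I_m.+1) := if unlift ord0 i is Some j then B j else D0.
  pose C' (i : 'I_m.+1) := if unlift ord0 i is Some j then K j else C.
  have A'0 : A' ord0 = D0 by rewrite /A' unlift_none.
  have C'0 : C' ord0 = C by rewrite /C' unlift_none.
  have A'S j : A' (lift ord0 j) = B j by rewrite /A' liftK.
  have C'S j : C' (lift ord0 j) = K j by rewrite /C' liftK.
  have := hN.2 m.+1 A' C'.
  rewrite big_ord_recl A'0 C'0.
  under eq_bigr do rewrite A'S C'S.
  have := hN.2 m B K (fun j => conj (mB j) (@BQ j)) tB mK.
  have capE n (F : 'I_n -> set Omega) : \bigcap_i F i = [set w | forall i, F i w].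
    by apply/seteqP; split => w /= h i; [exact: h|move=> _; exact: h].
  rewrite !capE /= => <- h.
  rewrite muleC -h; last 3 first.
  + by move=> i; rewrite /A'; case: unliftP => [j _|_]; split.
  + apply/trivIsetP => i j _ _ ij; rewrite /A'.
    case: unliftP ij => [i' ->|->]; case: unliftP => [j' ->|->].
    * rewrite (inj_eq lift_inj) => ij; move/trivIsetP: tB; exact.
    * by move=> _; exact: BD0.
    * by move=> _; rewrite setIC; exact: BD0.
    * by rewrite eqxx.
  + by move=> i; rewrite /C'; case: unliftP => [j _|_].
  congr (P _); apply/seteqP; split => w /=.
  + by move=> [h1 h2] i; rewrite /A' /C'; case: unliftP => [j _|_]; [exact: h1|].
  + move=> h1; split; last by have := h1 ord0; rewrite A'0 C'0.
    by move=> j; have := h1 (lift ord0 j); rewrite A'S C'S.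
Qed.

(** The sets [A i] may overlap, but as unions of disjoint blocks they have counts that are sums of
    block counts, hence measurable for the sigma-algebra generated by [V]. *)
Lemma indep_unions n (A : 'I_n -> set (R * R)) (b : 'I_n -> pred 'I_m)
    (K : 'I_n -> set (\bar R)) C :
  (forall i, A i = \big[setU/set0]_(j < m | b i j) B j) ->
  (forall i, measurable (K i)) -> measurable C ->
  indep_of P [set E | E = [set w | forall i, K i (N w (A i))]]
    [set w | C (N w D0)].
Proof.
move=> AE mK mC _ ->; apply: (indepV mC).
have mN (j : 'I_m) : @measurable_fun _ _ (g_sigma_algebraType V) (\bar R) setT (fun w => N w (B j)).
  move=> _ Y mY; rewrite setTI; apply: sub_sigma_algebra.
  exists (fun i => if i == j then Y else setT); first by move=> i; case: ifP.
  apply/seteqP; split => w /=; first by move=> h i; case: eqP => [->|].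
  by move/(_ j); rewrite eqxx.
have mNA (i : 'I_n) : @measurable_fun _ _ (g_sigma_algebraType V) (\bar R) setT (fun w => N w (A i)).
  rewrite (_ : (fun w => N w (A i)) = (fun w => \sum_(j < m) (if b i j then N w (B j) else 0))%E).
    by apply: emeasurable_sum => j; case: (b i j); [exact: mN|exact: measurable_cst].
  apply/funext => w; rewrite AE measure_bigsetU_ord_cond//; first by rewrite big_mkcond.
  exact: sub_trivIset tB.
have -> : [set w | forall i, K i (N w (A i))] =
    \bigcap_(i in [set: 'I_n]) ((fun w => N w (A i)) @^-1` K i).
  by apply/seteqP; split => w /= h i; [move=> _; exact: h|exact: h].
apply: (@fin_bigcap_measurable _ (g_sigma_algebraType V)) => // i _.
by have := mNA i measurableT _ (mK i); rewrite setTI.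
Qed.

End disjoint_family.

(** The product formula speaks of disjoint sets, the generators of overlapping ones. Events about
    finitely many counts form a pi-system, and each finite family of sets is a family of unions of
    atoms. *)
Lemma indep_jump_off (D0 : set (R * R)) (C : set (\bar R)) :
  measurable D0 -> D0 `<=` Q -> measurable C ->
  indep_of P <<s jump_off D0 >> [set w | C (N w D0)].
Proof.
move=> mD0 D0Q mC.
have mcount A (K : set (\bar R)) : measurable A -> measurable K ->
    measurable [set w | K (N w A)].
  by move=> mA mK; have := measurable_jump_count mA measurableT mK; rewrite setTI.
pose G : set (set Omega) := [set E | exists n (A : 'I_n -> set (R * R)) (K : 'I_n -> set (\bar R)),
  [/\ forall i, measurable (A i), forall i, A i `<=` Q, forall i, A i `&` D0 = set0,
     forall i, measurable (K i) & E = [set w | forall i, K i (N w (A i))]]].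
suff: indep_of P <<s G >> [set w | C (N w D0)].
  move=> h E SE; apply: h; apply: smallest_gen_sub SE => E' [A [K [mA AQ AD [iA mK] ->]]]; apply: sub_sigma_algebra.
  (* Compensation is a deterministic shift, so an event about the compensated count is an event
     about the count. *)
  pose K' := (fun x => x - intensity T ell A)%E @^-1` K.
  exists 1%N, (fun=> A), (fun=> K'); split => //.
    move=> _; rewrite -[X in measurable X]setTI.
    have mB : measurable_fun setT (fun x : \bar R => x - intensity T ell A)%E.
      by apply: emeasurable_funB.
    exact: mB.
  apply/seteqP; split => w //=; last by move=> /(_ ord0).
apply: indep_of_smallest.
- exact: mcount.
- move=> _ [n [A [K [mA AQ AD mK ->]]]].
  have -> : [set w | forall j, K j (N w (A j))] =
      \bigcap_(j in [set: 'I_n]) [set w | K j (N w (A j))].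
    by apply/seteqP; split => w /= h j; [move=> _; exact: h|exact: h].
  by apply: fin_bigcap_measurable => // j _; exact: mcount.
- move=> _ _ [n1 [A1 [K1 [mA1 AQ1 AD1 mK1 ->]]]] [n2 [A2 [K2 [mA2 AQ2 AD2 mK2 ->]]]].
  exists (n1 + n2)%N, (fun i => match fintype.split i with inl j => A1 j | inr j => A2 j end),
    (fun i => match fintype.split i with inl j => K1 j | inr j => K2 j end).
  split; [by move=> i; case: (fintype.split i)..|].
  apply/seteqP; split => w /=.
    by move=> [h1 h2] i; case: (fintype.split i) => j; [exact: h1|exact: h2].
  move=> h; split => j.
    by have := h (lshift n2 j); rewrite (unsplitK (inl j)).
  by have := h (rshift n1 j); rewrite (unsplitK (inr j)).
- move=> _ [n [A [K [mA AQ AD mK ->]]]].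
  pose I := {ffun 'I_n -> bool}.
  (* The atoms, some possibly empty, of the algebra generated by the [A i] off [D0]; the atom of [f]
     is a block of [A i] when [f i] holds. *)
  pose at_ (f : I) := Q `&` ~` D0 `&` \bigcap_(i in [set: 'I_n]) (if f i then A i else ~` A i).
  have mat f : measurable (at_ f).
    apply: measurableI.
      apply: measurableI; last exact: measurableC.
      by apply: measurableX; [exact: measurable_itv|exact: measurable_R0].
    apply: fin_bigcap_measurable => // i _.
    by case: ifP => _ //; exact: measurableC.
  pose B (j : 'I_#|I|) := at_ (enum_val j).
  apply: (@indep_unions #|I| B D0 _ _ _ _ _ _ n A (fun i j => enum_val j i) K C _ mK mC) => //.
  + by move=> j; exact: mat.
  + by move=> j z [[]].
  + apply/trivIsetP => i j _ _ ij; apply/seteqP; split => // z [[_ hi] [_ hj]].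
    move: ij => /eqP; apply; apply: enum_val_inj; apply/ffunP => k.
    have := hi k Logic.I; have := hj k Logic.I.
    by case: (enum_val i k); case: (enum_val j k) => //=.
  + by move=> j; apply/seteqP; split => // z [[[]]].
  + move=> i; apply/seteqP; split => z.
    * move=> Az.
      pose f : I := [ffun k => `[< A k z >]].
      have fi : enum_val (enum_rank f) i by rewrite enum_rankK ffunE; apply/asboolP.
      rewrite (bigD1 (enum_rank f))//=; left.
      rewrite /B enum_rankK; split.
        split; first exact: AQ Az.
        by move=> Dz; have : (A i `&` D0) z by []; rewrite AD.
      by move=> k _; rewrite ffunE; case: asboolP.
    * elim/big_rec: _ => // j X /= bij IH [[_ Bz]|]; last exact: IH.
      by have := Bz i Logic.I; rewrite bij.
Qed.

End jump_independence.

Section products_of_sets.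
Variables U V : Type.

Lemma setXUr (A : set U) (C D : set V) :
  A `*` (C `|` D) = A `*` C `|` A `*` D.
Proof.
apply/seteqP; split => z /=; first by case=> ? []; [left|right].
by case=> -[? ?]; split => //; [left|right].
Qed.

Lemma setXUl (A C : set U) (D : set V) :
  (A `|` C) `*` D = A `*` D `|` C `*` D.
Proof.
apply/seteqP; split => z /=; first by case=> -[] ? ?; [left|right].
by case=> -[? ?]; split => //; [left|right].
Qed.

Lemma setXIr (A : set U) (C D : set V) :
  A `*` (C `&` D) = A `*` C `&` A `*` D.
Proof.
by apply/seteqP; split => z /=; [case=> ? [? ?]|case=> -[? ?] [? ?]].
Qed.

End products_of_sets.

(** * Increments of the noises *)

Section noise_structure.
Context (R : realType) (d : measure_display) (Omega : measurableType d).
Context (P : probability Omega R) (T : R) (ell : {measure set R -> \bar R}).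
Variables (W B : R -> Omega -> R) (N : R.-ker Omega ~> (R * R)%type).
Hypothesis hP : measure_is_complete P.
Hypothesis hW : brownian_motion P T W.
Hypothesis hB : brownian_motion P T B.
Hypothesis hN : poisson_random_measure P T ell N.
Hypothesis hWBN : independent_noises P T ell W B N.

Local Notation Q := (`[0, T] `*` @R0 R).
Local Notation G := (filtrationG P T ell W B N).
Local Notation gW := (gen_process W).
Local Notation gB := (gen_process B).
Local Notation gJ := (gen_jumps T ell N).
Local Notation mu := (@lebesgue_measure R).

Lemma gen_process_sub (X : R -> Omega -> R) s t : s <= t ->
  gen_process X s `<=` gen_process X t.
Proof.
move=> st E [u [C [/andP[u0 us] mC ->]]]; exists u, C; split=> //.
by rewrite u0 (le_trans us).
Qed.

Lemma gen_jumps_sub s t : s <= t -> gJ s `<=` gJ t.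
Proof.
move=> st E [A [C [mA AQ iA mC ->]]]; exists A, C; split=> // z /AQ[z1 z2].
split => //; move: z1; rewrite /= !in_itv/= => /andP[-> h].
exact: le_trans h st.
Qed.

Lemma gen_process_measurable X t : brownian_motion P T X -> t <= T ->
  gen_process X t `<=` measurable.
Proof.
move=> [mX _ _ _ _] tT E [u [C [/andP[u0 ut] mC ->]]].
have := mX u; rewrite u0 (le_trans ut)// => /(_ isT).
by move/(_ measurableT C mC); rewrite setTI.
Qed.

Lemma measurable_compensated A : measurable A ->
  measurable_fun setT (compensated T ell N A).
Proof.
by move=> mA; apply: emeasurable_funB => //; exact: measurable_jump_count.
Qed.

Lemma gen_jumps_measurable t : gJ t `<=` measurable.
Proof.
move=> E [A [C [mA AQ iA mC ->]]].
by have := measurable_compensated mA measurableT mC; rewrite setTI.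
Qed.

Lemma jump_off_measurable D0 : jump_off T ell N D0 `<=` measurable.
Proof.
move=> E [A [C [mA AQ AD [iA mC] ->]]].
by have := measurable_compensated mA measurableT mC; rewrite setTI.
Qed.

Lemma jump_off_sub D0 : jump_off T ell N D0 `<=` gJ T.
Proof. by move=> E [A [C [mA AQ AD [iA mC] ->]]]; exists A, C. Qed.

(** Completeness of P enters here: the negligible sets added to the filtration have to be events. *)
Lemma join4_measurable S1 S2 S3 : S1 `<=` measurable -> S2 `<=` measurable ->
  S3 `<=` measurable -> join4 P S1 S2 S3 `<=` measurable.
Proof.
by move=> h1 h2 h3 E [[[|]|]|]; [exact: h1|exact: h2|exact: h3|exact: hP].
Qed.

Lemma join4_sub S1 S2 S3 S1' S2' S3' : S1 `<=` S1' -> S2 `<=` S2' ->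
  S3 `<=` S3' -> join4 P S1 S2 S3 `<=` join4 P S1' S2' S3'.
Proof.
move=> h1 h2 h3 E [[[h|h]|h]|h];
  [by left; left; left; exact: h1|by left; left; right; exact: h2|
   by left; right; exact: h3|by right].
Qed.

Lemma G_sub s t : s <= t -> G s `<=` G t.
Proof.
move=> st; apply: smallest_gen_sub => E h; apply: sub_sigma_algebra; move: E h.
by apply: join4_sub; [exact: gen_process_sub|exact: gen_process_sub|
  exact: gen_jumps_sub].
Qed.

Lemma G_measurable t : t <= T -> G t `<=` measurable.
Proof.
move=> tT; apply: smallest_measurable; apply: join4_measurable;
  [exact: gen_process_measurable|exact: gen_process_measurable|
   exact: gen_jumps_measurable].
Qed.

Lemma mwrt_G_le s t (f : Omega -> R) : s <= t -> mwrt (G s) f -> mwrt (G t) f.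
Proof.
move=> st; apply: mwrt_sub; apply: subset_trans (G_sub st) _.
exact: sub_sigma_algebra.
Qed.

Lemma mwrt_G_measurable t (f : Omega -> R) : t <= T -> mwrt (G t) f -> measurable_fun setT f.
Proof. by move=> tT; apply: mwrt_measurable; exact: G_measurable. Qed.

Lemma G_sub_join t S1 S2 S3 : gW t `<=` S1 -> gB t `<=` S2 -> gJ t `<=` S3 ->
  G t `<=` <<s join4 P S1 S2 S3 >>.
Proof.
move=> h1 h2 h3; apply: smallest_gen_sub => E h; apply: sub_sigma_algebra.
by move: E h; exact: join4_sub.
Qed.

Lemma mwrt_process (X : R -> Omega -> R) u t : 0 <= u <= t -> mwrt (gen_process X t) (X u).
Proof.
by move=> ut; apply: mwrtP => C mC; apply: sub_sigma_algebra; exists u, C.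
Qed.

Lemma measurable_rectangle (s t : R) (A : set R) : measurable A ->
  measurable (`]s, t] `*` A).
Proof. by move=> mA; apply: measurableX => //; exact: measurable_itv. Qed.

Lemma rectangle_sub (s t : R) (A : set R) : 0 <= s -> t <= T -> A `<=` @R0 R ->
  `]s, t] `*` A `<=` Q.
Proof.
move=> s0 tT AR z [/=]; rewrite !in_itv/= => /andP[sz zt] Az.
by split; [apply/andP; split; [exact: ltW (le_lt_trans s0 sz)|exact: le_trans tT]|exact: AR].
Qed.

Lemma intensity_rectangle (s t : R) (A : set R) : 0 <= s -> s <= t -> t <= T ->
  measurable A -> A `<=` @R0 R ->
  intensity T ell (`]s, t] `*` A) = ((t - s)%:E * ell A)%E.
Proof.
move=> s0 st tT mA AR; rewrite /intensity.
transitivity (\int[mu]_(u in `[0%R, T]) (ell A * (\1_(`]s, t]%classic) u)%:E))%E.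
  apply: eq_integral => u _; rewrite indicE; case: (boolP (u \in _)) => ust.
    by rewrite in_xsectionX// mule1; congr (ell _); exact/setIidPl.
  by rewrite notin_xsectionX// set0I measure0 mule0.
rewrite ge0_integralZl//; last first.
  by apply/measurable_EFinP; apply: measurable_indic; exact: measurable_itv.
rewrite integral_indic// setIidl; last first.
  move=> u /=; rewrite !in_itv/= => /andP[su ut].
  by rewrite (le_trans s0 (ltW su)) (le_trans ut).
rewrite muleC; congr (_ * _)%E.
apply: etrans (lebesgue_measure_itv _) _; rewrite /= lte_fin.
by move: st; rewrite le_eqVlt => /predU1P[->|->//]; rewrite ltxx subrr.
Qed.

(** The three noises form one indexed family, with one jump noise for each set of jump sizes, so
    that a single isometry covers them all. *)
Inductive mark := MW | MB | MN of set R.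

(** For a jump mark [fine] gives 0 where the count is infinite. This is a null event, but because of
    it additivity in time and in the mark holds only almost surely. *)
Definition incr (i : mark) (s t : R) (w : Omega) : R :=
  match i with
  | MW => W t w - W s w
  | MB => B t w - B s w
  | MN A => fine (compensated T ell N (`]s, t] `*` A) w)
  end.

Definition valid (i : mark) : Prop :=
  if i is MN A then [/\ measurable A, A `<=` @R0 R & (ell A < +oo)%E] else True.

(** The covariance rate: over an interval of length h the increments of noises i and j have
    covariance [kap i j * h]. *)
Definition kap (i j : mark) : R :=
  match i, j with
  | MW, MW => 1
  | MB, MB => 1
  | MN A, MN A' => fine (ell (A `&` A'))
  | _, _ => 0
  end.

Local Notation SW s := (join4 P (gW s) (gB T) (gJ T)).
Local Notation SB s := (join4 P (gW T) (gB s) (gJ T)).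
Local Notation SJ D := (join4 P (gW T) (gB T) (jump_off T ell N D)).

(** The increment event is itself an event of the W-path, so mutual independence applies with and
    without it, and the independence of Brownian increments settles the W factor. The whole paths of
    B and N are kept in the past so that their increments over ]s, t] may serve as coefficients. *)
Lemma indep_W s t C : 0 <= s -> s < t -> t <= T -> measurable C ->
  indep_of P <<s SW s >> ((fun w => W t w - W s w) @^-1` C).
Proof.
move=> s0 st tT mC.
have sT : s <= T := le_trans (ltW st) tT.
have DT : <<s gW T >> ((fun w => W t w - W s w) @^-1` C).
  apply: mwrt_preimage mC; apply: mwrtB; apply: mwrt_process.
    by rewrite (le_trans s0 (ltW st)).
  by rewrite s0.
apply: indep_of_join => //; [|exact: gen_process_measurable|
  exact: gen_process_measurable|exact: gen_jumps_measurable|].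
  apply: smallest_measurable DT; exact: gen_process_measurable.
move=> E1 E2 E3 h1 h2 h3.
have h1T : <<s gW T >> E1.
  by apply: smallest_gen_sub h1 => E /(gen_process_sub sT)/sub_sigma_algebra; exact.
rewrite (hWBN h1T h2 h3).
have -> (X : set Omega) : E1 `&` E2 `&` E3 `&` X = (E1 `&` X) `&` E2 `&` E3.
  by rewrite (setIAC _ E3) (setIAC _ E2).
rewrite (hWBN (smallestI h1T DT) h2 h3).
case: hW => _ _ _ _ /(_ s t s0 st tT E1 C h1 mC) ->.
by rewrite -!muleA; congr (_ * _)%E; rewrite muleC -muleA.
Qed.

Lemma indep_B s t C : 0 <= s -> s < t -> t <= T -> measurable C ->
  indep_of P <<s SB s >> ((fun w => B t w - B s w) @^-1` C).
Proof.
move=> s0 st tT mC.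
have sT : s <= T := le_trans (ltW st) tT.
have DT : <<s gB T >> ((fun w => B t w - B s w) @^-1` C).
  apply: mwrt_preimage mC; apply: mwrtB; apply: mwrt_process.
    by rewrite (le_trans s0 (ltW st)).
  by rewrite s0.
apply: indep_of_join => //; [|exact: gen_process_measurable|
  exact: gen_process_measurable|exact: gen_jumps_measurable|].
  apply: smallest_measurable DT; exact: gen_process_measurable.
move=> E1 E2 E3 h1 h2 h3.
have h2T : <<s gB T >> E2.
  by apply: smallest_gen_sub h2 => E /(gen_process_sub sT)/sub_sigma_algebra; exact.
rewrite (hWBN h1 h2T h3).
have -> (X : set Omega) : E1 `&` E2 `&` E3 `&` X = E1 `&` (E2 `&` X) `&` E3.
  by rewrite setIAC -(setIA E1).
rewrite (hWBN h1 (smallestI h2T DT) h3).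
case: hB => _ _ _ _ /(_ s t s0 st tT E2 C h2 mC) ->.
by rewrite -!muleA; congr (_ * _)%E; congr (_ * _)%E; rewrite muleC.
Qed.

Lemma indep_J (D0 : set (R * R)) C : measurable D0 -> D0 `<=` Q ->
  (intensity T ell D0 < +oo)%E -> measurable C ->
  indep_of P <<s SJ D0 >> (compensated T ell N D0 @^-1` C).
Proof.
move=> mD0 D0Q iD0 mC.
have DT : <<s gJ T >> (compensated T ell N D0 @^-1` C).
  by apply: sub_sigma_algebra; exists D0, C.
apply: indep_of_join => //; [|exact: gen_process_measurable|
  exact: gen_process_measurable|exact: jump_off_measurable|].
  apply: smallest_measurable DT; exact: gen_jumps_measurable.
move=> E1 E2 E3 h1 h2 h3.
have h3T : <<s gJ T >> E3.
  by apply: smallest_gen_sub h3 => E /jump_off_sub/sub_sigma_algebra; exact.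
rewrite (hWBN h1 h2 h3T) -setIA (hWBN h1 h2 (smallestI h3T DT)).
rewrite -!muleA; congr (_ * _)%E; congr (_ * _)%E.
pose C' := (fun x => x - intensity T ell D0)%E @^-1` C.
have mC' : measurable C'.
  rewrite -[X in measurable X]setTI.
  have mB : measurable_fun setT (fun x : \bar R => x - intensity T ell D0)%E.
    by apply: emeasurable_funB.
  exact: mB.
exact: (indep_jump_off hN mD0 D0Q mC' h3).
Qed.

End noise_structure.

(** * Moments, orthogonality and covariances of increments *)

Section increments.
Context (R : realType) (d : measure_display) (Omega : measurableType d).
Context (P : probability Omega R) (T : R) (ell : {measure set R -> \bar R}).
Variables (W B : R -> Omega -> R) (N : R.-ker Omega ~> (R * R)%type).
Hypothesis hP : measure_is_complete P.
Hypothesis hW : brownian_motion P T W.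
Hypothesis hB : brownian_motion P T B.
Hypothesis hN : poisson_random_measure P T ell N.
Hypothesis hWBN : independent_noises P T ell W B N.

Local Notation Q := (`[0, T] `*` @R0 R).
Local Notation G := (filtrationG P T ell W B N).
Local Notation gW := (gen_process W).
Local Notation gB := (gen_process B).
Local Notation gJ := (gen_jumps T ell N).
Local Notation SW s := (join4 P (gW s) (gB T) (gJ T)).
Local Notation SB s := (join4 P (gW T) (gB s) (gJ T)).
Local Notation SJ D := (join4 P (gW T) (gB T) (jump_off T ell N D)).
Local Notation incr := (incr T ell W B N).
Let rect (s t : R) (A : set R) := `]s, t] `*` A.

Lemma intensity_rectangle_lty s t A : 0 <= s -> s <= t -> t <= T ->
  measurable A -> A `<=` @R0 R -> (ell A < +oo)%E ->
  (intensity T ell (rect s t A) < +oo)%E.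
Proof.
move=> s0 st tT mA AR eA; rewrite /rect intensity_rectangle//.
by rewrite lte_mul_pinfty// lee_fin subr_ge0.
Qed.

Lemma incr0 i s w : incr i s s w = 0.
Proof.
case: i => [||A] /=; [by rewrite subrr|by rewrite subrr|].
rewrite /compensated set_itv_ge ?bnd_simp ?ltxx// set0X measure0 /intensity.
under eq_integral do rewrite xsection0 set0I measure0.
by rewrite integral0 subee.
Qed.

Section rectangle_count.
Variables (s t : R) (A : set R).
Hypotheses (s0 : 0 <= s) (st : s <= t) (tT : t <= T).
Hypotheses (mA : measurable A) (AR : A `<=` @R0 R) (eA : (ell A < +oo)%E).

Let D := rect s t A.
Let l := fine (intensity T ell D).

Let iD : (intensity T ell D < +oo)%E. Proof. exact: intensity_rectangle_lty. Qed.

Let lE : l = (t - s) * fine (ell A).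
Proof.
rewrite /l /D /rect intensity_rectangle// fineM// ge0_fin_numE//.
Qed.

Let iE : intensity T ell D = l%:E.
Proof. by rewrite /l fineK// ge0_fin_numE// /D /rect intensity_rectangle// mule_ge0// lee_fin subr_ge0. Qed.

Let l0 : 0 <= l.
Proof. by rewrite lE mulr_ge0 ?subr_ge0// fine_ge0. Qed.

Let mD : measurable D. Proof. exact: measurable_rectangle. Qed.

Let DQ : D `<=` Q. Proof. exact: rectangle_sub. Qed.

Let mND := measurable_jump_count N mD.

Let law := hN.1 D mD DQ iD.

Lemma rectangle_count_ae_fin : {ae P, forall w, N w D \is a fin_num}.
Proof.
by apply: filterS (poisson_ae_nat mND l0 law) => w [k ->].
Qed.

Let cE : {ae P, forall w, fine (N w D) - l = incr (MN A) s t w}.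
Proof.
by apply: filterS rectangle_count_ae_fin => w fN; rewrite /= /compensated iE fineB.
Qed.

Let minc : measurable_fun setT (incr (MN A) s t).
Proof. by apply: measurableT_comp => //; exact: measurable_compensated. Qed.

Let L2N := poisson_fine_L2 mND l0 law.

Lemma jump_incr_L2 : L2 P (incr (MN A) s t).
Proof. by apply: L2_ae cE _ => //; apply: L2B => //; exact: L2_cst. Qed.

Let mfN : measurable_fun setT (fun w => fine (N w D) - l).
Proof. by apply: measurable_funB => //; exact: L2_measurable L2N. Qed.

Lemma jump_incr_E : E P (incr (MN A) s t) = 0.
Proof.
rewrite -(E_ae mfN minc cE) EB ?E_cst; last 2 first.
- exact: L2_L1.
- exact: L1_cst.
by rewrite (poisson_E mND l0 law) subrr.
Qed.

Lemma jump_incr_E_sqr :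
  E P (fun w => incr (MN A) s t w ^+ 2) = (t - s) * fine (ell A).
Proof.
rewrite -lE -(poisson_variance mND l0 law); apply/esym/E_ae.
- exact: measurable_funX.
- exact: measurable_funX.
- by apply: filterS cE => w ->.
Qed.

Lemma indep_jump_incr C : measurable C ->
  indep_of P <<s SJ D >> (incr (MN A) s t @^-1` C).
Proof.
move=> mC; have mf : measurable (fine @^-1` C : set (\bar R)).
  by rewrite -[X in measurable X]setTI; exact: (@fine_measurable R setT measurableT).
exact: (indep_J hP hW hB hN hWBN mD DQ iD mf).
Qed.

End rectangle_count.

Lemma jump_incr_mwrt_gen D0 s t A : 0 <= s -> s <= t -> t <= T ->
  measurable A -> A `<=` @R0 R -> (ell A < +oo)%E ->
  rect s t A `&` D0 = set0 -> mwrt (jump_off T ell N D0) (incr (MN A) s t).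
Proof.
move=> s0 st tT mA AR eA AD; apply: mwrtP => C mC; apply: sub_sigma_algebra.
exists (rect s t A), (fine @^-1` C); split => //.
- exact: measurable_rectangle.
- exact: rectangle_sub.
- split; first exact: intensity_rectangle_lty.
  by rewrite -[X in measurable X]setTI; exact: (@fine_measurable R setT measurableT).
Qed.

Lemma mwrt_G s (f : Omega -> R) S1 S2 S3 : gW s `<=` S1 -> gB s `<=` S2 ->
  gJ s `<=` S3 -> mwrt (G s) f -> mwrt (join4 P S1 S2 S3) f.
Proof. by move=> h1 h2 h3; apply: mwrt_sub; exact: G_sub_join. Qed.

Lemma incr_mwrt i s t : 0 <= s -> s <= t -> t <= T -> valid ell i ->
  mwrt (G t) (incr i s t).
Proof.
move=> s0 st tT vi.
have tt : 0 <= t <= t by rewrite (le_trans s0 st)/=.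
have ss : 0 <= s <= t by rewrite s0.
case: i vi => [_|_|A [mA AR eA]] /=.
- apply: (@mwrt_sub _ _ _ (gW t)); last by apply: mwrtB; exact: mwrt_process.
  by move=> E h; apply: sub_sigma_algebra; apply: sub_sigma_algebra; left; left; left.
- apply: (@mwrt_sub _ _ _ (gB t)); last by apply: mwrtB; exact: mwrt_process.
  by move=> E h; apply: sub_sigma_algebra; apply: sub_sigma_algebra; left; left; right.
- apply: mwrtP => C mC; apply: sub_sigma_algebra; apply: sub_sigma_algebra; left; right.
  exists (rect s t A), (fine @^-1` C); split => //.
  + exact: measurable_rectangle.
  + exact: rectangle_sub.
  + exact: intensity_rectangle_lty.
  + by rewrite -[X in measurable X]setTI; exact: (@fine_measurable R setT measurableT).
Qed.

Let lawW s t (s0 : 0 <= s) (st : s < t) (tT : t <= T) :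
  let X := fun w => W t w - W s w in
  measurable_fun setT X /\
  forall C, measurable C -> P (X @^-1` C) = normal_prob 0 (Num.sqrt (t - s)) C.
Proof.
case: hW => mW _ _ law _; split; last by move=> C mC; exact: law.
apply: measurable_funB; apply: mW; first by rewrite (le_trans s0 (ltW st)).
by rewrite s0 (le_trans (ltW st)).
Qed.

Let lawB s t (s0 : 0 <= s) (st : s < t) (tT : t <= T) :
  let X := fun w => B t w - B s w in
  measurable_fun setT X /\
  forall C, measurable C -> P (X @^-1` C) = normal_prob 0 (Num.sqrt (t - s)) C.
Proof.
case: hB => mB _ _ law _; split; last by move=> C mC; exact: law.
apply: measurable_funB; apply: mB; first by rewrite (le_trans s0 (ltW st)).
by rewrite s0 (le_trans (ltW st)).
Qed.

Lemma incr_L2 i s t : 0 <= s -> s <= t -> t <= T -> valid ell i ->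
  L2 P (incr i s t).
Proof.
move=> s0; rewrite le_eqVlt => /predU1P[<- tT _|st tT].
  rewrite (_ : incr i s s = fun=> 0); first exact: L2_cst.
  by apply/funext => w; exact: incr0.
have dt : 0 < Num.sqrt (t - s) by rewrite sqrtr_gt0 subr_gt0.
case: i => [_|_|A [mA AR eA]].
- by have [mX lX] := lawW s0 st tT; exact: gaussian_L2 mX dt lX.
- by have [mX lX] := lawB s0 st tT; exact: gaussian_L2 mX dt lX.
- exact: jump_incr_L2 (ltW st) _ _ _ _.
Qed.

Lemma incr_E i s t : 0 <= s -> s <= t -> t <= T -> valid ell i ->
  E P (incr i s t) = 0.
Proof.
move=> s0; rewrite le_eqVlt => /predU1P[<- tT _|st tT].
  rewrite (_ : incr i s s = fun=> 0); first exact: E_cst.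
  by apply/funext => w; exact: incr0.
have dt : 0 < Num.sqrt (t - s) by rewrite sqrtr_gt0 subr_gt0.
case: i => [_|_|A [mA AR eA]].
- by have [mX lX] := lawW s0 st tT; exact: gaussian_E mX dt lX.
- by have [mX lX] := lawB s0 st tT; exact: gaussian_E mX dt lX.
- exact: jump_incr_E (ltW st) _ _ _ _.
Qed.

(* The largest sigma-algebra (up to generators) known to be independent of the
   increment of the noise i over the interval ]s, t]. *)
Let past i s t := match i with
  | MW => SW s | MB => SB s | MN A => SJ (rect s t A) end.

Lemma past_measurable i s t : s <= T -> past i s t `<=` measurable.
Proof.
move=> sT; case: i => [||A] /=; apply: join4_measurable => //;
  try exact: gen_jumps_measurable; try exact: jump_off_measurable.
- exact: gen_process_measurable hW _.
- exact: gen_process_measurable hB _.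
- exact: gen_process_measurable hW _.
- exact: gen_process_measurable hB _.
- exact: gen_process_measurable hW _.
- exact: gen_process_measurable hB _.
Qed.

(** For a jump mark this rests on half-open intervals: sets with times in [0, s] do not meet []s,
    t]]*[A]. *)
Lemma G_sub_past i s t (f : Omega -> R) : s <= T -> mwrt (G s) f ->
  mwrt (past i s t) f.
Proof.
move=> sT; case: i => [||A]; apply: mwrt_G => //;
  try exact: gen_process_sub; try exact: gen_jumps_sub.
move=> E [D [C [mD DQ iD mC ->]]]; exists D, C; split => //.
- move=> z /DQ[z1 z2]; split => //; move: z1; rewrite /= !in_itv/= => /andP[-> h].
  exact: le_trans h sT.
- apply/seteqP; split => // z [/DQ[/= z1 _] [/= z2 _]].
  move: z1 z2; rewrite !in_itv/= => /andP[_ h1] /andP[h2 _].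
  by have := lt_le_trans h2 h1; rewrite ltxx.
Qed.

Lemma indep_past i s t C : 0 <= s -> s < t -> t <= T -> valid ell i ->
  measurable C -> indep_of P <<s past i s t >> (incr i s t @^-1` C).
Proof.
move=> s0 st tT vi mC; case: i vi => [_|_|A [mA AR eA]].
- exact: indep_W.
- exact: indep_B.
- by apply: indep_jump_incr => //; exact: ltW.
Qed.

(** The coefficient may contain the increment of another noise over the same interval, which is how
    cross covariances are shown to vanish. Independence requires s < t; for s = t the increment is
    0. *)
Lemma past_orth i s t c : 0 <= s -> s <= t -> t <= T -> valid ell i ->
  mwrt (past i s t) c -> L1 P c -> E P (fun w => c w * incr i s t w) = 0.
Proof.
move=> s0; rewrite le_eqVlt => /predU1P[<- tT _|st tT vi mc L1c].
  move=> _ _; rewrite (_ : (fun w => _) = fun=> 0); first exact: E_cst.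
  by apply/funext => w; rewrite incr0 mulr0.
have sT := le_trans (ltW st) tT.
have L1i : L1 P (incr i s t) by apply/L2_L1/incr_L2 => //; exact: ltW.
have [|_ ->] := indep_of_E (past_measurable sT) mc L1c L1i.
  by move=> C mC; exact: indep_past.
by rewrite incr_E ?mulr0//; exact: ltW.
Qed.

Lemma incr_orth i s t c : 0 <= s -> s <= t -> t <= T -> valid ell i ->
  mwrt (G s) c -> L1 P c -> E P (fun w => c w * incr i s t w) = 0.
Proof.
move=> s0 st tT vi mc L1c; apply: past_orth => //.
by apply: G_sub_past => //; exact: le_trans tT.
Qed.

Lemma past_sqr i s t c : 0 <= s -> s <= t -> t <= T -> valid ell i ->
  mwrt (G s) c -> L1 P c ->
  E P (fun w => c w * incr i s t w ^+ 2) = E P c * (kap ell i i * (t - s)).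
Proof.
move=> s0; rewrite le_eqVlt => /predU1P[<- tT _ _ _|st tT vi mc L1c].
  rewrite subrr !mulr0 (_ : (fun w => _) = fun=> 0); first exact: E_cst.
  by apply/funext => w; rewrite incr0 expr0n mulr0.
have sT := le_trans (ltW st) tT.
have L1i : L1 P (fun w => incr i s t w ^+ 2).
  by apply/L2_sqr/incr_L2 => //; exact: ltW.
have [|_ ->] := indep_of_E (@past_measurable i s t sT) (G_sub_past sT mc) L1c L1i.
  move=> C mC; apply: (@indep_past i s t ((fun x => x ^+ 2) @^-1` C)) => //.
  by rewrite -[X in measurable X]setTI;
    exact: (measurable_funX 2 (@measurable_id _ _ setT)).
congr (_ * _).
have dt : 0 < Num.sqrt (t - s) by rewrite sqrtr_gt0 subr_gt0.
case: i vi {L1i} => [_|_|A [mA AR eA]] /=.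
- have [mX lX] := lawW s0 st tT; rewrite mul1r (gaussian_E_sqr mX dt lX).
  by rewrite sqr_sqrtr// subr_ge0 ltW.
- have [mX lX] := lawB s0 st tT; rewrite mul1r (gaussian_E_sqr mX dt lX).
  by rewrite sqr_sqrtr// subr_ge0 ltW.
- by rewrite setIid mulrC (jump_incr_E_sqr s0 (ltW st)).
Qed.

Lemma compensated_setU D1 D2 w : measurable D1 -> measurable D2 ->
  D1 `&` D2 = set0 -> N w D1 \is a fin_num -> N w D2 \is a fin_num ->
  intensity T ell D1 \is a fin_num -> intensity T ell D2 \is a fin_num ->
  (intensity T ell (D1 `|` D2) = intensity T ell D1 + intensity T ell D2)%E ->
  fine (compensated T ell N (D1 `|` D2) w) =
  fine (compensated T ell N D1 w) + fine (compensated T ell N D2 w).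
Proof.
move=> m1 m2 D12 f1 f2 i1 i2 iE.
have e : N w (D1 `|` D2) = (fine (N w D1) + fine (N w D2))%:E.
  by rewrite EFinD !fineK//; exact: measureU.
rewrite /compensated iE e -(fineK f1) -(fineK f2) -(fineK i1) -(fineK i2).
by rewrite -!EFinD /=; ring.
Qed.

Lemma incr_MN_setU s t A1 A2 : 0 <= s -> s <= t -> t <= T ->
  valid ell (MN A1) -> valid ell (MN A2) -> A1 `&` A2 = set0 ->
  {ae P, forall w, incr (MN (A1 `|` A2)) s t w =
     incr (MN A1) s t w + incr (MN A2) s t w}.
Proof.
move=> s0 st tT [m1 R1 e1] [m2 R2 e2] A12.
have AR : A1 `|` A2 `<=` @R0 R by move=> z [/R1|/R2].
have mA := measurableU _ _ m1 m2.
have ts : 0 <= t - s by rewrite subr_ge0.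
have f1 := rectangle_count_ae_fin s0 st tT m1 R1 e1.
have f2 := rectangle_count_ae_fin s0 st tT m2 R2 e2.
apply: filterS2 f1 f2 => w f1 f2 /=; rewrite setXUr.
have ff (A : set R) : (ell A < +oo)%E -> ell A \is a fin_num by move=> ?;
  rewrite ge0_fin_numE.
apply: compensated_setU => //.
- exact: measurable_rectangle.
- exact: measurable_rectangle.
- by rewrite -setXIr A12 setX0.
- by rewrite intensity_rectangle// fin_numM// ff.
- by rewrite intensity_rectangle// fin_numM// ff.
- rewrite -setXUr !intensity_rectangle// measureU// muleDr//.
  by rewrite ge0_adde_def// inE.
Qed.

Lemma incr_add i s t u : 0 <= s -> s <= t -> t <= u -> u <= T -> valid ell i ->
  {ae P, forall w, incr i s u w = incr i s t w + incr i t u w}.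
Proof.
move=> s0 st tu uT; case: i => [_|_|A [mA AR eA]].
- by apply: aeW => w /=; ring.
- by apply: aeW => w /=; ring.
- have f1 := rectangle_count_ae_fin s0 st (le_trans tu uT) mA AR eA.
  have f2 := rectangle_count_ae_fin (le_trans s0 st) tu uT mA AR eA.
  apply: filterS2 f1 f2 => w f1 f2 /=.
  have ff : ell A \is a fin_num by rewrite ge0_fin_numE.
  have -> : `]s, u] `*` A = (`]s, t] `*` A) `|` (`]t, u] `*` A).
    by rewrite -setXUl -itv_bndbnd_setU// bnd_simp.
  have t0 := le_trans s0 st; have tT := le_trans tu uT.
  apply: compensated_setU => //.
  + exact: measurable_rectangle.
  + exact: measurable_rectangle.
  + apply/seteqP; split => // z [[/= z1 _] [/= z2 _]].
    move: z1 z2; rewrite !in_itv/= => /andP[_ h1] /andP[h2 _].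
    by have := lt_le_trans h2 h1; rewrite ltxx.
  + by rewrite intensity_rectangle// fin_numM.
  + by rewrite intensity_rectangle// fin_numM.
  + rewrite -setXUl -itv_bndbnd_setU ?bnd_simp// !intensity_rectangle//;
      last exact: le_trans tu.
    by rewrite -muleDl// -EFinD; congr (_%:E * _)%E; ring.
Qed.

Let cross0 i j s t c : 0 <= s -> s <= t -> t <= T -> valid ell i -> valid ell j ->
  mwrt (G s) c -> bdd c -> mwrt (past i s t) (incr j s t) ->
  E P (fun w => c w * (incr i s t w * incr j s t w)) = 0.
Proof.
move=> s0 st tT vi vj mc bc mj.
have sT := le_trans st tT.
under eq_fun do rewrite (mulrC (incr i _ _ _)) mulrA.
apply: past_orth => //; first by apply: mwrtM => //; exact: G_sub_past.
apply: L1_bddM => //; last exact/L2_L1/incr_L2.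
exact: (mwrt_G_measurable hP hW hB sT mc).
Qed.

Let incr_join i s t S1 S2 S3 : 0 <= s -> s <= t -> t <= T -> valid ell i ->
  (if i is MW then gW T `<=` S1 else if i is MB then gB T `<=` S2 else gJ T `<=` S3) ->
  mwrt (join4 P S1 S2 S3) (incr i s t).
Proof.
move=> s0 st tT vi.
have ts : 0 <= t <= T by rewrite (le_trans s0 st).
have ss : 0 <= s <= T by rewrite s0 (le_trans st).
case: i vi => [_|_|A [mA AR eA]] h.
- apply: (@mwrt_sub _ _ _ (gW T)); last by apply: mwrtB; exact: mwrt_process.
  by move=> E' /h h'; apply: sub_sigma_algebra; left; left; left.
- apply: (@mwrt_sub _ _ _ (gB T)); last by apply: mwrtB; exact: mwrt_process.
  by move=> E' /h h'; apply: sub_sigma_algebra; left; left; right.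
- apply: (@mwrt_sub _ _ _ (jump_off T ell N set0)).
    by move=> E' /jump_off_sub/h h'; apply: sub_sigma_algebra; left; right.
  by apply: jump_incr_mwrt_gen => //; rewrite setI0.
Qed.

(** Both marks are split along their intersection. Of the four products of pieces three have
    disjoint marks and vanish; the square over the common part remains. *)
Let cross_NN A A' s t c : 0 <= s -> s <= t -> t <= T ->
  valid ell (MN A) -> valid ell (MN A') -> mwrt (G s) c -> bdd c ->
  E P (fun w => c w * (incr (MN A) s t w * incr (MN A') s t w)) =
  E P c * (kap ell (MN A) (MN A') * (t - s)).
Proof.
move=> s0 st tT vA vA' mc bc.
have sT := le_trans st tT.
have mc' := mwrt_G_measurable hP hW hB sT mc.
have vD C C' : valid ell (MN C) -> valid ell (MN C') -> valid ell (MN (C `\` C')).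
  move=> [mC CR eC] [mC' _ _]; split; first exact: measurableD.
    by move=> z [/CR].
  by apply: le_lt_trans eC; apply: le_measure; rewrite ?inE//; exact: measurableD.
have vI : valid ell (MN (A `&` A')).
  case: vA vA' => [mA AR eA] [mA' _ _]; split; first exact: measurableI.
    by move=> z [/AR].
  by apply: le_lt_trans eA; apply: le_measure; rewrite ?inE//; exact: measurableI.
have v1 := vD _ _ vA vA'; have v3 := vD _ _ vA' vA.
set I1 := incr (MN (A `\` A')) s t; set I2 := incr (MN (A `&` A')) s t.
set I3 := incr (MN (A' `\` A)) s t.
have L2I i : valid ell i -> L2 P (incr i s t) by move=> vi; exact: incr_L2.
have dI (C C' : set R) : (C `&` C') `&` (C `\` C') = set0.
  by apply/seteqP; split => // z [[_ h] []].
have eA : {ae P, forall w, incr (MN A) s t w = I2 w + I1 w}.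
  have := @incr_MN_setU s t (A `&` A') (A `\` A') s0 st tT vI v1 (dI _ _).
  by rewrite setUIDK.
have eA' : {ae P, forall w, incr (MN A') s t w = I2 w + I3 w}.
  have vI' : valid ell (MN (A' `&` A)) by rewrite setIC.
  have := incr_MN_setU s0 st tT vI' v3 (dI _ _).
  by rewrite setUIDK /I2 (setIC A A').
have cL i j : valid ell i -> valid ell j -> L1 P (fun w => c w * (incr i s t w * incr j s t w)).
  by move=> vi vj; apply: L1_bddM => //; apply: L2M; exact: L2I.
have e : {ae P, forall w, c w * (incr (MN A) s t w * incr (MN A') s t w) =
    c w * (I1 w * I3 w) + c w * (I1 w * I2 w) + (c w * (I3 w * I2 w) + c w * (I2 w * I2 w))}.
  by apply: filterS2 eA eA' => w -> ->; ring.
rewrite (E_ae _ _ e); last 2 first.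
- exact/L1_measurable/cL.
- by apply/L1_measurable/L1D; apply: L1D; exact: cL.
rewrite !ED; [|exact: cL|exact: cL|exact: cL|exact: cL|by apply: L1D; exact: cL..].
have z C C' : valid ell (MN C) -> valid ell (MN C') -> C' `&` C = set0 ->
   E P (fun w => c w * (incr (MN C) s t w * incr (MN C') s t w)) = 0.
  move=> vC [mC' CR' eC'] CC; apply: cross0 => //.
  apply: (@mwrt_sub _ _ _ (jump_off T ell N (rect s t C))).
    by move=> E' h; apply: sub_sigma_algebra; left; right.
  by apply: jump_incr_mwrt_gen => //; rewrite /rect -setXIr CC setX0.
have d1 : (A' `\` A) `&` (A `\` A') = set0.
  by apply/seteqP; split => // x [] /= [h1 h2] [h3 h4].
have d2 : (A `&` A') `&` (A `\` A') = set0 by exact: dI.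
have d3 : (A `&` A') `&` (A' `\` A) = set0.
  by apply/seteqP; split => // x [] /= [h1 h2] [h3 h4].
rewrite (z _ _ v1 v3 d1) (z _ _ v1 vI d2) (z _ _ v3 vI d3).
rewrite !add0r; under eq_fun do rewrite -expr2.
have L1c : L1 P c by apply/L2_L1/bdd_L2.
by rewrite past_sqr//= setIid.
Qed.

Lemma incr_cross i j s t c : 0 <= s -> s <= t -> t <= T ->
  valid ell i -> valid ell j -> mwrt (G s) c -> bdd c ->
  E P (fun w => c w * (incr i s t w * incr j s t w)) =
  E P c * (kap ell i j * (t - s)).
Proof.
move=> s0 st tT vi vj mc bc.
have sT := le_trans st tT.
have L1c : L1 P c.
  by apply/L2_L1/bdd_L2 => //; exact: (mwrt_G_measurable hP hW hB sT mc).
case: i j vi vj => [||A] [||A'] vi vj; try exact: cross_NN.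
- by under eq_fun do rewrite -expr2; exact: past_sqr.
- by rewrite [kap _ _ _]/= mul0r mulr0; apply: cross0 => //; exact: incr_join.
- by rewrite [kap _ _ _]/= mul0r mulr0; apply: cross0 => //; exact: incr_join.
- by rewrite [kap _ _ _]/= mul0r mulr0; apply: cross0 => //; exact: incr_join.
- by under eq_fun do rewrite -expr2; exact: past_sqr.
- by rewrite [kap _ _ _]/= mul0r mulr0; apply: cross0 => //; exact: incr_join.
- rewrite [kap _ _ _]/= mul0r mulr0;
    under eq_fun do rewrite (mulrC (incr (MN A) _ _ _)).
  by apply: cross0 => //; exact: incr_join.
- rewrite [kap _ _ _]/= mul0r mulr0;
    under eq_fun do rewrite (mulrC (incr (MN A) _ _ _)).
  by apply: cross0 => //; exact: incr_join.
Qed.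
End increments.

(** * Isometry for elementary integrals *)

Section elementary_integrands.
Context (R : realType) (Omega I : Type).

Record term := Term { tl : R; tr : R; ti : I; tc : Omega -> R }.

Definition clip (a b u : R) := Num.min (Num.max u a) b.

(** Restriction of a term to ]a, b]. A term starting at or after b is clipped to the empty interval
    at b, where its coefficient may not yet be known; replacing it by 0 keeps the term adapted. *)
Definition tclip (a b : R) (x : term) : term :=
  Term (clip a b (tl x)) (clip a b (tr x)) (ti x)
    (if tl x < b then tc x else fun=> 0).

Definition olap (x y : term) : R :=
  let l := Num.max (tl x) (tl y) in let r := Num.min (tr x) (tr y) in
  if l < r then r - l else 0.

Definition tind (x : term) (t : R) : R := \1_(`]tl x, tr x]) t.

Lemma olapC x y : olap x y = olap y x.
Proof. by rewrite /olap maxC minC. Qed.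

Lemma tind_clip a b x t w : a <= b ->
  tc x w * tind x t * \1_(`]a, b]) t = tc (tclip a b x) w * tind (tclip a b x) t.
Proof.
move=> ab; rewrite /tind /tclip /= !indicE.
have [abt|nt] := pselect (`]a, b]%classic t).
  rewrite (mem_set abt); move: abt => /=; rewrite in_itv/= => /andP[at_ tb].
  rewrite mulr1; case: ltP => lb; last first.
    rewrite mul0r memNset ?mulr0//= in_itv/= => /andP[lt _].
    by have := lt_le_trans lt tb; rewrite ltNge lb.
  congr (_ * (nat_of_bool _)%:R); apply/idP/idP; rewrite !inE /= !in_itv/= /clip.
    by move=> /andP[lt tr]; rewrite gt_min gt_max lt at_/= le_min tb le_max tr.
  rewrite gt_min gt_max le_min le_max => /andP[/orP[/andP[-> _]|]].
    by move=> /andP[/orP[->//|]]; rewrite leNgt at_.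
  by move=> bt; have := lt_le_trans bt tb; rewrite ltxx.
rewrite (memNset nt) mulr0; case: ltP => lb; last by rewrite mul0r.
rewrite memNset ?mulr0//= in_itv/= /clip => /andP[h1 h2].
apply: nt; rewrite /= in_itv/=; move: h2; rewrite le_min => /andP[_ tb].
rewrite tb andbT; move: h1; rewrite gt_min => /orP[|bt].
  by rewrite gt_max => /andP[].
by have := lt_le_trans bt tb; rewrite ltxx.
Qed.

Local Notation mu := (@lebesgue_measure R).

Lemma tindM x y t : tind x t * tind y t =
  \1_(`]Num.max (tl x) (tl y), Num.min (tr x) (tr y)]) t.
Proof.
rewrite /tind !indicE -natrM mulnb -in_setI; congr (nat_of_bool _)%:R.
apply/idP/idP; rewrite !inE /= !in_itv/= gt_max le_min.
  by move=> [/andP[-> ->] /andP[-> ->]].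
by move=> /andP[/andP[-> ->] /andP[-> ->]].
Qed.

Lemma integrable_tindM x y (c : R) :
  mu.-integrable setT (fun t => (c * (tind x t * tind y t))%:E).
Proof.
under eq_fun do rewrite tindM EFinM.
apply: integrableZl => //; exact: integrable_indic_itv.
Qed.

Lemma Rintegral_tindM x y (c : R) :
  \int[mu]_t (c * (tind x t * tind y t)) = c * olap x y.
Proof.
under eq_Rintegral do rewrite tindM.
rewrite RintegralZl//; last exact: integrable_indic_itv.
congr (_ * _); rewrite /Rintegral integral_indic//= setIT /olap.
have -> : mu `]Num.max (tl x) (tl y), Num.min (tr x) (tr y)] = _ := lebesgue_measure_itv _.
by rewrite /= lte_fin; case: ifP.
Qed.

End elementary_integrands.

Lemma integrable_sum_ord d (U : measurableType d) (R : realType)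
    (m : {measure set U -> \bar R}) (D : set U) n (f : 'I_n -> U -> R) :
  measurable D -> (forall k, m.-integrable D (EFin \o f k)) ->
  m.-integrable D (fun u => (\sum_(k < n) f k u)%:E).
Proof.
move=> mD h; under eq_fun do rewrite -sumEFin.
by apply: integrable_sum => // k _; exact: h.
Qed.

Lemma Rintegral_sum_ord d (U : measurableType d) (R : realType)
    (m : {measure set U -> \bar R}) (D : set U) n (f : 'I_n -> U -> R) :
  measurable D -> (forall k, m.-integrable D (EFin \o f k)) ->
  \int[m]_(u in D) (\sum_(k < n) f k u) = \sum_(k < n) \int[m]_(u in D) f k u.
Proof.
move=> mD; elim: n f => [|n IH] f h.
  by under eq_Rintegral do rewrite big_ord0; rewrite big_ord0 Rintegral_cst// mul0r.
under eq_Rintegral do rewrite big_ord_recr /=.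
by rewrite RintegralD ?IH ?big_ord_recr//; exact: integrable_sum_ord.
Qed.

(** * Isometry and orthogonality for an abstract family of noises *)

Section stochastic_integral.
Context (R : realType) (d : measure_display) (Omega : measurableType d).
Context (P : probability Omega R) (T : R) (G : R -> set (set Omega)).
Variables (I : Type) (valid : I -> Prop) (incr : I -> R -> R -> Omega -> R).
Variable kap : I -> I -> R.
Local Notation mu := (@lebesgue_measure R).

Hypothesis G_measurable : forall t, t <= T -> G t `<=` measurable.
Hypothesis G_mono : forall s t (f : Omega -> R), s <= t -> mwrt (G s) f -> mwrt (G t) f.
Hypothesis kapC : forall i j, kap i j = kap j i.
Hypothesis incr0 : forall i s w, incr i s s w = 0.
Hypothesis incr_L2 : forall i s t, 0 <= s -> s <= t -> t <= T -> valid i ->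
  L2 P (incr i s t).
Hypothesis incr_mwrt : forall i s t, 0 <= s -> s <= t -> t <= T -> valid i ->
  mwrt (G t) (incr i s t).
Hypothesis incr_orth : forall i s t c, 0 <= s -> s <= t -> t <= T -> valid i ->
  mwrt (G s) c -> L1 P c -> E P (fun w => c w * incr i s t w) = 0.
Hypothesis incr_cross : forall i j s t c, 0 <= s -> s <= t -> t <= T ->
  valid i -> valid j -> mwrt (G s) c -> bdd c ->
  E P (fun w => c w * (incr i s t w * incr j s t w)) =
  E P c * (kap i j * (t - s)).
Hypothesis incr_add : forall i s t u, 0 <= s -> s <= t -> t <= u -> u <= T ->
  valid i -> {ae P, forall w, incr i s u w = incr i s t w + incr i t u w}.

Local Notation term := (term R Omega I).

Definition twf (x : term) : Prop :=
  [/\ 0 <= tl x, tl x <= tr x, tr x <= T & valid (ti x)] /\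
  (mwrt (G (tl x)) (tc x) /\ bdd (tc x)).

Definition tint (x : term) (w : Omega) : R :=
  tc x w * incr (ti x) (tl x) (tr x) w.

Let twf_tc x : twf x -> measurable_fun setT (tc x) /\ bdd (tc x).
Proof.
move=> [[l0 lr rT _] [mc bc]]; split => //.
by apply: mwrt_measurable mc; apply: G_measurable; exact: le_trans rT.
Qed.

Lemma tint_L2 x : twf x -> L2 P (tint x).
Proof.
move=> wx; have [mc bc] := twf_tc wx; case: wx => [[l0 lr rT vi] _].
by apply: L2_bddM => //; exact: incr_L2.
Qed.

(** The longer increment is cut at r; its second piece is orthogonal to everything known at r. *)
Let same_start (i j : I) (l r r' : R) (c : Omega -> R) :
  0 <= l -> l <= r -> r <= r' -> r' <= T -> valid i -> valid j ->
  mwrt (G l) c -> bdd c ->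
  E P (fun w => c w * (incr i l r w * incr j l r' w)) = E P c * (kap i j * (r - l)).
Proof.
move=> l0 lr rr' r'T vi vj mc bc.
have rT := le_trans rr' r'T; have lT := le_trans lr rT.
have mc' := mwrt_measurable (G_measurable lT) mc.
have r0 := le_trans l0 lr.
have Li : L2 P (incr i l r) by exact: incr_L2.
have Lj : L2 P (incr j l r) by exact: incr_L2.
have Lj' : L2 P (incr j r r') by exact: incr_L2.
have Ljj : L2 P (incr j l r') by apply: incr_L2 => //; exact: le_trans rr'.
have La : L1 P (fun w => c w * (incr i l r w * incr j l r w)).
  by apply: L1_bddM => //; exact: L2M.
have Lb : L1 P (fun w => c w * incr i l r w * incr j r r' w).
  by apply: L2M => //; exact: L2_bddM.
rewrite (@E_ae _ _ _ _ _ (fun w => c w * (incr i l r w * incr j l r w) +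
   c w * incr i l r w * incr j r r' w)); last 3 first.
- apply: (@L1_measurable _ _ _ P); apply: L1_bddM => //; exact: L2M.
- by apply: (@L1_measurable _ _ _ P); exact: L1D.
- have := @incr_add j l r r' l0 lr rr' r'T vj.
  by apply: filterS => w ->; ring.
rewrite ED// incr_cross// incr_orth ?addr0//.
- by apply: mwrtM; [exact: G_mono mc|exact: incr_mwrt].
- by apply/L2_L1/L2_bddM.
Qed.

(** The earlier increment is cut where the later one starts. The first piece joins the coefficients,
    leaving an increment orthogonal to them; the second starts together with [y]. *)
Let ordered_pair x y : twf x -> twf y -> tl x <= tl y ->
  E P (fun w => tint x w * tint y w) =
  E P (fun w => tc x w * tc y w) * (kap (ti x) (ti y) * olap x y).
Proof.
case: x y => [l r i c] [l' r' j c'] wx wy; rewrite /tint /olap /= => ll'.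
have [mcx bcx] := twf_tc wx; have [mcy bcy] := twf_tc wy.
case: wx => [/= [l0 lr rT vi] [mc bc]]; case: wy => [/= [l'0 l'r' r'T vj] [mc' bc']].
rewrite (max_idPr ll').
have l'T := le_trans l'r' r'T.
have bcc := bddM bc bc'.
have mcc : mwrt (G l') (fun w => c w * c' w) by apply: mwrtM => //; exact: G_mono mc.
have mcc' := mwrt_measurable (G_measurable l'T) mcc.
have [rl'|l'r] := leP r l'.
  rewrite ltNge (le_trans _ rl') ?ge_min ?lexx// !mulr0.
  have -> : (fun w => c w * incr i l r w * (c' w * incr j l' r' w)) =
      (fun w => c w * c' w * incr i l r w * incr j l' r' w).
    by apply/funext => w; ring.
  apply: incr_orth => //.
  - by apply: mwrtM => //; apply: (G_mono rl'); exact: incr_mwrt.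
  - by apply/L2_L1/L2_bddM => //; exact: incr_L2.
have Ll : L2 P (incr i l l') by exact: incr_L2.
have Lr : L2 P (incr i l' r) by apply: incr_L2 => //; exact: ltW.
have Li : L2 P (incr i l r) by exact: incr_L2.
have Lj : L2 P (incr j l' r') by exact: incr_L2.
have La : L1 P (fun w => c w * c' w * incr i l l' w * incr j l' r' w).
  by apply: L2M => //; exact: L2_bddM.
have Lb : L1 P (fun w => c w * c' w * (incr i l' r w * incr j l' r' w)).
  by apply: L1_bddM => //; exact: L2M.
rewrite (@E_ae _ _ _ _ _ (fun w => c w * c' w * incr i l l' w * incr j l' r' w
   + c w * c' w * (incr i l' r w * incr j l' r' w))); last 3 first.
- by apply: (@L1_measurable _ _ _ P); apply: L2M; exact: L2_bddM.
- by apply: (@L1_measurable _ _ _ P); exact: L1D.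
- have := @incr_add i l l' r l0 ll' (ltW l'r) rT vi.
  by apply: filterS => w ->; ring.
rewrite ED// incr_orth// ?add0r; last 2 first.
- by apply: mwrtM => //; exact: incr_mwrt.
- by apply/L2_L1/L2_bddM.
have [rr'|r'r] := leP r r'.
  by rewrite l'r same_start//; exact: ltW.
under eq_fun do rewrite (mulrC (incr i _ _ _)).
rewrite (same_start l'0 l'r' (ltW r'r) rT vj vi mcc bcc) kapC.
by case: ltP => // h; congr (_ * (_ * _)); apply/eqP; rewrite subr_eq0 eq_le h.
Qed.

Lemma tint_pair x y : twf x -> twf y ->
  E P (fun w => tint x w * tint y w) =
  E P (fun w => tc x w * tc y w) * (kap (ti x) (ti y) * olap x y).
Proof.
move=> wx wy; have [xy|/ltW yx] := leP (tl x) (tl y); first exact: ordered_pair.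
under eq_fun do rewrite mulrC; rewrite ordered_pair// kapC olapC.
by under eq_fun do rewrite mulrC.
Qed.

Lemma tclip_wf a b x : 0 <= a -> a <= b -> b <= T -> twf x -> twf (tclip a b x).
Proof.
move=> a0 ab bT [[l0 lr rT vi] [mc bc]]; split => /=.
  split => //.
  - by rewrite /clip le_min le_max l0/= (le_trans a0).
  - by rewrite /clip le_min !ge_min ge_max !le_max lr !lexx !orbT.
  - by rewrite /clip ge_min bT orbT.
case: ltP => lb; last by split; [exact: mwrt_cst|exists 0 => w; rewrite normr0].
split => //; apply: G_mono mc.
by rewrite /clip le_min le_max lexx/= ltW.
Qed.

Definition pint (x : term) (t : R) (w : Omega) : R :=
  tc x w * incr (ti x) (Num.min (tl x) t) (Num.min (tr x) t) w.

Lemma pint_L2 x t : 0 <= t -> t <= T -> twf x -> L2 P (pint x t).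
Proof.
move=> t0 tT wx; have [mc bc] := twf_tc wx; case: wx => [[l0 lr rT vi] _].
apply: L2_bddM => //; apply: incr_L2 => //.
- by rewrite le_min l0.
- by rewrite le_min !ge_min lr lexx orbT.
- by rewrite ge_min rT.
Qed.

Lemma pint_clip a b x : 0 <= a -> a <= b -> b <= T -> twf x ->
  {ae P, forall w, pint x b w - pint x a w = tint (tclip a b x) w}.
Proof.
move=> a0 ab bT [[l0 lr rT vi] _]; rewrite /pint /tint /tclip /clip /=.
have [lb|bl] := ltP (tl x) b; last first.
  have br := le_trans bl lr.
  apply: aeW => w /=; rewrite ?(min_idPr bl) ?(min_idPr br).
  rewrite ?(min_idPr (le_trans ab bl)) ?(min_idPr (le_trans ab br)) !incr0.
  by rewrite !mulr0 mul0r subrr.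
rewrite ?(min_idPl (ltW lb)).
have [ra|ar] := leP (tr x) a.
  have la := le_trans lr ra.
  apply: aeW => w /=; rewrite ?(min_idPl (le_trans ra ab)) ?(min_idPl la).
  by rewrite ?(max_idPr la) ?(min_idPl ab) incr0 subrr mulr0.
have [la|al] := leP (tl x) a.
  rewrite ?(min_idPl ab).
  have := @incr_add (ti x) (tl x) a (Num.min (tr x) b) l0 la.
  rewrite le_min (ltW ar) ab ge_min rT => /(_ isT isT vi).
  by apply: filterS => w ->; ring.
by apply: aeW => w /=; rewrite incr0 mulr0 subr0 ?(min_idPl (ltW lb)).
Qed.

Definition fint n (x : 'I_n -> term) (t : R) (w : Omega) : R :=
  \sum_(k < n) pint (x k) t w.

(** The squared norm of the elementary integrand at time t, expanded with [kap] as inner product of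
    the marks. *)
Definition fsqr n (x : 'I_n -> term) (t : R) (w : Omega) : R :=
  \sum_(k < n) \sum_(m < n)
    kap (ti (x k)) (ti (x m)) *
    ((tc (x k) w * tind (x k) t) * (tc (x m) w * tind (x m) t)).

Lemma fsqr_clip a b n (x : 'I_n -> term) t w : a <= b ->
  fsqr x t w * \1_(`]a, b]) t = fsqr (fun k => tclip a b (x k)) t w.
Proof.
move=> ab; rewrite /fsqr mulr_suml; apply: eq_bigr => k _.
rewrite mulr_suml; apply: eq_bigr => m _; rewrite -!tind_clip//= indicE.
by case: (_ \in _) => /=; ring.
Qed.

Lemma fsqr_integrable n (x : 'I_n -> term) w :
  mu.-integrable setT (fun t => (fsqr x t w)%:E).
Proof.
apply: integrable_sum_ord => // k; apply: integrable_sum_ord => // m.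
have := @integrable_tindM _ _ _ (x k) (x m)
  (kap (ti (x k)) (ti (x m)) * (tc (x k) w * tc (x m) w)).
by apply: eq_integrable => // t _ /=; congr EFin; ring.
Qed.

Lemma Rintegral_fsqr n (x : 'I_n -> term) w :
  \int[mu]_t fsqr x t w = \sum_(k < n) \sum_(m < n)
    kap (ti (x k)) (ti (x m)) * olap (x k) (x m) * (tc (x k) w * tc (x m) w).
Proof.
have e k m t : kap (ti (x k)) (ti (x m)) *
    ((tc (x k) w * tind (x k) t) * (tc (x m) w * tind (x m) t)) =
    kap (ti (x k)) (ti (x m)) * (tc (x k) w * tc (x m) w) * (tind (x k) t * tind (x m) t).
  by ring.
rewrite /fsqr; under eq_Rintegral do under eq_bigr do under eq_bigr do rewrite e.
rewrite Rintegral_sum_ord//; last first.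
  by move=> k; apply: integrable_sum_ord => // m; exact: integrable_tindM.
apply: eq_bigr => k _; rewrite Rintegral_sum_ord//; last first.
  by move=> m; exact: integrable_tindM.
by apply: eq_bigr => m _; rewrite Rintegral_tindM mulrAC.
Qed.

(** Both sides are double sums over pairs of terms and agree pair by pair, the time integral of each
    pair being its overlap. *)
Lemma isometry_full n (x : 'I_n -> term) : (forall k, twf (x k)) ->
  L1 P (fun w => \int[mu]_t fsqr x t w) /\
  E P (fun w => (\sum_(k < n) tint (x k) w) ^+ 2) =
  E P (fun w => \int[mu]_t fsqr x t w).
Proof.
move=> wx.
have Lc k m : L1 P (fun w => tc (x k) w * tc (x m) w).
  have [mk bk] := twf_tc (wx k); have [mm bm] := twf_tc (wx m).
  by apply: L2M; exact: bdd_L2.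
have -> : (fun w => \int[mu]_t fsqr x t w) = (fun w => \sum_(k < n) \sum_(m < n)
    kap (ti (x k)) (ti (x m)) * olap (x k) (x m) * (tc (x k) w * tc (x m) w)).
  by apply/funext => w; exact: Rintegral_fsqr.
split.
  by apply: L1_sum => k; apply: L1_sum => m; exact: L1Z.
have -> : (fun w => (\sum_(k < n) tint (x k) w) ^+ 2) =
    (fun w => \sum_(k < n) \sum_(m < n) tint (x k) w * tint (x m) w).
  by apply/funext => w; rewrite expr2 big_distrlr.
rewrite !E_sum; last 2 first.
- by move=> k; apply: L1_sum => m; exact: L1Z.
- by move=> k; apply: L1_sum => m; apply: L2M; exact: tint_L2.
apply: eq_bigr => k _; rewrite !E_sum; last 2 first.
- by move=> m; exact: L1Z.
- by move=> m; apply: L2M; exact: tint_L2.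
by apply: eq_bigr => m _; rewrite EZ// tint_pair// mulrC.
Qed.

Lemma fint_L2 n (x : 'I_n -> term) t : 0 <= t -> t <= T ->
  (forall k, twf (x k)) -> L2 P (fint x t).
Proof. by move=> t0 tT wx; apply: L2_sum => k; exact: pint_L2. Qed.

Lemma fint_clip n (x : 'I_n -> term) a b : 0 <= a -> a <= b -> b <= T ->
  (forall k, twf (x k)) ->
  {ae P, forall w, fint x b w - fint x a w =
     \sum_(k < n) tint (tclip a b (x k)) w}.
Proof.
move=> a0 ab bT; rewrite /fint; elim: n x => [|n IH] x wx.
  by apply: aeW => w; rewrite !big_ord0 subrr.
have h1 := IH (fun k => x (widen_ord (leqnSn n) k)) (fun k => wx _).
have h2 := pint_clip a0 ab bT (wx ord_max).
apply: filterS2 h1 h2 => w h1 h2.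
by rewrite !big_ord_recr/= -h1 -h2; ring.
Qed.

Lemma fint_isometry n (x : 'I_n -> term) a b : 0 <= a -> a <= b -> b <= T ->
  (forall k, twf (x k)) ->
  L1 P (fun w => \int[mu]_(t in `]a, b]) fsqr x t w) /\
  E P (fun w => (fint x b w - fint x a w) ^+ 2) =
  E P (fun w => \int[mu]_(t in `]a, b]) fsqr x t w).
Proof.
move=> a0 ab bT wx.
have wy k : twf (tclip a b (x k)) by exact: tclip_wf.
have [L1y Ey] := isometry_full wy.
have -> : (fun w => \int[mu]_(t in `]a, b]) fsqr x t w) =
    (fun w => \int[mu]_t fsqr (fun k => tclip a b (x k)) t w).
  apply/funext => w; rewrite Rintegral_mkcond; apply: eq_Rintegral => t _.
  by rewrite -fsqr_clip// patchE indicE; case: ifP => _; rewrite ?mulr1 ?mulr0.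
split => //; rewrite -Ey; apply: E_ae.
- apply: measurable_funX; apply: measurable_funB; apply: L2_measurable;
    apply: fint_L2 => //.
  + exact: le_trans ab.
  + exact: le_trans bT.
- apply: measurable_funX; apply: (@L2_measurable _ _ _ P); apply: L2_sum => k;
    exact: tint_L2.
- by apply: filterS (fint_clip a0 ab bT wx) => w ->.
Qed.

(** After clipping to ]a, b] every term starts at a or later, so [c] can be absorbed into its
    coefficient. *)
Lemma fint_orth n (x : 'I_n -> term) a b c : 0 <= a -> a <= b -> b <= T ->
  (forall k, twf (x k)) -> mwrt (G a) c -> L2 P c ->
  E P (fun w => c w * (fint x b w - fint x a w)) = 0.
Proof.
move=> a0 ab bT wx mc Lc.
have wy k : twf (tclip a b (x k)) by exact: tclip_wf.
have Ls : L2 P (fun w => \sum_(k < n) tint (tclip a b (x k)) w).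
  by apply: L2_sum => k; exact: tint_L2.
have Lba : L2 P (fun w => fint x b w - fint x a w).
  apply: L2B; apply: fint_L2 => //; [exact: le_trans ab|exact: le_trans bT].
rewrite (@E_ae _ _ _ _ _ (fun w => \sum_(k < n) c w * tint (tclip a b (x k)) w));
  last 3 first.
- by apply: (@L1_measurable _ _ _ P); exact: L2M.
- apply: (@L1_measurable _ _ _ P); apply: L1_sum => k.
  by apply: L2M => //; exact: tint_L2.
- by apply: filterS (fint_clip a0 ab bT wx) => w ->; rewrite mulr_sumr.
rewrite E_sum; last by move=> k; apply: L2M => //; exact: tint_L2.
rewrite big1// => k _; have [[l0 lr rT vi] [mk bk]] := wy k.
rewrite /tint; under eq_fun do rewrite mulrA.
have al : a <= tl (tclip a b (x k)) by rewrite /= /clip le_min ab le_max lexx orbT.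
have lT := le_trans lr rT.
apply: incr_orth => //; first by apply: mwrtM => //; exact: G_mono mc.
by apply: L2M => //; apply: bdd_L2 => //; exact: mwrt_measurable (G_measurable lT) mk.
Qed.
End stochastic_integral.

(** * Joint measurability *)

Section sigma_finite_jumps.
Context (R : realType) (ell : {measure set R -> \bar R}).
Hypothesis hell : (\int[ell]_(z in @R0 R) (z ^+ 2)%:E < +oo)%E.

(** Tonelli's theorem asks for a sigma-finite measure. [ell] is arbitrary at 0, so it is restricted
    to [R0], where the integral of z^2 being finite bounds the mass of |z| >= 1/(n+1). *)
Definition ell0 := mrestr ell (@measurable_R0 R).

HB.instance Definition _ := Measure.on ell0.

(** The point 0, null for [ell0], is added so that these sets cover the line. *)
Let K (n : nat) : set R := [set z | n.+1%:R^-1 <= `|z|] `|` [set 0].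

Let mK n : measurable [set z : R | n.+1%:R^-1 <= `|z|].
Proof.
rewrite (_ : mkset _ = @Num.norm R R @^-1` `[n.+1%:R^-1, +oo[%classic).
  rewrite -[X in measurable X]setTI; exact: (@normr_measurable R setT).
by apply/seteqP; split => z /=; rewrite in_itv/= andbT.
Qed.

Let ellK n : (ell [set z | (n.+1%:R^-1 <= `|z|)%R] < +oo)%E.
Proof.
set k : R := n.+1%:R^-1; set D := mkset _.
have k0 : 0 < k by rewrite invr_gt0 ltr0n.
have DR : D `<=` @R0 R.
  by move=> z /= kz; rewrite /R0/= -normr_gt0; exact: lt_le_trans kz.
have : (\int[ell]_(z in D) (k ^+ 2)%:E < +oo)%E.
  apply: le_lt_trans hell; apply: (@le_trans _ _ (\int[ell]_(z in D) (z ^+ 2)%:E)%E).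
    apply: ge0_le_integral => //; first exact: mK.
    - by move=> z _; rewrite lee_fin sqr_ge0.
    - by apply/measurable_EFinP; exact: measurable_funX.
    - move=> z kz; rewrite lee_fin -(real_normK (num_real z)).
      by rewrite lerXn2r ?nnegrE ?(ltW k0)//.
  apply: ge0_subset_integral => //; [exact: mK|exact: measurable_R0| | ].
  - by apply: measurable_funTS; apply/measurable_EFinP;
      exact: (measurable_funX 2 (@measurable_id _ _ setT)).
  - by move=> z _; rewrite lee_fin sqr_ge0.
rewrite (integral_cst ell (mK n)).
have k2 : 0 < k ^+ 2 by rewrite exprn_gt0.
case: (ell D) (measure_ge0 ell D) => [r| |] // _; first by rewrite !ltry.
by rewrite mulry gtr0_sg// mul1e.
Qed.

Let ell0_sigma_finite : sigma_finite setT ell0.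
Proof.
exists K.
  apply/seteqP; split => // z _.
  have [->|z0] := eqVneq z 0; first by exists 0%N => //; right.
  have z1 : 0 < `|z|^-1 by rewrite invr_gt0 normr_gt0.
  exists (Num.truncn (`|z|^-1)) => //; left => /=.
  rewrite -[leRHS]invrK lef_pV2 ?posrE ?ltr0n//.
  exact/ltW/truncnS_gt.
move=> n; have mKn : measurable (K n) by apply: measurableU;
  [exact: mK|exact: measurable_set1].
split => //; rewrite /ell0 /mrestr.
apply: le_lt_trans (ellK n); apply: le_measure; rewrite ?inE.
- by apply: measurableI => //; exact: measurable_R0.
- exact: mK.
- by move=> z [[//|->]]; rewrite /R0/= eqxx.
Qed.

HB.instance Definition _ :=
  @Measure_isSigmaFinite.Build _ _ _ ell0 ell0_sigma_finite.

Lemma integral_ell0 (f : R -> \bar R) :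
  (\int[ell]_(z in @R0 R) f z = \int[ell0]_z (f \_ (@R0 R)) z)%E.
Proof.
rewrite -integral_mkcond; apply: eq_measure_integral => A mA AR.
by rewrite /ell0 /mrestr; congr (ell _); exact/esym/setIidPl.
Qed.

Lemma measurable_int_ell0 d (U : measurableType d) (D : set U)
    (f : U * R -> \bar R) : measurable D ->
  measurable_fun (D `*` @R0 R) f -> (forall q, 0 <= f q)%E ->
  measurable_fun D (fun u => \int[ell]_(z in @R0 R) f (u, z))%E.
Proof.
move=> mD mf f0.
have mDR : measurable (D `*` @R0 R) by apply: measurableX => //; exact: measurable_R0.
have mg : measurable_fun setT (f \_ (D `*` @R0 R)).
  by apply/(measurable_restrictT f).
have g0 q : (0 <= (f \_ (D `*` @R0 R)) q)%E by exact: erestrict_ge0.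
have := measurable_fun_fubini_tonelli_F (m2 := ell0) _ mg g0.
move=> /(measurable_funS measurableT (@subsetT _ D)).
apply: eq_measurable_fun => u; rewrite inE => Du.
rewrite /fubini_F integral_ell0; apply: eq_integral => z _.
rewrite !patchE; congr (if _ then _ else _).
by apply/idP/idP; rewrite !inE /=; [case|split].
Qed.

End sigma_finite_jumps.

Section joint_measurability.
Context (R : realType) (d : measure_display) (Omega : measurableType d).
Variables (P : probability Omega R) (T : R).
Local Notation mu := (@lebesgue_measure R).

Lemma measurable_section (D : set R) (F : R * Omega -> \bar R) w :
  measurable_fun (D `*` setT) F -> measurable D ->
  measurable_fun D (fun t => F (t, w)).
Proof.
move=> mF mD; apply: (@measurable_comp _ _ _ _ _ _ (D `*` setT)) mF _.
- exact: measurableX.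
- by move=> _ [t Dt <-].
- exact/measurable_funTS/pair2_measurable.
Qed.

Lemma measurable_int_time (D E : set R) (F : R * Omega -> \bar R) :
  measurable D -> measurable E -> E `<=` D ->
  measurable_fun (D `*` setT) F -> (forall q, 0 <= F q)%E ->
  measurable_fun setT (fun w => \int[mu]_(t in E) F (t, w))%E.
Proof.
move=> mD mE ED mF F0.
have mES : measurable (E `*` @setT Omega) by exact: measurableX.
have mG : measurable_fun setT (F \_ (E `*` setT)).
  apply/(measurable_restrictT F) => //; apply: measurable_funS mF.
    exact: measurableX.
  by move=> [t w] [/= /ED].
have G0 q : (0 <= (F \_ (E `*` setT)) q)%E by exact: erestrict_ge0.
have := @measurable_fun_fubini_tonelli_G _ _ (measurableTypeR R) Omega R mu _ mG G0.
rewrite /fubini_G; apply: eq_measurable_fun => w _.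
rewrite [RHS]integral_mkcond; apply: eq_integral => t _.
rewrite !patchE; congr (if _ then _ else _).
by apply/idP/idP; rewrite !inE /=; [case|split].
Qed.

End joint_measurability.

Lemma ge0_integral_le2 d (U : measurableType d) (R : realType)
    (m : {measure set U -> \bar R}) (D : set U) (f g h : U -> \bar R) :
  measurable D -> measurable_fun D f -> measurable_fun D g -> measurable_fun D h ->
  (forall x, D x -> 0 <= f x)%E -> (forall x, D x -> 0 <= g x)%E ->
  (forall x, D x -> 0 <= h x)%E ->
  (forall x, D x -> h x <= 2%:E * f x + 2%:E * g x)%E ->
  (\int[m]_(x in D) h x <=
     2%:E * \int[m]_(x in D) f x + 2%:E * \int[m]_(x in D) g x)%E.
Proof.
move=> mD mf mg mh f0 g0 h0 hfg.
have f20 x : D x -> (0 <= 2%:E * f x)%E by move=> Dx; rewrite mule_ge0// f0.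
have g20 x : D x -> (0 <= 2%:E * g x)%E by move=> Dx; rewrite mule_ge0// g0.
rewrite -!ge0_integralZl// -ge0_integralD//; [|exact: measurable_funeM..].
apply: ge0_le_integral => //.
by apply: emeasurable_funD; exact: measurable_funeM.
Qed.

(** * Integrands against all noises and their energy *)

Section integrands.
Context (R : realType) (d : measure_display) (Omega : measurableType d).
Context (P : probability Omega R) (T : R) (ell : {measure set R -> \bar R}).
Hypothesis hell : (\int[ell]_(z in @R0 R) (z ^+ 2)%:E < +oo)%E.
Local Notation mu := (@lebesgue_measure R).

(** The components are integrated against W, the compensated jumps and B respectively; equations
    without B have third component 0. *)
Record integrand := Integrand {
  uy : R -> Omega -> R; uz : R -> Omega -> R -> R; ub : R -> Omega -> R }.

Definition mproc (y : R -> Omega -> R) :=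
  measurable_fun (`[0, T] `*` setT) (fun p : R * Omega => y p.1 p.2).

Definition mfield (z : R -> Omega -> R -> R) :=
  measurable_fun ((`[0, T] `*` setT) `*` @R0 R)
    (fun q : (R * Omega) * R => z q.1.1 q.1.2 q.2).

Definition mintegrand u := [/\ mproc (uy u), mfield (uz u) & mproc (ub u)].

Definition iadd u v := Integrand (fun t w => uy u t w + uy v t w)
  (fun t w z => uz u t w z + uz v t w z) (fun t w => ub u t w + ub v t w).

Definition iopp u := Integrand (fun t w => - uy u t w)
  (fun t w z => - uz u t w z) (fun t w => - ub u t w).

(** The squared norm in R x R x L2(ell), possibly infinite. *)
Definition nrm (u : integrand) (p : R * Omega) : \bar R :=
  ((uy u p.1 p.2 ^+ 2)%:E + (ub u p.1 p.2 ^+ 2)%:E +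
    \int[ell]_(z in @R0 R) (uz u p.1 p.2 z ^+ 2)%:E)%E.

Definition energy (a b : R) u : \bar R :=
  (\int[P]_w \int[mu]_(t in `[a, b]) nrm u (t, w))%E.

Local Notation TO := (`[0, T] `*` @setT Omega).

Let mTO : measurable TO. Proof. by apply: measurableX. Qed.

Lemma nrm_ge0 u p : (0 <= nrm u p)%E.
Proof.
apply: adde_ge0; last by apply: integral_ge0 => z _; rewrite lee_fin sqr_ge0.
by rewrite adde_ge0// lee_fin sqr_ge0.
Qed.

Lemma mfield_sqr z : mfield z ->
  measurable_fun TO (fun p => \int[ell]_(x in @R0 R) (z p.1 p.2 x ^+ 2)%:E)%E.
Proof.
move=> mz; apply: (measurable_int_ell0 hell (f := fun q => (z q.1.1 q.1.2 q.2 ^+ 2)%:E)) => //.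
- by apply/measurable_EFinP; exact: measurable_funX.
- by move=> q; rewrite lee_fin sqr_ge0.
Qed.

Lemma mproc_sqr y : mproc y ->
  measurable_fun TO (fun p => (y p.1 p.2 ^+ 2)%:E).
Proof. by move=> my; apply/measurable_EFinP; exact: measurable_funX. Qed.

Lemma measurable_nrm u : mintegrand u -> measurable_fun TO (nrm u).
Proof.
move=> [my mz mb]; apply: emeasurable_funD; last exact: mfield_sqr.
by apply: emeasurable_funD; exact: mproc_sqr.
Qed.

Lemma mfield_section z t w : mfield z -> 0 <= t <= T ->
  measurable_fun (@R0 R) (z t w).
Proof.
move=> mz tT.
apply: (@measurable_comp _ _ _ _ _ _ ((`[0, T] `*` @setT Omega) `*` @R0 R)
  (fun q : (R * Omega) * R => z q.1.1 q.1.2 q.2) _ (pair (t, w))) => //.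
- by apply: measurableX => //; exact: measurable_R0.
- by move=> _ [x Rx <-]; split => //; split => //=; rewrite in_itv.
- exact/measurable_funTS/pair1_measurable.
Qed.

Lemma measurable_nrm_int u (a b : R) : mintegrand u -> 0 <= a -> b <= T ->
  measurable_fun setT (fun w => \int[mu]_(t in `[a, b]) nrm u (t, w))%E.
Proof.
move=> mu' a0 bT; apply: (@measurable_int_time _ _ _ `[0, T]) => //.
- by apply: subset_itv; rewrite bnd_simp.
- exact: measurable_nrm.
- exact: nrm_ge0.
Qed.

Lemma measurable_nrm_time u (a b : R) w : mintegrand u -> 0 <= a -> b <= T ->
  measurable_fun `[a, b] (fun t => nrm u (t, w)).
Proof.
move=> mu' a0 bT; apply: (@measurable_funS _ _ _ _ `[0, T]) => //.
  by apply: subset_itv; rewrite bnd_simp.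
by apply: measurable_section => //; exact: measurable_nrm.
Qed.

Lemma iadd_meas u v : mintegrand u -> mintegrand v -> mintegrand (iadd u v).
Proof.
move=> [my mz mb] [my' mz' mb'].
by split; exact: measurable_funD.
Qed.

Lemma iopp_meas u : mintegrand u -> mintegrand (iopp u).
Proof.
by move=> [my mz mb]; split; exact: measurableT_comp.
Qed.

Lemma nrm_opp u p : nrm (iopp u) p = nrm u p.
Proof.
by rewrite /nrm /= !sqrrN; congr (_ + _)%E; apply: eq_integral => z _; rewrite sqrrN.
Qed.

Let sqrD_le (x y : R) :
  (((x + y) ^+ 2)%:E <= 2%:E * (x ^+ 2)%:E + 2%:E * (y ^+ 2)%:E)%E.
Proof.
by rewrite -!EFinM -EFinD lee_fin; have := sqr_ge0 (x - y); nra.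
Qed.

Let add3_le (A B C A' B' C' X Y Z : \bar R) :
  (0 <= A -> 0 <= B -> 0 <= C -> 0 <= A' -> 0 <= B' -> 0 <= C' ->
   X <= 2%:E * A + 2%:E * A' -> Y <= 2%:E * B + 2%:E * B' ->
   Z <= 2%:E * C + 2%:E * C' ->
   X + Y + Z <= 2%:E * (A + B + C) + 2%:E * (A' + B' + C'))%E.
Proof.
move=> A0 B0 C0 A0' B0' C0' hX hY hZ.
rewrite !ge0_muleDr ?adde_ge0// [leRHS]addeACA (addeACA (2%:E * A)%E).
by apply: leeD => //; exact: leeD.
Qed.

Lemma nrm_add u v p : mintegrand u -> mintegrand v -> TO p ->
  (nrm (iadd u v) p <= 2%:E * nrm u p + 2%:E * nrm v p)%E.
Proof.
case: p => t w [my mz mb] [my' mz' mb'] [/= tT _].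
have {}tT : 0 <= t <= T by move: tT; rewrite in_itv.
have i0 (f : R -> R) : (0 <= \int[ell]_(z in @R0 R) (f z ^+ 2)%:E)%E.
  by apply: integral_ge0 => z _; rewrite lee_fin sqr_ge0.
have r0 (x : R) : (0 <= (x ^+ 2)%:E)%E by rewrite lee_fin sqr_ge0.
rewrite /nrm /=; apply: add3_le => //.
have ms (f : R -> R) : measurable_fun (@R0 R) f -> measurable_fun (@R0 R) (fun z => (f z ^+ 2)%:E).
  by move=> mf; apply/measurable_EFinP; exact: measurable_funX.
apply: ge0_integral_le2; first exact: measurable_R0.
- by apply: ms; exact: mfield_section.
- by apply: ms; exact: mfield_section.
- by apply: ms; apply: measurable_funD; exact: mfield_section.
- by [].
- by [].
- by [].
- by move=> z _; exact: sqrD_le.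
Qed.

Lemma energy_add a b u v : 0 <= a -> b <= T -> mintegrand u -> mintegrand v ->
  (energy a b (iadd u v) <= 2%:E * energy a b u + 2%:E * energy a b v)%E.
Proof.
move=> a0 bT mu' mv.
have i0 u' w : (0 <= \int[mu]_(t in `[a, b]) nrm u' (t, w))%E.
  by apply: integral_ge0 => t _; exact: nrm_ge0.
apply: ge0_integral_le2 => //.
- exact: measurable_nrm_int.
- exact: measurable_nrm_int.
- by apply: measurable_nrm_int => //; exact: iadd_meas.
move=> w _; apply: ge0_integral_le2 => //.
- exact: measurable_nrm_time.
- exact: measurable_nrm_time.
- by apply: measurable_nrm_time => //; exact: iadd_meas.
- by move=> t _; exact: nrm_ge0.
- by move=> t _; exact: nrm_ge0.
- by move=> t _; exact: nrm_ge0.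
move=> t /=; rewrite in_itv/= => /andP[at_ tb]; apply: nrm_add => //.
by split => //=; rewrite in_itv/= (le_trans a0 at_) (le_trans tb).
Qed.

Lemma energy_opp a b u : energy a b (iopp u) = energy a b u.
Proof.
by apply: eq_integral => w _; apply: eq_integral => t _; exact: nrm_opp.
Qed.

Lemma energy_le a b u : 0 <= a -> b <= T -> mintegrand u ->
  (energy a b u <= energy 0 T u)%E.
Proof.
move=> a0 bT mu'; have i0 (s t : R) w : (0 <= \int[mu]_(r in `[s, t]) nrm u (r, w))%E.
  by apply: integral_ge0 => r _; exact: nrm_ge0.
apply: ge0_le_integral => //; [exact: measurable_nrm_int|exact: measurable_nrm_int|].
move=> w _; apply: ge0_subset_integral => //.
- exact: measurable_nrm_time.
- by move=> t _; exact: nrm_ge0.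
- by apply: subset_itv; rewrite bnd_simp.
Qed.

Let abs_sqr (x : R) : (`|x| ^+ 2)%:E = (x ^+ 2)%:E.
Proof. by rewrite real_normK ?num_real. Qed.

Lemma energyE u : mintegrand u ->
  (energy 0 T u = Eint2 P T (uy u) + Eint2 P T (ub u) + Eintjump2 P T ell (uz u))%E.
Proof.
move=> [my mz mb].
have r0 (x : R) : (0 <= (x ^+ 2)%:E)%E by rewrite lee_fin sqr_ge0.
have i0 (f : R -> R) : (0 <= \int[ell]_(z in @R0 R) (f z ^+ 2)%:E)%E.
  by apply: integral_ge0.
pose F1 (p : R * Omega) := (uy u p.1 p.2 ^+ 2)%:E.
pose F2 (p : R * Omega) := (ub u p.1 p.2 ^+ 2)%:E.
pose F3 (p : R * Omega) := (\int[ell]_(z in @R0 R) (uz u p.1 p.2 z ^+ 2)%:E)%E.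
have m1 : measurable_fun TO F1 by exact: mproc_sqr.
have m2 : measurable_fun TO F2 by exact: mproc_sqr.
have m3 : measurable_fun TO F3 by exact: mfield_sqr.
have mt (F : R * Omega -> \bar R) w : measurable_fun TO F -> measurable_fun `[0, T] (fun t => F (t, w)).
  by move=> mF; apply: measurable_section mF _; exact: measurable_itv.
have mi F : measurable_fun TO F -> (forall p, (0 <= F p)%E) ->
    measurable_fun setT (fun w => \int[mu]_(t in `[0%R, T]) F (t, w))%E.
  by move=> mF F0; exact: (@measurable_int_time _ _ _ `[0, T]).
have ii (F : R * Omega -> \bar R) w : (forall p, (0 <= F p)%E) -> (0 <= \int[mu]_(t in `[0%R, T]) F (t, w))%E.
  by move=> F0; exact: integral_ge0.
transitivity (\int[P]_w (\int[mu]_(t in `[0%R, T]) F1 (t, w) +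
  \int[mu]_(t in `[0%R, T]) F2 (t, w) + \int[mu]_(t in `[0%R, T]) F3 (t, w)))%E.
  apply: eq_integral => w _.
  have e1 : (\int[mu]_(t in `[0%R, T]) (F1 (t, w) + F2 (t, w)) =
      \int[mu]_(t in `[0%R, T]) F1 (t, w) + \int[mu]_(t in `[0%R, T]) F2 (t, w))%E.
    apply: ge0_integralD; first exact: measurable_itv.
    - by move=> t _; exact: r0.
    - exact: (mt F1 w m1).
    - by move=> t _; exact: r0.
    - exact: (mt F2 w m2).
  rewrite -e1; apply: ge0_integralD; first exact: measurable_itv.
  - by move=> t _; rewrite adde_ge0.
  - by apply: emeasurable_funD; [exact: (mt F1 w m1)|exact: (mt F2 w m2)].
  - by move=> t _; exact: i0.
  - exact: (mt F3 w m3).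
have n1 p : (0 <= F1 p)%E by exact: r0.
have n2 p : (0 <= F2 p)%E by exact: r0.
have n3 p : (0 <= F3 p)%E by exact: i0.
pose A1 w := (\int[mu]_(t in `[0%R, T]) F1 (t, w))%E.
pose A2 w := (\int[mu]_(t in `[0%R, T]) F2 (t, w))%E.
pose A3 w := (\int[mu]_(t in `[0%R, T]) F3 (t, w))%E.
have a1 w : (0 <= A1 w)%E := ii F1 w n1.
have a2 w : (0 <= A2 w)%E := ii F2 w n2.
have a3 w : (0 <= A3 w)%E := ii F3 w n3.
have mA1 : measurable_fun setT A1 := mi F1 m1 n1.
have mA2 : measurable_fun setT A2 := mi F2 m2 n2.
have mA3 : measurable_fun setT A3 := mi F3 m3 n3.
have -> : Eint2 P T (uy u) = (\int[P]_w A1 w)%E.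
  by apply: eq_integral => w _; apply: eq_integral => t _; rewrite abs_sqr.
have -> : Eint2 P T (ub u) = (\int[P]_w A2 w)%E.
  by apply: eq_integral => w _; apply: eq_integral => t _; rewrite abs_sqr.
have -> : Eintjump2 P T ell (uz u) = (\int[P]_w A3 w)%E.
  apply: eq_integral => w _; apply: eq_integral => t _.
  by apply: eq_integral => z _; rewrite abs_sqr.
have e2 : (\int[P]_w (A1 w + A2 w) = \int[P]_w A1 w + \int[P]_w A2 w)%E.
  apply: ge0_integralD; [exact: measurableT|by move=> w _;
    exact: a1|exact: mA1|by move=> w _; exact: a2|exact: mA2].
rewrite -e2; apply: ge0_integralD; [exact: measurableT| | |by move=> w _;
  exact: a3|exact: mA3].
- by move=> w _; exact: adde_ge0 (a1 w) (a2 w).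
- exact: emeasurable_funD.
Qed.

End integrands.

(** * Stochastic integrals *)

Section noise_integral.
Context (R : realType) (d : measure_display) (Omega : measurableType d).
Context (P : probability Omega R) (T : R) (ell : {measure set R -> \bar R}).
Variables (W B : R -> Omega -> R) (N : R.-ker Omega ~> (R * R)%type).
Hypothesis hP : measure_is_complete P.
Hypothesis hW : brownian_motion P T W.
Hypothesis hB : brownian_motion P T B.
Hypothesis hN : poisson_random_measure P T ell N.
Hypothesis hWBN : independent_noises P T ell W B N.

Local Notation G := (filtrationG P T ell W B N).
Local Notation mu := (@lebesgue_measure R).
Local Notation incr := (incr T ell W B N).
Hypothesis hT : 0 < T.
Hypothesis hell : (\int[ell]_(z in @R0 R) (z ^+ 2)%:E < +oo)%E.

Local Notation tm := (term R Omega (mark R)).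
Local Notation twf := (@twf R d Omega T G (mark R) (valid ell)).
Local Notation fint := (@fint R d Omega (mark R) incr).
Local Notation fsqr := (@fsqr R d Omega (mark R) (kap ell)).
Local Notation energy := (energy P ell).

Let G_meas t : t <= T -> G t `<=` measurable.
Proof. exact: (G_measurable hP hW hB). Qed.

Lemma kapC i j : kap ell i j = kap ell j i.
Proof. by case: i j => [||A] [||A'] //=; rewrite setIC. Qed.

Lemma noise_isometry n (x : 'I_n -> tm) a b : 0 <= a -> a <= b -> b <= T ->
  (forall k, twf (x k)) ->
  L1 P (fun w => \int[mu]_(t in `]a, b]) fsqr x t w) /\
  E P (fun w => (fint x b w - fint x a w) ^+ 2) =
  E P (fun w => \int[mu]_(t in `]a, b]) fsqr x t w).
Proof.
have := (@fint_isometry R d Omega P T G (mark R) (valid ell) incr (kap ell)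
  G_meas (@mwrt_G_le _ _ _ _ _ _ _ _ _) kapC (incr0 T ell W B N)
  (incr_L2 hW hB hN) (@incr_mwrt _ _ _ _ _ _ _ _ _)
  (incr_orth hP hW hB hN hWBN) (incr_cross hP hW hB hN hWBN) (incr_add W B hN)).
 exact.
Qed.

Lemma noise_fint_L2 n (x : 'I_n -> tm) t : 0 <= t -> t <= T ->
  (forall k, twf (x k)) -> L2 P (fint x t).
Proof. exact: (fint_L2 G_meas (incr_L2 hW hB hN)). Qed.

Lemma noise_fint_orth n (x : 'I_n -> tm) a b c : 0 <= a -> a <= b -> b <= T ->
  (forall k, twf (x k)) -> mwrt (G a) c -> L2 P c ->
  E P (fun w => c w * (fint x b w - fint x a w)) = 0.
Proof.
apply: (fint_orth G_meas (@mwrt_G_le _ _ _ _ _ _ _ _ _) (incr0 T ell W B N)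
  (incr_L2 hW hB hN) (incr_orth hP hW hB hN hWBN) (incr_add W B hN)).
Qed.

(** With [wgtB] and [wgtN] these are the coordinates of a mark as a vector of R x R x L2(ell); [kap]
    is the inner product of these vectors. *)
Definition wgtW (i : mark R) : R := if i is MW then 1 else 0.
Definition wgtB (i : mark R) : R := if i is MB then 1 else 0.
Definition wgtN (i : mark R) (z : R) : R := if i is MN A then \1_A z else 0.

Lemma integrable_gN i j : valid ell i -> valid ell j ->
  ell.-integrable (@R0 R) (fun z => (wgtN i z * wgtN j z)%:E).
Proof.
have z0 (f : R -> R) : f =1 cst 0 -> ell.-integrable (@R0 R) (fun z => (f z)%:E).
  move=> f0; under eq_fun do rewrite f0; exact: integrable0.
case: i j => [||A] [||A'] vi vj; try by apply: z0 => z /=; rewrite ?mul0r ?mulr0.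
case: vi vj => [mA AR eA] [mA' _ _].
rewrite (_ : (fun _ => _) = EFin \o \1_(A `&` A')); last first.
  by apply/funext => z /=; rewrite indicI.
have mI : measurable (A `&` A') by exact: measurableI.
apply/integrableP; split.
  by apply/measurable_EFinP/measurable_indic.
under eq_integral => z _ do rewrite /= ger0_norm//.
rewrite integral_indic//; last exact: measurable_R0.
apply: le_lt_trans eA; apply: le_measure; rewrite ?inE//.
- by apply: measurableI => //; exact: measurable_R0.
- by move=> z [[]].
Qed.

Lemma kapE i j : valid ell i -> valid ell j ->
  kap ell i j = wgtW i * wgtW j + wgtB i * wgtB j + \int[ell]_(z in @R0 R) (wgtN i z * wgtN j z).
Proof.
have z0 (f : R -> R) : f =1 cst 0 -> \int[ell]_(z in @R0 R) f z = 0.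
  move=> f0; under eq_Rintegral do rewrite f0.
  by rewrite /Rintegral integral0.
case: i j => [||A] [||A'] /= vi vj; rewrite ?mulr0 ?mul0r ?mulr1 ?addr0 ?add0r;
  try by rewrite z0 ?addr0// => z /=; rewrite ?mul0r ?mulr0.
case: vi vj => [mA AR eA] [mA' _ _].
rewrite /Rintegral; congr fine.
transitivity (\int[ell]_(z in @R0 R) (\1_(A `&` A') z)%:E)%E.
  rewrite integral_indic//; [|exact: measurable_R0|exact: measurableI].
  by congr (ell _); apply/esym/setIidPl => z [/AR].
by apply: eq_integral => z _; rewrite indicI.
Qed.

Definition fval n (x : 'I_n -> tm) : integrand R Omega :=
  Integrand (fun t w => \sum_(k < n) wgtW (ti (x k)) * (tc (x k) w * tind (x k) t))
    (fun t w z => \sum_(k < n) wgtN (ti (x k)) z * (tc (x k) w * tind (x k) t))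
    (fun t w => \sum_(k < n) wgtB (ti (x k)) * (tc (x k) w * tind (x k) t)).

Let twf_tc (x : tm) : twf x -> measurable_fun setT (tc x).
Proof.
move=> [[l0 lr rT _] [mc _]].
by apply: mwrt_measurable mc; apply: G_meas; exact: le_trans rT.
Qed.

Lemma fval_meas n (x : 'I_n -> tm) : (forall k, twf (x k)) ->
  mintegrand T (fval x).
Proof.
move=> wx.
have mt k : measurable_fun setT (fun p : R * Omega => tc (x k) p.2 * tind (x k) p.1).
  apply: measurable_funM.
  - exact: measurableT_comp (twf_tc (wx k)) _.
  - by apply: measurableT_comp => //; apply: measurable_indic; exact: measurable_itv.
split; apply: measurable_funTS => /=.
- apply: measurable_sum => k; apply: measurable_funM => //.
- apply: measurable_sum => k; apply: measurable_funM.
    case: (ti (x k)) (wx k).1 => [||A] // [_ _ _ [mA _ _]] /=.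
    by apply: measurableT_comp => //; exact: measurable_indic.
  exact: measurableT_comp (mt k) _.
- by apply: measurable_sum => k; apply: measurable_funM.
Qed.

Lemma nrm_fval n (x : 'I_n -> tm) t w : (forall k, twf (x k)) ->
  nrm ell (fval x) (t, w) = (fsqr x t w)%:E.
Proof.
move=> wx; have vx k : valid ell (ti (x k)) by case: (wx k) => -[].
rewrite /nrm /=; pose a k := tc (x k) w * tind (x k) t.
have igk k m : ell.-integrable (@R0 R)
    (EFin \o (fun z => a k * a m * (wgtN (ti (x k)) z * wgtN (ti (x m)) z))).
  apply: (eq_integrable _ (fun z => (a k * a m)%:E * (wgtN (ti (x k)) z * wgtN (ti (x m)) z)%:E)%E) => //.
    exact: measurable_R0.
  by apply: integrableZl; [exact: measurable_R0|exact: integrable_gN].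
have sE z : (\sum_(k < n) wgtN (ti (x k)) z * (tc (x k) w * tind (x k) t)) ^+ 2 =
    \sum_(k < n) \sum_(m < n) a k * a m * (wgtN (ti (x k)) z * wgtN (ti (x m)) z).
  rewrite expr2 big_distrlr /=; apply: eq_bigr => k _; apply: eq_bigr => m _.
  by rewrite /a; ring.
under eq_integral do rewrite sE.
have <- : (\int[ell]_(z in @R0 R) \sum_(k < n) \sum_(m < n) (a k * a m * (wgtN (ti (x k)) z * wgtN (ti (x m)) z)))%:E =
   (\int[ell]_(z in @R0 R) (\sum_(k < n) \sum_(m < n) (a k * a m * (wgtN (ti (x k)) z * wgtN (ti (x m)) z)))%:E)%E.
  rewrite fineK//; apply: integrable_fin_num; first exact: measurable_R0.
  apply: integrable_sum_ord => [|k]; first exact: measurable_R0.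
  by apply: integrable_sum_ord => [|m]; [exact: measurable_R0|exact: igk].
rewrite -!EFinD; congr EFin.
rewrite Rintegral_sum_ord; last 2 first.
- exact: measurable_R0.
- by move=> k; apply: integrable_sum_ord => [|m]; [exact: measurable_R0|exact: igk].
rewrite /fsqr !expr2 !big_distrlr /= -!big_split /=; apply: eq_bigr => k _.
rewrite Rintegral_sum_ord; [|exact: measurable_R0|by move=> m; exact: igk].
rewrite -!big_split /=; apply: eq_bigr => m _.
rewrite kapE// RintegralZl; [|exact: measurable_R0|exact: integrable_gN].
by rewrite /a; ring.
Qed.

(** The isometry in terms of [energy]. One time interval is half-open and the other closed; the
    extra point is null. *)
Lemma energy_fval n (x : 'I_n -> tm) a b : 0 <= a -> a <= b -> b <= T ->
  (forall k, twf (x k)) ->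
  energy a b (fval x) = (E P (fun w => (fint x b w - fint x a w) ^+ 2))%:E.
Proof.
move=> a0 ab bT wx; have [L1x ->] := noise_isometry a0 ab bT wx.
rewrite E_EFin//; apply: eq_integral => w _.
have ix (D : set R) : measurable D -> mu.-integrable D (EFin \o (fun t => fsqr x t w)).
  move=> mD; apply: integrableS (fsqr_integrable _ x w) => //.
under eq_integral do rewrite nrm_fval//.
rewrite Rintegral_itv_obnd_cbnd; last by apply: ix; exact: measurable_itv.
rewrite fineK//; apply: integrable_fin_num; first exact: measurable_itv.
by apply: ix; exact: measurable_itv.
Qed.
End noise_integral.
Lemma young (R : realType) (e x y : R) : 0 < e ->
  `|x * y| <= e * x ^+ 2 / 2 + e^-1 * y ^+ 2 / 2.
Proof.
move=> e0; have ei : e * e^-1 = 1 by rewrite divff ?gt_eqF.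
have ei0 : 0 < e^-1 by rewrite invr_gt0.
rewrite ler_norml; apply/andP; split.
  have := mulr_ge0 (ltW ei0) (sqr_ge0 (e * x + y)).
  have -> : e^-1 * (e * x + y) ^+ 2 =
    (e * e^-1) * (e * x ^+ 2) + 2 * (e * e^-1) * (x * y) + e^-1 * y ^+ 2.
    by ring.
  by rewrite ei; lra.
have := mulr_ge0 (ltW ei0) (sqr_ge0 (e * x - y)).
have -> : e^-1 * (e * x - y) ^+ 2 =
  (e * e^-1) * (e * x ^+ 2) - 2 * (e * e^-1) * (x * y) + e^-1 * y ^+ 2.
  by ring.
by rewrite ei; lra.
Qed.

Lemma sqr_perturb (R : realType) (m p q : R) :
  (m - p + q) ^+ 2 <= 2 * m ^+ 2 + (4 * p ^+ 2 + 4 * q ^+ 2).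
Proof. by have := sqr_ge0 (m + p - q); have := sqr_ge0 (p + q); nra. Qed.

Section stochastic_integral.
Context (R : realType) (d : measure_display) (Omega : measurableType d).
Context (P : probability Omega R) (T : R) (ell : {measure set R -> \bar R}).
Variables (W B : R -> Omega -> R) (N : R.-ker Omega ~> (R * R)%type).
Hypothesis hP : measure_is_complete P.
Hypothesis hW : brownian_motion P T W.
Hypothesis hB : brownian_motion P T B.
Hypothesis hN : poisson_random_measure P T ell N.
Hypothesis hWBN : independent_noises P T ell W B N.

Local Notation G := (filtrationG P T ell W B N).
Local Notation incr := (incr T ell W B N).
Hypothesis hT : 0 < T.
Hypothesis hell : (\int[ell]_(z in @R0 R) (z ^+ 2)%:E < +oo)%E.

Local Notation tm := (term R Omega (mark R)).
Local Notation twf := (@twf R d Omega T G (mark R) (valid ell)).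
Local Notation fint := (@fint R d Omega (mark R) incr).
Local Notation energy := (energy P ell).

Let G_meas t : t <= T -> G t `<=` measurable.
Proof. exact: (G_measurable hP hW hB). Qed.

Let mwrtN (S : set (set Omega)) (f : Omega -> R) : mwrt S f ->
  mwrt S (fun w => - f w).
Proof.
move=> mf; have := mwrtB (mwrt_cst 0) mf.
by rewrite (_ : (fun w => 0 - f w) = fun w => - f w)//; apply/funext => w;
  rewrite sub0r.
Qed.

Definition dist2 (X Y : Omega -> R) : \bar R := (\int[P]_w ((X w - Y w) ^+ 2)%:E)%E.

(* M is the stochastic integral of the integrand u against all noises at once:
   it is approximated, at any two times, by integrals of elementary integrands. *)
Definition stochint (u : integrand R Omega) (M : R -> Omega -> R) : Prop :=
  [/\ mintegrand T u, forall t, 0 <= t <= T -> mwrt (G t) (M t) &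
    forall a b e, 0 <= a <= T -> 0 <= b <= T -> 0 < e ->
      exists n (x : 'I_n -> tm), (forall k, twf (x k)) /\
        [/\ (energy 0 T (iadd u (iopp (fval x))) <= e%:E)%E,
            (dist2 (M a) (fint x a) <= e%:E)%E &
            (dist2 (M b) (fint x b) <= e%:E)%E]].

Let mM (M : R -> Omega -> R) t : 0 <= t <= T ->
  (forall t, 0 <= t <= T -> mwrt (G t) (M t)) -> measurable_fun setT (M t).
Proof.
move=> tT mM; apply: mwrt_measurable (mM t tT); apply: G_meas.
by case/andP: tT.
Qed.

Let mfint n (x : 'I_n -> tm) t : (forall k, twf (x k)) -> 0 <= t <= T ->
  measurable_fun setT (fint x t).
Proof.
by move=> wx /andP[t0 tT]; apply: (@L2_measurable _ _ _ P);
  exact: (noise_fint_L2 hP hW hB hN).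
Qed.

Lemma dist2_add (X X' Y Y' : Omega -> R) :
  measurable_fun setT X -> measurable_fun setT X' ->
  measurable_fun setT Y -> measurable_fun setT Y' ->
  (dist2 (fun w => (X w + Y w)%R) (fun w => (X' w + Y' w)%R) <=
   2%:E * dist2 X X' + 2%:E * dist2 Y Y')%E.
Proof.
move=> mX mX' mY mY'.
have ms (f : Omega -> R) : measurable_fun setT f ->
    measurable_fun setT (fun w => (f w ^+ 2)%:E).
  by move=> mf; apply/measurable_EFinP; exact: measurable_funX.
apply: ge0_integral_le2 => //.
- by apply: ms; exact: measurable_funB.
- by apply: ms; exact: measurable_funB.
- by apply: ms; apply: measurable_funB; exact: measurable_funD.
- by move=> w _; rewrite lee_fin sqr_ge0.
- by move=> w _; rewrite lee_fin sqr_ge0.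
- by move=> w _; rewrite lee_fin sqr_ge0.
move=> w _; rewrite -!EFinM -EFinD lee_fin.
have := sqr_ge0 ((X w - X' w) - (Y w - Y' w)).
by nra.
Qed.

Let two_le (x y : \bar R) (e : R) : (x <= (e / 4)%:E)%E -> (y <= (e / 4)%:E)%E ->
  (2%:E * x + 2%:E * y <= e%:E)%E.
Proof.
move=> xe ye; apply: (@le_trans _ _ (2%:E * (e / 4)%:E + 2%:E * (e / 4)%:E)%E).
  by apply: leeD; rewrite lee_pmul2l//.
by rewrite -!EFinM -EFinD lee_fin; lra.
Qed.

(** Approximating families are concatenated. Each has accuracy e/4 because (p + q)^2 <= 2 p^2 + 2
    q^2. *)
Lemma stochint_add u v M M' : stochint u M -> stochint v M' ->
  stochint (iadd u v) (fun t w => M t w + M' t w).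
Proof.
move=> [mu' mM1 hu] [mv mM2 hv]; split.
- exact: iadd_meas.
- by move=> t tT; apply: mwrtD; [exact: mM1|exact: mM2].
move=> a b e aT bT e0; have e4 : 0 < e / 4 by rewrite divr_gt0.
have [n1 [x1 [w1 [en1 da1 db1]]]] := hu a b _ aT bT e4.
have [n2 [x2 [w2 [en2 da2 db2]]]] := hv a b _ aT bT e4.
pose x (k : 'I_(n1 + n2)) := match fintype.split k with inl i => x1 i | inr i => x2 i end.
have xl i : x (lshift n2 i) = x1 i by rewrite /x (unsplitK (inl i)).
have xr i : x (rshift n1 i) = x2 i by rewrite /x (unsplitK (inr i)).
have wx k : twf (x k) by rewrite /x; case: fintype.split.
have fE t w : fint x t w = fint x1 t w + fint x2 t w.
  rewrite /fint big_split_ord /=; congr (_ + _); apply: eq_bigr => i _;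
  by rewrite ?xl ?xr.
exists (n1 + n2)%N, x; split => //; split.
- have -> : iadd (iadd u v) (iopp (fval x)) =
      iadd (iadd u (iopp (fval x1))) (iadd v (iopp (fval x2))).
    rewrite /iadd /iopp /fval /=; congr Integrand.
    + apply/funext => t; apply/funext => w; rewrite big_split_ord /=.
      under eq_bigr do rewrite xl; under [X in _ - (_ + X)]eq_bigr do rewrite xr.
      by ring.
    + apply/funext => t; apply/funext => w; apply/funext => z; rewrite big_split_ord /=.
      under eq_bigr do rewrite xl; under [X in _ - (_ + X)]eq_bigr do rewrite xr.
      by ring.
    + apply/funext => t; apply/funext => w; rewrite big_split_ord /=.
      under eq_bigr do rewrite xl; under [X in _ - (_ + X)]eq_bigr do rewrite xr.
      by ring.
  apply: le_trans (two_le en1 en2); apply: (energy_add P hell (lexx 0) (lexx T));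
    by apply: iadd_meas => //; apply: iopp_meas; exact: (fval_meas hP hW hB).
- have -> : fint x a = (fun w => fint x1 a w + fint x2 a w).
    by apply/funext => w; exact: fE.
  apply: le_trans (two_le da1 da2); apply: dist2_add; by [exact: mM|exact: mfint].
- have -> : fint x b = (fun w => fint x1 b w + fint x2 b w).
    by apply/funext => w; exact: fE.
  apply: le_trans (two_le db1 db2); apply: dist2_add; by [exact: mM|exact: mfint].
Qed.

Lemma stochint_opp u M : stochint u M -> stochint (iopp u) (fun t w => - M t w).
Proof.
move=> [mu' mM1 hu]; split.
- exact: iopp_meas.
- by move=> t tT; exact: mwrtN (mM1 t tT).
move=> a b e aT bT e0.
have [n [x [wx [en da db]]]] := hu a b _ aT bT e0.
pose y k := Term (tl (x k)) (tr (x k)) (ti (x k)) (fun w => - tc (x k) w).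
have fE t w : fint y t w = - fint x t w.
  by rewrite /fint -sumrN; apply: eq_bigr => k _; rewrite /pint /= mulNr.
have dE (X Y : Omega -> R) : dist2 (fun w => - X w) (fun w => - Y w) = dist2 X Y.
  by apply: eq_integral => w _; rewrite -opprD sqrrN.
exists n, y; split.
  move=> k; have [[l0 lr rT vi] [mc [K cK]]] := wx k; split => //=; split.
    exact: mwrtN.
  by exists K => w; rewrite normrN.
split.
- have -> : iadd (iopp u) (iopp (fval y)) = iopp (iadd u (iopp (fval x))).
    rewrite /iadd /iopp /fval /=; congr Integrand.
    + apply/funext => t; apply/funext => w.
      under eq_bigr do rewrite mulNr mulrN; by rewrite sumrN; ring.
    + apply/funext => t; apply/funext => w; apply/funext => z.
      under eq_bigr do rewrite mulNr mulrN; by rewrite sumrN; ring.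
    + apply/funext => t; apply/funext => w.
      under eq_bigr do rewrite mulNr mulrN; by rewrite sumrN; ring.
  by rewrite energy_opp.
- have -> : fint y a = (fun w => - fint x a w) by apply/funext => w; exact: fE.
  by rewrite dE.
- have -> : fint y b = (fun w => - fint x b w) by apply/funext => w; exact: fE.
  by rewrite dE.
Qed.

Section consequences.
Variables (u : integrand R Omega) (M : R -> Omega -> R).
Hypothesis uM : stochint u M.

Lemma stochint_measurable t : 0 <= t <= T -> measurable_fun setT (M t).
Proof. by case: uM => _ mM1 _ tT; exact: mM. Qed.

Lemma stochint_L2 t : 0 <= t <= T -> L2 P (M t).
Proof.
move=> tT; have [mu' mM1 /(_ t t 1 tT tT ltr01)] := uM.
move=> [n [x [wx [_ dt _]]]].
have L2x : L2 P (fint x t) by case/andP: tT => *; exact: (noise_fint_L2 hP hW hB hN).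
have mMt := stochint_measurable tT.
have L2d : L2 P (fun w => M t w - fint x t w).
  have md : measurable_fun setT (fun w => M t w - fint x t w).
    by apply: measurable_funB => //; exact: L2_measurable L2x.
  split => //; apply: ge0_L1; first exact: measurable_funX.
    by move=> w; exact: sqr_ge0.
  by apply: le_lt_trans dt _; rewrite ltry.
by have := L2D L2d L2x; under eq_fun do rewrite subrK.
Qed.

Let approx a b e : 0 <= a <= T -> 0 <= b <= T -> 0 < e ->
  exists n (x : 'I_n -> tm), (forall k, twf (x k)) /\
    [/\ (energy 0 T (iadd u (iopp (fval x))) <= e%:E)%E,
        E P (fun w => (M a w - fint x a w) ^+ 2) <= e &
        E P (fun w => (M b w - fint x b w) ^+ 2) <= e].
Proof.
move=> aT bT e0; have [_ _ /(_ a b e aT bT e0)] := uM.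
move=> [n [x [wx [en da db]]]]; exists n, x; split; [exact: wx|split; [exact: en| | ]].
- have L2x : L2 P (fint x a) by case/andP: aT => *; exact: (noise_fint_L2 hP hW hB hN).
  by rewrite -lee_fin (E_EFin (L2_sqr (L2B (stochint_L2 aT) L2x))); exact: da.
- have L2x : L2 P (fint x b) by case/andP: bT => *; exact: (noise_fint_L2 hP hW hB hN).
  by rewrite -lee_fin (E_EFin (L2_sqr (L2B (stochint_L2 bT) L2x))); exact: db.
Qed.

(** Orthogonality is exact for the approximations, so only the errors at a and b remain; Young's
    inequality bounds each of them. *)
Lemma stochint_orth a b c : 0 <= a -> a <= b -> b <= T ->
  mwrt (G a) c -> L2 P c -> E P (fun w => c w * (M b w - M a w)) = 0.
Proof.
move=> a0 ab bT mc L2c.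
have aT : 0 <= a <= T by rewrite a0 (le_trans ab).
have b0T : 0 <= b <= T by rewrite (le_trans a0 ab).
have [K EK] : {K | E P (fun w => c w ^+ 2) = K} by exists (E P (fun w => c w ^+ 2)).
have K0 : 0 <= K by rewrite -EK; apply: E_ge0 => w; exact: sqr_ge0.
suff h e : 0 < e -> `|E P (fun w => c w * (M b w - M a w))| <= e * (K + 2).
  apply/eqP; rewrite -normr_eq0 eq_le normr_ge0 andbT.
  apply/ler_addgt0Pl => e e0; rewrite addr0.
  have K2 : 0 < K + 2 by rewrite ltr_wpDl.
  by have := h (e / (K + 2)) (divr_gt0 e0 K2); rewrite divfK ?gt_eqF.
move=> e0.
(* Accuracy e^2 compensates the factor 1/e in Young's inequality; each error is then at most e (K +
   1) / 2. *)
have [n [x [wx [_ da db]]]] := approx aT b0T (exprn_gt0 2 e0).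
have L2xa : L2 P (fint x a) by case/andP: aT => *; exact: (noise_fint_L2 hP hW hB hN).
have L2xb : L2 P (fint x b) by case/andP: b0T => *; exact: (noise_fint_L2 hP hW hB hN).
have L2Ma := stochint_L2 aT; have L2Mb := stochint_L2 b0T.
have La := L2B L2Ma L2xa; have Lb := L2B L2Mb L2xb.
have L2d := L2B L2xb L2xa; have L2Md := L2B L2Mb L2Ma.
have key X : L2 P X -> E P (fun w => X w ^+ 2) <= e ^+ 2 ->
    `|E P (fun w => c w * X w)| <= e * (K + 1) / 2.
  move=> L2X hX.
  have L1p : L1 P (fun w => e * c w ^+ 2 / 2 + e^-1 * X w ^+ 2 / 2).
    apply: L1D.
      have := L1Z 2^-1 (L1Z e (L2_sqr L2c)).
      by under eq_fun do rewrite mulrC.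
    have := L1Z 2^-1 (L1Z e^-1 (L2_sqr L2X)).
    by under eq_fun do rewrite mulrC.
  have hp : E P (fun w => e * c w ^+ 2 / 2 + e^-1 * X w ^+ 2 / 2) <= e * (K + 1) / 2.
    have -> : (fun w => e * c w ^+ 2 / 2 + e^-1 * X w ^+ 2 / 2) =
        (fun w => (e / 2) * c w ^+ 2 + (e^-1 / 2) * X w ^+ 2).
      by apply/funext => w; ring.
    have L1c := L1Z (e / 2) (L2_sqr L2c); have L1X := L1Z (e^-1 / 2) (L2_sqr L2X).
    rewrite ED// !EZ//; [|exact: L2_sqr|exact: L2_sqr].
    have : e^-1 / 2 * E P (fun w => X w ^+ 2) <= e^-1 / 2 * e ^+ 2.
      by apply: ler_wpM2l => //; rewrite divr_ge0// invr_ge0 ltW.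
    have -> : e^-1 / 2 * e ^+ 2 = e / 2 by field; rewrite gt_eqF.
    rewrite EK; move: (e^-1 / 2 * _) => q hq.
    by rewrite mulrDr mulr1 mulrDl (mulrAC e K) lerD2l.
  have L1cX := L2M L2c L2X.
  have pw w := young (c w) (X w) e0.
  apply: le_trans hp; rewrite ler_norml; apply/andP; split.
    rewrite lerNl -mulN1r -EZ//; apply: E_le => //; first exact: L1Z.
    by move=> w; rewrite mulN1r; apply: le_trans (pw w); rewrite -normrN;
      exact: ler_norm.
  by apply: E_le => // w; exact: le_trans (ler_norm _) (pw w).
have -> : E P (fun w => c w * (M b w - M a w)) =
    E P (fun w => c w * (M b w - fint x b w)) - E P (fun w => c w * (M a w - fint x a w)).
  rewrite -[LHS]subr0 -(noise_fint_orth hP hW hB hN hWBN a0 ab bT wx mc L2c).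
  rewrite -(EB (L2M L2c Lb) (L2M L2c La)).
  rewrite -(EB (L2M L2c L2Md) (L2M L2c L2d)).
  by congr E; apply/funext => w; ring.
apply: le_trans (ler_normB _ _) _.
apply: le_trans (lerD (key _ Lb db) (key _ La da)) _.
rewrite -splitr -subr_ge0 (_ : _ - _ = e); [exact: ltW|ring].
Qed.

(** Write u as the error plus the elementary integrand, whose energy is known exactly, then compare
    the elementary increment with that of M. Each comparison costs a factor 2. *)
Lemma stochint_energy a b : 0 <= a -> a <= b -> b <= T ->
  (energy a b u <= (4 * E P (fun w => (M b w - M a w) ^+ 2))%:E)%E.
Proof.
move=> a0 ab bT.
have aT : 0 <= a <= T by rewrite a0 (le_trans ab).
have b0T : 0 <= b <= T by rewrite (le_trans a0 ab).
have [V EV] : {V | E P (fun w => (M b w - M a w) ^+ 2) = V} by eexists.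
(* 18 = 2 + 2 * 8: the error energy counts twice, and the elementary increment has second moment at
   most 2 V + 8 e. *)
rewrite EV; suff h e : 0 < e -> (energy a b u <= (4 * V + 18 * e)%:E)%E.
  apply/lee_addgt0Pr => e e0.
  have := h (e / 18) (divr_gt0 e0 (ltr0n _ 18)).
  by rewrite [18 * _]mulrC divfK ?pnatr_eq0// -EFinD.
move=> e0; have [n [x [wx [en da db]]]] := approx aT b0T e0.
have L2xa : L2 P (fint x a) by case/andP: aT => *; exact: (noise_fint_L2 hP hW hB hN).
have L2xb : L2 P (fint x b) by case/andP: b0T => *; exact: (noise_fint_L2 hP hW hB hN).
have L2Ma := stochint_L2 aT; have L2Mb := stochint_L2 b0T.
have La := L2B L2Ma L2xa; have Lb := L2B L2Mb L2xb.
have L2d := L2B L2xb L2xa; have L2Md := L2B L2Mb L2Ma.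
have [mu' _ _] := uM; have mx := fval_meas hP hW hB wx.
have mux : mintegrand T (iadd u (iopp (fval x))).
  by apply: iadd_meas => //; exact: iopp_meas.
have {1}-> : u = iadd (iadd u (iopp (fval x))) (fval x).
  case: (u) => y z b'; rewrite /iadd /iopp /=; congr Integrand.
  - by apply/funext => t; apply/funext => w; rewrite subrK.
  - by apply/funext => t; apply/funext => w; apply/funext => s; rewrite subrK.
  - by apply/funext => t; apply/funext => w; rewrite subrK.
apply: le_trans (energy_add P hell a0 bT mux mx) _.
rewrite (energy_fval hP hW hB hN hWBN a0 ab bT wx).
have he : (energy a b (iadd u (iopp (fval x))) <= e%:E)%E.
  by apply: le_trans en; exact: (energy_le P hell).
have hV : E P (fun w => (fint x b w - fint x a w) ^+ 2) <= 2 * V + 8 * e.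
  apply: (@le_trans _ _ (E P (fun w => 2 * (M b w - M a w) ^+ 2 +
      (4 * (M b w - fint x b w) ^+ 2 + 4 * (M a w - fint x a w) ^+ 2)))).
    apply: E_le; first exact: L2_sqr.
    - apply: L1D; first exact/L1Z/L2_sqr.
      by apply: L1D; exact/L1Z/L2_sqr.
    - move=> w; have := sqr_perturb (M b w - M a w) (M b w - fint x b w) (M a w - fint x a w).
      by rewrite (_ : _ - _ - _ + _ = fint x b w - fint x a w)//; ring.
  rewrite ED; [|exact/L1Z/L2_sqr|by apply: L1D; exact/L1Z/L2_sqr].
  rewrite ED; [|exact/L1Z/L2_sqr|exact/L1Z/L2_sqr].
  rewrite !EZ; [|exact: L2_sqr|exact: L2_sqr|exact: L2_sqr].
  rewrite EV lerD2l (_ : 8 * e = 4 * e + 4 * e); last by ring.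
  exact: lerD (ler_wpM2l (ler0n R 4) db) (ler_wpM2l (ler0n R 4) da).
apply: (@le_trans _ _ (2%:E * e%:E + 2%:E * (2 * V + 8 * e)%:E)%E).
  by apply: leeD; rewrite lee_pmul2l// lee_fin.
by rewrite -!EFinM -EFinD lee_fin (_ : 2 * e + _ = 4 * V + 18 * e)//; ring.
Qed.

End consequences.
End stochastic_integral.

(** * The Ito integrals against W, B and the jumps as instances of [stochint] *)

Section stochastic_integral_intro.
Context (R : realType) (d : measure_display) (Omega : measurableType d).
Context (P : probability Omega R) (T : R) (ell : {measure set R -> \bar R}).
Variables (W B : R -> Omega -> R) (N : R.-ker Omega ~> (R * R)%type).
Hypothesis hP : measure_is_complete P.
Hypothesis hW : brownian_motion P T W.
Hypothesis hB : brownian_motion P T B.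
Hypothesis hN : poisson_random_measure P T ell N.
Hypothesis hWBN : independent_noises P T ell W B N.

Local Notation G := (filtrationG P T ell W B N).
Local Notation incr := (incr T ell W B N).
Hypothesis hT : 0 < T.
Hypothesis hell : (\int[ell]_(z in @R0 R) (z ^+ 2)%:E < +oo)%E.

Local Notation tm := (term R Omega (mark R)).
Local Notation twf := (@twf R d Omega T G (mark R) (valid ell)).
Local Notation fint := (@fint R d Omega (mark R) incr).
Local Notation energy := (energy P ell).

Let G_meas t : t <= T -> G t `<=` measurable.
Proof. exact: (G_measurable hP hW hB). Qed.

Local Notation stochint := (stochint P T ell W B N).

Let cvg0_le (f : nat -> \bar R) (e : R) : f @ \oo --> 0%E -> 0 < e ->
  \forall n \near \oo, (f n <= e%:E)%E.
Proof.
move=> f0 e0; apply: (f0 [set x | (x <= e%:E)%E]).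
have : nbhs 0%E [set x | (x < e%:E)%E].
  by apply: open_nbhs_nbhs; split; [exact: open_ereal_lt_ereal|rewrite /= lte_fin].
by apply: filterS => x /= /ltW.
Qed.

(** One index has to serve the energy and both times; three limits along the same sequence provide
    it. *)
Lemma stochint_lim u I (m : nat -> nat) (x : forall k, 'I_(m k) -> tm) :
  mintegrand T u -> (forall t, 0 <= t <= T -> mwrt (G t) (I t)) ->
  (forall k i, twf (x k i)) ->
  (fun k => energy 0 T (iadd u (iopp (fval (x k))))) @ \oo --> 0%E ->
  (forall t, 0 <= t <= T -> (fun k => dist2 P (I t) (fint (x k) t)) @ \oo --> 0%E) ->
  stochint u I.
Proof.
move=> mu' mI wx he hd; split => // a b e aT bT e0.
have h1 := cvg0_le he e0; have h2 := cvg0_le (hd a aT) e0;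
  have h3 := cvg0_le (hd b bT) e0.
have [k [k1 [k2 k3]]] := filter_ex (filterI h1 (filterI h2 h3)).
by exists (m k), (x k); split; [exact: wx|split; [exact: k1|exact: k2|exact: k3]].
Qed.

Section filtration.
Variable Fl : R -> set (set Omega).
Hypothesis FlG : forall t, Fl t `<=` G t.
Hypothesis FlT : Fl 0 setT.

Let mwrtFG t (f : Omega -> R) : mwrt (Fl t) f -> mwrt (G t) f.
Proof. by apply: mwrt_sub => E /FlG h; exact: sub_sigma_algebra. Qed.

Let Fl_meas t : t <= T -> Fl t `<=` measurable.
Proof. by move=> tT E /FlG; exact: G_meas. Qed.

Let gen_meas : gen_predictable T Fl `<=` measurable.
Proof.
move=> D [[A [FA ->]]|[s [t [A [s0 st tT FA ->]]]]].
  by apply: measurableX => //; apply: Fl_meas FA; exact: ltW.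
apply: measurableX; first exact: measurable_itv.
by apply: Fl_meas FA; exact: le_trans tT.
Qed.

(** Measurability on a domain is usable once the domain is itself predictable; it is the union of
    the generators over {0} and ]0, T]. *)
Let predT : <<s gen_predictable T Fl >> (`[0, T] `*` setT).
Proof.
have -> : (`[0, T] `*` setT : set (R * Omega)) = [set 0] `*` setT `|` `]0, T] `*` setT.
  apply/seteqP; split => -[t w] /=; rewrite !in_itv/=.
    move=> [/andP[]]; rewrite le_eqVlt => /predU1P[<-|t0] tT _; first by left.
    by right; rewrite t0 tT.
  by move=> [[-> _]|[/andP[/ltW -> ->] _]]//; rewrite lexx ltW.
apply: (@measurableU _ (g_sigma_algebraType (gen_predictable T Fl))).
- by apply: sub_sigma_algebra; left; exists setT.
- apply: sub_sigma_algebra; right; exists 0, T, setT; split => //; exact: ltW.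
Qed.

Lemma predictable_mproc Y : predictable T Fl Y -> mproc T Y.
Proof.
move=> pY _ C mC.
apply: (smallest_sub (@sigma_algebra_measurable _ (R * Omega)%type) gen_meas).
exact: pY predT C mC.
Qed.

Lemma predictable_mfield Z : predictable_field T Fl Z -> mfield T Z.
Proof.
move=> pZ.
apply: (@measurable_comp _ _ _ ((R * Omega) * R)%type (g_sigma_algebraType (gen_predictable T Fl) * R)%type _
  ((`[0, T] `*` setT) `*` @R0 R) (fun q => Z q.1.1 q.1.2 q.2) _ id) => //.
- apply: measurableX; first exact: predT.
  exact: measurable_R0.
- by move=> q [q' ? <-].
- apply: measurable_funTS; apply/measurable_fun_pairP; split => //=.
  rewrite (_ : fst \o id = fst)//.
  move=> _ C mC; rewrite setTI.
  have mC' : measurable (C : set (R * Omega)).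
    exact: (smallest_sub (@sigma_algebra_measurable _ (R * Omega)%type) gen_meas).
  by have := @measurable_fst _ _ (R * Omega)%type R measurableT C mC'; rewrite setTI.
  exact: measurable_snd.
Qed.

Let Eint20 : Eint2 P T (fun _ _ => 0) = 0%E.
Proof.
rewrite /Eint2 integral0_eq// => w _; rewrite integral0_eq// => t _.
by rewrite normr0 expr0n.
Qed.

Let Eintjump20 : Eintjump2 P T ell (fun _ _ _ => 0) = 0%E.
Proof.
rewrite /Eintjump2 integral0_eq// => w _; rewrite integral0_eq// => t _.
by rewrite integral0_eq// => z _; rewrite normr0 expr0n.
Qed.

Let dist2E X Y : dist2 P X Y = (\int[P]_w (`|X w - Y w| ^+ 2)%:E)%E.
Proof. by apply: eq_integral => w _; rewrite real_normK ?num_real. Qed.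

Definition intW Y : integrand R Omega := Integrand Y (fun _ _ _ => 0) (fun _ _ => 0).
Definition intB Y : integrand R Omega := Integrand (fun _ _ => 0) (fun _ _ _ => 0) Y.
Definition intN Z : integrand R Omega := Integrand (fun _ _ => 0) Z (fun _ _ => 0).

Let mproc0 : mproc T (fun (_ : R) (_ : Omega) => 0 : R).
Proof. exact: measurable_cst. Qed.
Let mfield0 : mfield T (fun (_ : R) (_ : Omega) (_ : R) => 0 : R).
Proof. exact: measurable_cst. Qed.

Let congr3E (x x' y y' z z' : \bar R) : x = x' -> y = y' -> z = z' ->
  (x + y + z = x' + y' + z')%E.
Proof. by move=> -> -> ->. Qed.

(** A simple process is a family of terms with the single mark [MW], so the jump and B parts of the
    error energy vanish and the given Ito approximations serve as they are. *)
Lemma stochint_W Y I : predictable T Fl Y -> brownian_integral P T Fl W Y I ->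
  stochint (intW Y) I.
Proof.
move=> pY [aI cI [h [wh hc ht]]].
have mY := predictable_mproc pY.
pose x k (i : 'I_(sp_size (h k))) : tm := Term (@sp_l _ _ _ (h k) i) (sp_r i) (MW R) (sp_c i).
have wx k i : twf (x k i).
  have [l0 lr rT mc bc] := wh k i.
  by split; [split|split => //; exact: mwrtFG].
apply: (stochint_lim (x := x)); [by split| |exact: wx| | ].
- by move=> t tT; apply: mwrtFG; exact: aI.
- rewrite (_ : (fun _ => _) = fun n => Eint2 P T (fun t w => Y t w - sp_val (h n) t w))//.
  apply/funext => k; rewrite (energyE P hell); last first.
    by apply: iadd_meas => //; apply: iopp_meas; exact: (fval_meas hP hW hB).
  transitivity (Eint2 P T (fun t w => (Y t w - sp_val (h k) t w)%R) +
    Eint2 P T (fun (_ : R) (_ : Omega) => 0%R) +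
    Eintjump2 P T ell (fun (_ : R) (_ : Omega) (_ : R) => 0%R))%E; last first.
    by rewrite Eint20 Eintjump20 !adde0.
  apply: congr3E.
  + apply: (congr1 (Eint2 P T)); apply/funext => t; apply/funext => w;
      apply: (congr1 (fun v : R => (Y t w - v)%R)).
    by apply: eq_bigr => i _; rewrite /= mul1r.
  + apply: (congr1 (Eint2 P T)); apply/funext => t; apply/funext => w.
    by rewrite /= big1 ?subr0// => i _; rewrite /= mul0r.
  + apply: (congr1 (Eintjump2 P T ell)); apply/funext => t; apply/funext => w;
      apply/funext => z.
    by rewrite /= big1 ?subr0// => i _; rewrite /= mul0r.
- move=> t tT; under eq_fun do rewrite dist2E; exact: ht.
Qed.

Lemma stochint_B Y I : predictable T Fl Y -> brownian_integral P T Fl B Y I ->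
  stochint (intB Y) I.
Proof.
move=> pY [aI cI [h [wh hc ht]]].
have mY := predictable_mproc pY.
pose x k (i : 'I_(sp_size (h k))) : tm := Term (@sp_l _ _ _ (h k) i) (sp_r i) (MB R) (sp_c i).
have wx k i : twf (x k i).
  have [l0 lr rT mc bc] := wh k i.
  by split; [split|split => //; exact: mwrtFG].
apply: (stochint_lim (x := x)); [by split| |exact: wx| | ].
- by move=> t tT; apply: mwrtFG; exact: aI.
- rewrite (_ : (fun _ => _) = fun n => Eint2 P T (fun t w => Y t w - sp_val (h n) t w))//.
  apply/funext => k; rewrite (energyE P hell); last first.
    by apply: iadd_meas => //; apply: iopp_meas; exact: (fval_meas hP hW hB).
  transitivity (Eint2 P T (fun (_ : R) (_ : Omega) => 0%R) +
    Eint2 P T (fun t w => (Y t w - sp_val (h k) t w)%R) +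
    Eintjump2 P T ell (fun (_ : R) (_ : Omega) (_ : R) => 0%R))%E; last first.
    by rewrite Eint20 Eintjump20 adde0 add0e.
  apply: congr3E.
  + apply: (congr1 (Eint2 P T)); apply/funext => t; apply/funext => w.
    by rewrite /= big1 ?subr0// => i _; rewrite /= mul0r.
  + apply: (congr1 (Eint2 P T)); apply/funext => t; apply/funext => w;
      apply: (congr1 (fun v : R => (Y t w - v)%R)).
    by apply: eq_bigr => i _; rewrite /= mul1r.
  + apply: (congr1 (Eintjump2 P T ell)); apply/funext => t; apply/funext => w;
      apply/funext => z.
    by rewrite /= big1 ?subr0// => i _; rewrite /= mul0r.
- move=> t tT; under eq_fun do rewrite dist2E; exact: ht.
Qed.

Lemma stochint_N Z I : predictable_field T Fl Z -> jump_integral P T ell Fl N Z I ->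
  stochint (intN Z) I.
Proof.
move=> pZ [aI cI [h [wh hc ht]]].
have mZ := predictable_mfield pZ.
pose x k (i : 'I_(sf_size (h k))) : tm := Term (@sf_l _ _ _ (h k) i) (sf_r i) (MN (sf_mark i)) (sf_c i).
have wx k i : twf (x k i).
  have [[l0 lr rT mc bc] mA AR eA] := wh k i.
  by split; [split|split => //; exact: mwrtFG].
apply: (stochint_lim (x := x)); [by split| |exact: wx| | ].
- by move=> t tT; apply: mwrtFG; exact: aI.
- rewrite (_ : (fun _ => _) =
    fun n => Eintjump2 P T ell (fun t w z => Z t w z - sf_val (h n) t w z))//.
  apply/funext => k; rewrite (energyE P hell); last first.
    by apply: iadd_meas => //; apply: iopp_meas; exact: (fval_meas hP hW hB).
  transitivity (Eint2 P T (fun (_ : R) (_ : Omega) => 0%R) +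
    Eint2 P T (fun (_ : R) (_ : Omega) => 0%R) +
    Eintjump2 P T ell (fun t w z => (Z t w z - sf_val (h k) t w z)%R))%E; last first.
    by rewrite Eint20 !add0e.
  apply: congr3E.
  + apply: (congr1 (Eint2 P T)); apply/funext => t; apply/funext => w.
    by rewrite /= big1 ?subr0// => i _; rewrite /= mul0r.
  + apply: (congr1 (Eint2 P T)); apply/funext => t; apply/funext => w.
    by rewrite /= big1 ?subr0// => i _; rewrite /= mul0r.
  + apply: (congr1 (Eintjump2 P T ell)); apply/funext => t; apply/funext => w;
      apply/funext => z; apply: (congr1 (fun v : R => (Z t w z - v)%R)).
    by apply: eq_bigr => i _; rewrite /= mulrC.
- move=> t tT; under eq_fun do rewrite dist2E; exact: ht.
Qed.

End filtration.
End stochastic_integral_intro.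

(** * Doob's inequality *)

Section grid_maximum.
Context (R : realType).
Implicit Types (s : nat -> R) (y : R -> R).

Fixpoint smax s n : R := if n is m.+1 then Num.max (smax s m) `|s n| else `|s 0%N|.

Lemma smax_ge s n k : (k <= n)%N -> `|s k| <= smax s n.
Proof.
elim: n => [|n IH]; first by rewrite leqn0 => /eqP ->.
rewrite leq_eqVlt => /predU1P[->|/IH h] /=; first by rewrite le_max lexx orbT.
by rewrite le_max h.
Qed.

Lemma smax_ge0 s n : 0 <= smax s n.
Proof. exact: le_trans (normr_ge0 _) (smax_ge s (leqnn n)). Qed.

Lemma smax_ex s n : exists2 k, (k <= n)%N & smax s n = `|s k|.
Proof.
elim: n => [|n [k kn IH]] /=; first by exists 0%N.
case: (leP (smax s n) `|s n.+1|) => h; first by exists n.+1.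
by exists k => //; exact: leq_trans kn _.
Qed.

Definition sg (x : R) : R := if 0 <= x then 1 else -1.

(* The pathwise form of Doob's inequality: the sum is a martingale transform. *)
Lemma doob_pathwise s n :
  smax s n ^+ 2 + 4 * \sum_(k < n) (sg (s k) * smax s k) * (s k.+1 - s k) <=
  4 * s n ^+ 2.
Proof.
(* With m the maximum, this sharper bound passes through the induction; the claim follows from (2 |s
   n| - m)^2 >= 0. *)
suff h : 2 * \sum_(k < n) (sg (s k) * smax s k) * (s k.+1 - s k) <=
    2 * (smax s n * `|s n|) - smax s n ^+ 2.
  have : s n ^+ 2 = `|s n| ^+ 2 by rewrite real_normK ?num_real.
  have := sqr_ge0 (2 * `|s n| - smax s n); nra.
elim: n => [|n IH] /=; first by rewrite big_ord0; have := sqr_ge0 `|s 0%N|; nra.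
rewrite big_ord_recr /= mulrDr.
set D := 2 * \sum_(k < n) _ in IH *.
have m0 := smax_ge0 s n; set m := smax s n in IH m0 *.
have hs : sg (s n) * (s n.+1 - s n) <= `|s n.+1| - `|s n|.
  rewrite /sg; case: (leP 0 (s n)) => s0.
    by rewrite mul1r (ger0_norm s0); have := ler_norm (s n.+1); lra.
  by rewrite (ltr0_norm s0); have := ler_norm (- s n.+1); rewrite normrN; lra.
have {}hs : sg (s n) * m * (s n.+1 - s n) <= m * `|s n.+1| - m * `|s n|.
  by rewrite (mulrC (sg _)) -mulrA -mulrBr; exact: ler_wpM2l.
case: (leP m `|s n.+1|) => h.
  have := sqr_ge0 (`|s n.+1| - m); nra.
lra.
Qed.

Variables (a b : R).
Hypothesis ab : a < b.

(** The dyadic grid, stopped at b once k exceeds 2^n, so that every natural k is a legitimate time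
    for the discrete inequality. *)
Definition tgrid n k : R := a + (b - a) * ((minn k (2 ^ n))%:R / (2 ^ n)%:R).

Let p2 n : 0 < (2 ^ n)%:R :> R.
Proof. by rewrite ltr0n expn_gt0. Qed.

Lemma tgrid_itv n k : a <= tgrid n k <= b.
Proof.
have ba : 0 <= b - a by rewrite subr_ge0 ltW.
rewrite /tgrid lerDl mulr_ge0 ?divr_ge0//= -lerBrDl ler_piMr//.
by rewrite ler_pdivrMr// mul1r ler_nat geq_minr.
Qed.

Lemma tgrid_le n k : tgrid n k <= tgrid n k.+1.
Proof.
rewrite /tgrid lerD2l; apply: ler_wpM2l; first by rewrite subr_ge0 ltW.
apply: ler_wpM2r; first by rewrite invr_ge0 ltW.
by rewrite ler_nat leq_min geq_minr andbT geq_min leqnSn.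
Qed.

Lemma tgrid_end n : tgrid n (2 ^ n) = b.
Proof. by rewrite /tgrid minnn divff ?gt_eqF// mulr1 addrC subrK. Qed.

Lemma tgridS n k : tgrid n.+1 (2 * k) = tgrid n k.
Proof.
by rewrite /tgrid expnS -minnMr !natrM -mulf_div divff ?mul1r.
Qed.

(** The grid points lie strictly to the right of t because they are used with right continuity. *)
Lemma tgrid_dense t e : a <= t < b -> 0 < e ->
  exists n k, (k <= 2 ^ n)%N /\ t < tgrid n k < t + e.
Proof.
move=> /andP[at_ tb] e0; have ba : 0 < b - a by rewrite subr_gt0.
have [n hn] : exists n, (b - a) / e < (2 ^ n)%:R.
  exists (Num.truncn ((b - a) / e)).+1; apply: lt_trans (truncnS_gt _) _.
  by rewrite ltr_nat ltn_expl.
have y0 : 0 <= (t - a) / (b - a) * (2 ^ n)%:R.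
  by rewrite mulr_ge0 ?divr_ge0 ?subr_ge0// ltW.
set y := _ * _ in y0; have /andP[y1 y2] := truncn_itv y0.
set k := Num.truncn y in y1 y2.
have kn : (k < 2 ^ n)%N.
  rewrite -(ltr_nat R); apply: le_lt_trans y1 _.
  by rewrite /y gtr_pMl// ltr_pdivrMr// mul1r ltrD2r.
have tE : t = a + (b - a) * (y / (2 ^ n)%:R).
  by rewrite /y mulfK ?gt_eqF// mulrC divfK ?gt_eqF// addrC subrK.
exists n, k.+1; split => //; rewrite /tgrid (minn_idPl kn); apply/andP; split.
  by rewrite [ltLHS]tE ltrD2l ltr_pM2l// ltr_pM2r ?invr_gt0.
have -> : a + (b - a) * (k.+1%:R / (2 ^ n)%:R) =
    a + (b - a) * (k%:R / (2 ^ n)%:R) + (b - a) / (2 ^ n)%:R.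
  by rewrite -natr1; ring.
apply: (@le_lt_trans _ _ (t + (b - a) / (2 ^ n)%:R)).
  rewrite lerD2r [leRHS]tE lerD2l ler_pM2l// ler_pM2r ?invr_gt0//.
by rewrite ltrD2l ltr_pdivrMr// -ltr_pdivrMl// mulrC.
Qed.

Definition gmax y n : R := smax (fun k => y (tgrid n k)) (2 ^ n).

(** The supremum of y^2 over dyadic points. As an increasing limit of finite maxima it is measurable
    in w and open to monotone convergence. *)
Definition gsup y : \bar R := limn (fun n => (gmax y n ^+ 2)%:E).

Lemma gmax_ge0 y n : 0 <= gmax y n.
Proof. exact: smax_ge0. Qed.

Lemma gmax_ge y n k : (k <= 2 ^ n)%N -> `|y (tgrid n k)| <= gmax y n.
Proof. by move=> kn; exact: (smax_ge (fun k => y (tgrid n k))). Qed.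

Lemma gmax_mono y : {homo gmax y : n m / (n <= m)%N >-> n <= m}.
Proof.
apply: homo_leq => [x|x z t|n]; [exact: lexx|exact: le_trans|].
rewrite {1}/gmax; have [k kn ->] := smax_ex (fun k => y (tgrid n k)) (2 ^ n).
by rewrite -tgridS; apply: gmax_ge; rewrite expnS leq_mul2l.
Qed.

Lemma gmax2_mono y :
  {homo (fun n => (gmax y n ^+ 2)%:E) : n m / (n <= m)%N >-> (n <= m)%E}.
Proof.
by move=> n m /(gmax_mono y) h; rewrite lee_fin ler_pXn2r// ?nnegrE ?gmax_ge0.
Qed.

Lemma gsup_ge y n : ((gmax y n ^+ 2)%:E <= gsup y)%E.
Proof.
have gE : gsup y = _ := cvg_lim _ (ereal_nondecreasing_cvgn (gmax2_mono y)).
rewrite gE//.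
by apply: ereal_sup_ubound; exists n.
Qed.

Lemma gsup_ge0 y : (0 <= gsup y)%E.
Proof. by apply: le_trans (gsup_ge y 0); rewrite lee_fin sqr_ge0. Qed.

Lemma gsup_grid y n k : (k <= 2 ^ n)%N -> ((y (tgrid n k) ^+ 2)%:E <= gsup y)%E.
Proof.
move=> kn; apply: le_trans (gsup_ge y n).
rewrite lee_fin -real_normK ?num_real// ler_pXn2r ?nnegrE ?gmax_ge0//.
exact: gmax_ge.
Qed.

Lemma gsup_le y c :
  (forall n k, (k <= 2 ^ n)%N -> ((y (tgrid n k) ^+ 2)%:E <= c)%E) ->
  (gsup y <= c)%E.
Proof.
move=> yc; have gE : gsup y = _ := cvg_lim _ (ereal_nondecreasing_cvgn (gmax2_mono y)).
rewrite gE//; apply: ge_ereal_sup => _ [n _ <-] /=.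
rewrite /gmax; have [k kn ->] := smax_ex (fun k => y (tgrid n k)) (2 ^ n).
by rewrite real_normK ?num_real//; exact: yc.
Qed.

Definition itvsup y : \bar R := ereal_sup [set (`|y t| ^+ 2)%:E | t in `[a, b]].

Lemma itvsup_ge y t : a <= t <= b -> ((y t ^+ 2)%:E <= itvsup y)%E.
Proof.
move=> tab; apply: ereal_sup_ubound; exists t; first by rewrite /= in_itv.
by rewrite real_normK ?num_real.
Qed.

Lemma itvsup_ge0 y : (0 <= itvsup y)%E.
Proof.
by apply: le_trans (@itvsup_ge y a _); rewrite ?lee_fin ?sqr_ge0// lexx ltW.
Qed.

Lemma itvsup_le y c : (forall t, a <= t <= b -> ((y t ^+ 2)%:E <= c)%E) ->
  (itvsup y <= c)%E.
Proof.
move=> yc; apply: ge_ereal_sup => _ [t /= tab <-].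
by rewrite real_normK ?num_real//; apply: yc; move: tab; rewrite in_itv.
Qed.

(** Below b each value is a limit of grid values from the right; b has no right neighbours in the
    interval but is a grid point. *)
Lemma itvsup_gsup y : (forall t, a <= t < b -> y v @[v --> t^'+] --> y t) ->
  itvsup y = gsup y.
Proof.
move=> yr; apply/eqP; rewrite eq_le; apply/andP; split; last first.
  by apply: gsup_le => n k _; apply: itvsup_ge; exact: tgrid_itv.
apply: itvsup_le => t /andP[at_]; rewrite le_eqVlt => /predU1P[->|tb].
  by rewrite -(tgrid_end 0); exact: gsup_grid.
have tab : a <= t < b by rewrite at_.
have yt2 : (fun v : R => y v ^+ 2) v @[v --> t^'+] --> y t ^+ 2.
  exact: cvgM (yr t tab) (yr t tab).
apply/lee_addgt0Pr => e e0.
have yte : y t ^+ 2 - e < y t ^+ 2 by rewrite ltrBlDr ltrDl.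
have near_t : \forall v \near nbhs t, t < v -> y t ^+ 2 - e < y v ^+ 2 :=
  @cvgr_gt _ _ _ (at_right_proper_filter t) _ _ yt2 _ yte.
have [dl /= dl0 H] := (nbhs_ballP _ _).1 near_t.
have [n [k [kn /andP[tk ktd]]]] := tgrid_dense tab dl0.
apply: (@le_trans _ _ ((y (tgrid n k) ^+ 2)%:E + e%:E)%E).
  rewrite -EFinD lee_fin -lerBlDr; apply: ltW; apply: H => //=.
  by rewrite /ball/= ltr_distlC (lt_trans _ tk) ?ktd// gtrBl.
by apply: leeD => //; exact: gsup_grid.
Qed.

End grid_maximum.

Section doob.
Context (R : realType) (d : measure_display) (Omega : measurableType d).
Variable P : probability Omega R.

Lemma measurable_sg : measurable_fun setT (@sg R).
Proof.
apply: measurable_fun_ifT => //.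
by apply: measurable_fun_ler => //; exact: measurable_cst.
Qed.

Lemma mwrt_max S (f g : Omega -> R) : mwrt S f -> mwrt S g ->
  mwrt S (fun w => Num.max (f w) (g w)).
Proof. exact: measurable_maxr. Qed.

Lemma mwrt_norm S (f : Omega -> R) : mwrt S f -> mwrt S (fun w => `|f w|).
Proof. by move=> mf; apply: measurableT_comp => //; exact: normr_measurable. Qed.

Lemma mwrt_sg S (f : Omega -> R) : mwrt S f -> mwrt S (fun w => sg (f w)).
Proof. by move=> mf; apply: measurableT_comp => //; exact: measurable_sg. Qed.

Lemma L2_norm (f : Omega -> R) : L2 P f -> L2 P (fun w => `|f w|).
Proof.
move=> [mf f2]; split; first exact: measurableT_comp.
by under eq_fun do rewrite real_normK ?num_real//.
Qed.

Lemma L2_max (f g : Omega -> R) : L2 P f -> L2 P g ->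
  L2 P (fun w => Num.max (f w) (g w)).
Proof.
move=> [mf f2] [mg g2]; split; first exact: measurable_maxr.
apply: (@L1_le _ _ _ P _ (fun w => f w ^+ 2 + g w ^+ 2)); last exact: L1D.
  by apply: measurable_funX; exact: measurable_maxr.
move=> w; rewrite !ger0_norm ?sqr_ge0// ?addr_ge0 ?sqr_ge0//.
by case: (leP (f w) (g w)) => _; rewrite ?lerDl ?lerDr sqr_ge0.
Qed.

Section discrete.
Variables (S : nat -> Omega -> R) (H : nat -> set (set Omega)).
Hypothesis H_measurable : forall k, H k `<=` measurable.
Hypothesis H_mono : forall k (f : Omega -> R), mwrt (H k) f -> mwrt (H k.+1) f.
Hypothesis S_mwrt : forall k, mwrt (H k) (S k).
Hypothesis S_L2 : forall k, L2 P (S k).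
Hypothesis S_orth : forall k c, mwrt (H k) c -> L2 P c ->
  E P (fun w => c w * (S k.+1 w - S k w)) = 0.

Let mx n w := smax (S^~ w) n.

Lemma smax_mwrt n : mwrt (H n) (mx n).
Proof.
elim: n => [|n IH]; first exact: mwrt_norm.
by apply: mwrt_max; [exact: H_mono|exact: mwrt_norm].
Qed.

Lemma smax_L2 n : L2 P (mx n).
Proof.
elim: n => [|n IH]; first exact: L2_norm.
by apply: L2_max => //; exact: L2_norm.
Qed.

(** Take expectations in [doob_pathwise]: the coefficient of each increment is known at time k and
    square integrable, so the transform has mean 0. *)
Lemma doob_discrete n : E P (fun w => mx n w ^+ 2) <= 4 * E P (fun w => S n w ^+ 2).
Proof.
pose c k w := sg (S k w) * mx k w.
have mc k : mwrt (H k) (c k) by apply: mwrtM; [exact: mwrt_sg|exact: smax_mwrt].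
have L2c k : L2 P (c k).
  apply: L2_bddM; [|by exists 1 => w; rewrite /sg; case: ifP;
    rewrite ?normrN normr1|exact: smax_L2].
  exact: (mwrt_measurable (@H_measurable k) (mwrt_sg (@S_mwrt k))).
have L1d k : L1 P (fun w => c k w * (S k.+1 w - S k w)).
  by apply: L2M; [exact: L2c|exact: L2B].
have L1s := L1_sum (fun k : 'I_n => L1d k).
have Es : E P (fun w => \sum_(k < n) c k w * (S k.+1 w - S k w)) = 0.
  by rewrite (E_sum (fun k : 'I_n => L1d k)) big1// => k _; exact: S_orth.
rewrite -[leLHS]addr0 -(mulr0 4) -Es -(EZ 4 L1s) -(EZ 4 (L2_sqr (S_L2 n))).
rewrite -ED; [|exact: L2_sqr (smax_L2 n)|exact: L1Z].
apply: E_le => [||w]; first by apply: L1D; [exact: L2_sqr (smax_L2 n)|exact: L1Z].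
  exact/L1Z/L2_sqr.
exact: (doob_pathwise (S^~ w)).
Qed.

End discrete.

Section continuous.
Variables (G : R -> set (set Omega)) (a b : R) (U : R -> Omega -> R).
Hypothesis ab : a < b.
Hypothesis G_measurable : forall t, a <= t <= b -> G t `<=` measurable.
Hypothesis G_mono : forall s t (f : Omega -> R), s <= t -> mwrt (G s) f -> mwrt (G t) f.
Hypothesis U_mwrt : forall t, a <= t <= b -> mwrt (G t) (U t).
Hypothesis U_L2 : forall t, a <= t <= b -> L2 P (U t).
Hypothesis U_orth : forall s t c, a <= s -> s <= t -> t <= b ->
  mwrt (G s) c -> L2 P c -> E P (fun w => c w * (U t w - U s w)) = 0.

Lemma measurable_gmax (X : R -> Omega -> R) n :
  (forall t, a <= t <= b -> measurable_fun setT (X t)) ->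
  measurable_fun setT (fun w => (gmax a b (X^~ w) n ^+ 2)%:E).
Proof.
move=> mX; apply/measurable_EFinP; apply: measurable_funX.
rewrite /gmax; elim: (2 ^ n)%N => [|k IH] /=.
  by apply: measurableT_comp => //; apply: mX; exact: tgrid_itv.
apply: measurable_maxr => //.
by apply: measurableT_comp => //; apply: mX; exact: tgrid_itv.
Qed.

Lemma measurable_gsup (X : R -> Omega -> R) :
  (forall t, a <= t <= b -> measurable_fun setT (X t)) ->
  measurable_fun setT (fun w => gsup a b (X^~ w)).
Proof.
move=> mX; apply: (emeasurable_fun_cvg (fun n w => (gmax a b (X^~ w) n ^+ 2)%:E)).
  by move=> n; exact: measurable_gmax.
by move=> w _; apply: ereal_nondecreasing_is_cvgn; exact: gmax2_mono.
Qed.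

(** Grid maxima increase, so the discrete bound passes to the limit; every grid ends at b, hence the
    common right-hand side. *)
Lemma doob_gsup :
  (\int[P]_w gsup a b (U^~ w) <= (4 * E P (fun w => U b w ^+ 2))%:E)%E.
Proof.
have mU t : a <= t <= b -> measurable_fun setT (U t).
  by move=> tab; exact: (L2_measurable (U_L2 tab)).
have h : (fun n => \int[P]_w (gmax a b (U^~ w) n ^+ 2)%:E)%E @ \oo -->
    (\int[P]_w gsup a b (U^~ w))%E.
  apply: cvg_monotone_convergence => //.
  - by move=> n; exact: measurable_gmax.
  - by move=> n w _; rewrite lee_fin sqr_ge0.
  - by move=> w _; exact: gmax2_mono.
apply: (cvge_le _ h); apply: nearW => n.
have tg k : a <= tgrid a b n k <= b by exact: tgrid_itv.
have L2m := @smax_L2 (fun k => U (tgrid a b n k)) (fun k => U_L2 (tg k)) (2 ^ n).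
rewrite -(E_EFin (L2_sqr L2m)) lee_fin.
suff : E P (fun w => smax (fun k => U (tgrid a b n k) w) (2 ^ n) ^+ 2) <=
    4 * E P (fun w => U (tgrid a b n (2 ^ n)) w ^+ 2) by rewrite tgrid_end; exact.
apply: (@doob_discrete (fun k => U (tgrid a b n k)) (fun k => G (tgrid a b n k))).
- by move=> k; exact: G_measurable.
- by move=> k f; apply: G_mono; exact: tgrid_le.
- by move=> k; exact: U_mwrt.
- by move=> k; exact: U_L2.
move=> k c mc L2c; apply: U_orth => //; first by case/andP: (tg k).
  exact: tgrid_le.
by case/andP: (tg k.+1).
Qed.

End continuous.

End doob.

(** * The estimate on a short interval and its iteration *)

Section drift.
Context (R : realType).
Local Notation mu := (@lebesgue_measure R).

Let mu_itv (a b : R) : a < b -> mu `[a, b] = (b - a)%:E.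
Proof.
by move=> ab; apply: etrans (lebesgue_measure_itv _) _; rewrite /= lte_fin ab.
Qed.

Let int_cst (a b : R) (k : \bar R) : a < b ->
  (\int[mu]_(s in `[a, b]) k = k * (b - a)%:E)%E.
Proof.
move=> ab; have mD : measurable (`[a, b]%classic : set (measurableTypeR R)) by exact: measurable_itv.
by apply: etrans (integral_cst mu mD k) _; congr (_ * _)%E; exact: mu_itv.
Qed.

(** Cauchy-Schwarz, obtained by integrating 2 c |g| <= g^2 + c^2 for a suitable constant c. *)
Lemma sqr_integral_le (a b : R) (g : R -> R) : a < b ->
  mu.-integrable `[a, b] (EFin \o g) ->
  (((\int[mu]_(s in `[a, b]) `|g s|) ^+ 2)%:E <=
   (b - a)%:E * \int[mu]_(s in `[a, b]) (g s ^+ 2)%:E)%E.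
Proof.
move=> ab ig; have h0 : 0 < b - a by rewrite subr_gt0.
have mD : measurable (`[a, b]%classic : set (measurableTypeR R)) by exact: measurable_itv.
set r := (\int[mu]_(s in `[a, b]) `|g s|)%R; set q := (\int[mu]_(s in _) _)%E.
have r0 : 0 <= r by exact: Rintegral_ge0.
have mg : measurable_fun `[a, b] g by move/integrableP: ig => [/measurable_EFinP].
have mg2 : measurable_fun `[a, b] (fun s => (g s ^+ 2)%:E).
  by apply/measurable_EFinP; exact: measurable_funX.
have mag : measurable_fun `[a, b] (fun s => `|g s|%:E).
  by apply/measurable_EFinP; exact: measurableT_comp.
have q0 : (0 <= q)%E by apply: integral_ge0 => s _; rewrite lee_fin sqr_ge0.
have rE : r%:E = (\int[mu]_(s in `[a, b]) `|g s|%:E)%E.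
  rewrite /r fineK//; apply: integrable_fin_num => //.
  exact: (integrable_abse ig).
(* The mean of |g| is the optimal constant. *)
pose c := r / (b - a); have c0 : 0 <= c by rewrite divr_ge0// ltW.
have key : ((2 * c * r)%:E <= q + (c ^+ 2 * (b - a))%:E)%E.
  have -> : ((2 * c * r)%:E = \int[mu]_(s in `[a, b]) ((2 * c)%:E * `|g s|%:E))%E.
    rewrite ge0_integralZl//; first by rewrite EFinM rE.
    - by rewrite lee_fin mulr_ge0.
  have -> : (q + (c ^+ 2 * (b - a))%:E = \int[mu]_(s in `[a, b]) ((g s ^+ 2)%:E + (c ^+ 2)%:E))%E.
    have e := @ge0_integralD _ _ _ mu _ mD (fun s => (g s ^+ 2)%:E) (fun=> (c ^+ 2)%:E).
    rewrite e//; last 2 first.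
    - by move=> s _; rewrite lee_fin sqr_ge0.
    - by move=> s _; rewrite lee_fin sqr_ge0.
    by rewrite int_cst// -EFinM.
  apply: ge0_le_integral => //.
  - by move=> s _; rewrite -EFinM lee_fin;
      exact: mulr_ge0 (mulr_ge0 (ler0n R 2) c0) (normr_ge0 _).
  - by apply: (@measurable_funeM _ _ _ _ (fun s => `|g s|%:E)).
  - by apply: emeasurable_funD.
  - move=> s _; rewrite -EFinM -EFinD lee_fin.
    have := sqr_ge0 (`|g s| - c); rewrite sqrrB real_normK ?num_real//.
    rewrite -mulr_natr; lra.
(* If g^2 has infinite integral the right side is +oo, as b - a > 0. *)
move: key; case: q q0 => [q q0|_ _|//]; last by rewrite gt0_muley ?lte_fin// leey.
rewrite -EFinD -EFinM !lee_fin => key.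
have cr : c * (b - a) = r by rewrite /c divfK// gt_eqF.
have e1 : c ^+ 2 * (b - a) = c * r by rewrite expr2 -mulrA cr.
rewrite e1 in key; have {}key : c * r <= q by lra.
by have := ler_wpM2r (ltW h0) key; rewrite mulrAC cr -expr2 (mulrC q).
Qed.

(** The path [x] is bounded by its supremum before integration, so only [g] and [v] have to be
    measurable in time. *)
Lemma drift_bound (a b K : R) (g x : R -> R) (v : R -> \bar R) : a < b -> 0 <= K ->
  mu.-integrable `[a, b] (EFin \o g) ->
  measurable_fun `[a, b] v -> (forall s, 0 <= v s)%E ->
  {ae mu, forall s, a <= s <= b ->
    ((g s ^+ 2)%:E <= K%:E * ((x s ^+ 2)%:E + v s))%E} ->
  (((\int[mu]_(s in `[a, b]) `|g s|) ^+ 2)%:E <=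
   ((b - a) * K)%:E * ((b - a)%:E * itvsup a b x + \int[mu]_(s in `[a, b]) v s))%E.
Proof.
move=> ab K0 ig mv v0 hg; apply: le_trans (sqr_integral_le ab ig) _.
have h0 : 0 < b - a by rewrite subr_gt0.
have mD : measurable (`[a, b]%classic : set (measurableTypeR R)) by exact: measurable_itv.
have mg : measurable_fun `[a, b] g by move/integrableP: ig => [/measurable_EFinP].
have mg2 : measurable_fun `[a, b] (fun s => (g s ^+ 2)%:E).
  by apply/measurable_EFinP; exact: measurable_funX.
have s0 := itvsup_ge0 ab x.
rewrite EFinM -muleA; apply: lee_wpmul2l; first by rewrite lee_fin ltW.
have <- : (\int[mu]_(s in `[a, b]) (K%:E * (itvsup a b x + v s)) =
  K%:E * ((b - a)%:E * itvsup a b x + \int[mu]_(s in `[a, b]) v s))%E.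
  have e : (\int[mu]_(s in `[a, b]) (itvsup a b x + v s) =
      \int[mu]_(s in `[a, b]) itvsup a b x + \int[mu]_(s in `[a, b]) v s)%E.
    exact: (@ge0_integralD _ _ _ mu _ mD (fun=> itvsup a b x) v).
  rewrite ge0_integralZl//; last 2 first.
  - exact: emeasurable_funD.
  - by move=> s _; rewrite adde_ge0.
  by rewrite e int_cst// [(itvsup _ _ _ * _)%E]muleC.
apply: ae_ge0_le_integral => //.
- by move=> s _; rewrite lee_fin sqr_ge0.
- by move=> s _; rewrite mule_ge0 ?adde_ge0.
- by apply: measurable_funeM; exact: emeasurable_funD.
apply: (@filterS _ _ (ae_filter_ringOfSetsType mu) _ _ _ hg) => s hs /=;
  rewrite in_itv/= => sab.
apply: le_trans (hs sab) _; apply: lee_wpmul2l => //.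
by apply: leeD => //; exact: itvsup_ge.
Qed.

End drift.

Section bsde_estimate.
Context (R : realType) (d : measure_display) (Omega : measurableType d).
Variables (P : probability Omega R) (T : R) (G : R -> set (set Omega)).
Variables (x M : R -> Omega -> R) (v : R -> Omega -> \bar R) (K : R).
Local Notation mu := (@lebesgue_measure R).

Hypothesis hP : measure_is_complete P.
Hypothesis T0 : 0 < T.
Hypothesis K0 : 0 <= K.
Hypothesis G_measurable : forall t, t <= T -> G t `<=` measurable.
Hypothesis G_mono : forall s t (f : Omega -> R), s <= t -> mwrt (G s) f -> mwrt (G t) f.
Hypothesis M_mwrt : forall t, 0 <= t <= T -> mwrt (G t) (M t).
Hypothesis M_L2 : forall t, 0 <= t <= T -> L2 P (M t).
Hypothesis M_orth : forall a b c, 0 <= a -> a <= b -> b <= T ->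
  mwrt (G a) c -> L2 P c -> E P (fun w => c w * (M b w - M a w)) = 0.
Hypothesis v_ge0 : forall t w, (0 <= v t w)%E.
Hypothesis v_time : forall (a b : R) w, 0 <= a -> b <= T ->
  measurable_fun `[a, b] (v^~ w).
Hypothesis v_int : forall a b : R, 0 <= a -> b <= T ->
  measurable_fun setT (fun w => \int[mu]_(t in `[a, b]) v t w)%E.
Hypothesis M_energy : forall a b : R, 0 <= a -> a <= b -> b <= T ->
  (\int[P]_w \int[mu]_(t in `[a, b]) v t w <=
   (4 * E P (fun w => (M b w - M a w) ^+ 2))%:E)%E.
Hypothesis x_mwrt : forall t, 0 <= t <= T -> mwrt (G t) (x t).
Hypothesis x_cadlag : {ae P, forall w, cadlag T (x^~ w)}.
Hypothesis x_fin : (\int[P]_w itvsup 0 T (x^~ w) < +oo)%E.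
Hypothesis x_eq : {ae P, forall w, exists g : R -> R,
  [/\ mu.-integrable `[0, T] (EFin \o g),
      forall t, 0 <= t <= T ->
        x t w = x T w + \int[mu]_(s in `[t, T]) g s - (M T w - M t w) &
      {ae mu, forall s, 0 <= s <= T ->
        ((g s ^+ 2)%:E <= K%:E * ((x s w ^+ 2)%:E + v s w))%E}]}.

Let x_meas t : 0 <= t <= T -> measurable_fun setT (x t).
Proof.
move=> tT; apply: mwrt_measurable (x_mwrt tT); apply: G_measurable.
by case/andP: tT.
Qed.

Lemma ae_itvsup_gsup a b : 0 <= a -> a < b -> b <= T ->
  {ae P, forall w, itvsup a b (x^~ w) = gsup a b (x^~ w)}.
Proof.
move=> a0 ab bT; apply: filterS x_cadlag => w [xr _].
apply: itvsup_gsup => // t /andP[at_ tb]; apply: xr.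
by rewrite (le_trans a0 at_) (lt_le_trans tb bT).
Qed.

(** An uncountable supremum: it agrees almost surely with the dyadic one, and completeness of P
    transfers measurability. *)
Lemma measurable_itvsup a b : 0 <= a -> a < b -> b <= T ->
  measurable_fun setT (fun w => itvsup a b (x^~ w)).
Proof.
move=> a0 ab bT; apply: (ae_measurable_fun hP (f := fun w => gsup a b (x^~ w))).
  by apply: filterS (ae_itvsup_gsup a0 ab bT) => w ->.
apply: measurable_gsup => // t /andP[at_ tb]; apply: x_meas.
by rewrite (le_trans a0 at_) (le_trans tb bT).
Qed.

Lemma itvsup_sub a b w : 0 <= a -> a < b -> b <= T ->
  (itvsup a b (x^~ w) <= itvsup 0 T (x^~ w))%E.
Proof.
move=> a0 ab bT; apply: itvsup_le => // t /andP[at_ tb]; apply: itvsup_ge => //.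
by rewrite (le_trans a0 at_) (le_trans tb bT).
Qed.

Lemma itvsup_fin a b : 0 <= a -> a < b -> b <= T ->
  (\int[P]_w itvsup a b (x^~ w) < +oo)%E.
Proof.
move=> a0 ab bT; apply: le_lt_trans x_fin.
apply: ge0_le_integral => //; [by move=> w _; exact: itvsup_ge0| | |].
- exact: measurable_itvsup.
- exact: measurable_itvsup.
- by move=> w _; exact: itvsup_sub.
Qed.

Lemma x_L2 t : 0 <= t <= T -> L2 P (x t).
Proof.
move=> tT; split; first exact: x_meas.
apply: ge0_L1; first by apply: measurable_funX; exact: x_meas.
  by move=> w; exact: sqr_ge0.
apply: le_lt_trans x_fin; apply: ge0_le_integral => //.
- by move=> w _; rewrite lee_fin sqr_ge0.
- by apply/measurable_EFinP/measurable_funX; exact: x_meas.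
- exact: measurable_itvsup.
- by move=> w _; exact: itvsup_ge.
Qed.

Section one_step.
Variables a b : R.
Hypotheses (a0 : 0 <= a) (ab : a < b) (bT : b <= T).
Hypotheses (h1 : b - a <= 1) (hK : 52 * ((b - a) * K) <= 1).

Let aT : 0 <= a <= T. Proof. by rewrite a0 (le_trans (ltW ab)). Qed.
Let bT' : 0 <= b <= T. Proof. by rewrite bT (le_trans a0 (ltW ab)). Qed.
Let tT t : a <= t <= b -> 0 <= t <= T.
Proof. by move=> /andP[at_ tb]; rewrite (le_trans a0 at_) (le_trans tb bT). Qed.

(* U is a martingale started at x a, and differs from x by the accumulated drift. *)
Let U t w := x a w + (M t w - M a w).
Let S w := itvsup a b (x^~ w).
Let I w := (\int[mu]_(t in `[a, b]) v t w)%E.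
Let Rw w := (((b - a) * K)%:E * ((b - a)%:E * S w + I w))%E.

Let S0 w : (0 <= S w)%E. Proof. exact: itvsup_ge0. Qed.
Let I0 w : (0 <= I w)%E. Proof. by apply: integral_ge0. Qed.
Let h0 : 0 <= b - a. Proof. by rewrite subr_ge0 ltW. Qed.
Let R0 w : (0 <= Rw w)%E.
Proof.
rewrite mule_ge0// ?lee_fin ?mulr_ge0// adde_ge0//.
by rewrite mule_ge0.
Qed.
Let mS : measurable_fun setT S. Proof. exact: measurable_itvsup. Qed.
Let mI : measurable_fun setT I. Proof. exact: v_int. Qed.
Let mR : measurable_fun setT Rw.
Proof.
apply: measurable_funeM; apply: emeasurable_funD => //; exact: measurable_funeM.
Qed.

Let U_mwrt t : a <= t <= b -> mwrt (G t) (U t).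
Proof.
move=> tab; have /andP[at_ _] := tab; apply: mwrtD.
  by apply: G_mono (x_mwrt aT).
apply: mwrtB; first by apply: M_mwrt; exact: tT.
by apply: G_mono (M_mwrt aT).
Qed.

Let U_L2 t : a <= t <= b -> L2 P (U t).
Proof.
move=> tab; apply: L2D; first exact: x_L2.
by apply: L2B; apply: M_L2 => //; exact: tT.
Qed.

Let U_orth s t c : a <= s -> s <= t -> t <= b ->
  mwrt (G s) c -> L2 P c -> E P (fun w => c w * (U t w - U s w)) = 0.
Proof.
move=> as_ st tb mc L2c.
rewrite -(M_orth (le_trans a0 as_) st (le_trans tb bT) mc L2c).
by congr E; apply/funext => w; rewrite /U; ring.
Qed.

(** Subtracting the equations at a and t cancels the terminal terms and leaves U - x as the drift
    integrated over [a, t]. A single null set serves all t. *)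
Let drift_ae : {ae P, forall w, forall t, a <= t <= b ->
  (((U t w - x t w) ^+ 2)%:E <= Rw w)%E}.
Proof.
apply: filterS x_eq => w [g [ig xE hg]] t tab.
have /andP[at_ tb] := tab; have /andP[t0 tT'] := tT tab.
have igs (s r : R) : 0 <= s -> r <= T -> mu.-integrable `[s, r] (EFin \o g).
  move=> s0 rT; apply: integrableS ig; [exact: measurable_itv|exact: measurable_itv|].
  by apply: subset_itv; rewrite bnd_simp.
have J : U t w - x t w = \int[mu]_(s in `[a, t]) g s.
  have e := Rintegral_itvB (igs a T a0 (lexx T)) (_ : (BLeft a <= BRight t)%O) (_ : (BRight t <= BRight T)%O).
  have {}e := e at_ tT'.
  rewrite Rintegral_itv_obnd_cbnd in e; last first.
    apply: integrableS (igs a T a0 (lexx T));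
      [exact: measurable_itv|exact: measurable_itv|].
    by apply: subset_itv; rewrite bnd_simp.
  by rewrite /U (xE a aT) (xE t (tT tab)) -e; ring.
have ig_at := igs a t a0 tT'; have ig_ab := igs a b a0 bT.
apply: (@le_trans _ _ (((\int[mu]_(s in `[a, b]) `|g s|) ^+ 2)%:E)%E).
  rewrite lee_fin J -(real_normK (num_real _)) ler_pXn2r ?nnegrE//; last first.
    exact: Rintegral_ge0.
  have mD (r s : R) : measurable (`[r, s]%classic : set (measurableTypeR R)) by exact: measurable_itv.
  apply: le_trans (le_normr_Rintegral (mD a t) ig_at) _.
  have iga : mu.-integrable `[a, b] (EFin \o (fun s => `|g s|)) := integrable_norm ig_ab.
  have igt : mu.-integrable `[a, t] (EFin \o (fun s => `|g s|)) := integrable_norm ig_at.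
  have fin_ab := integrable_fin_num (mD a b) iga.
  have fin_at := integrable_fin_num (mD a t) igt.
  rewrite -lee_fin (fineK fin_ab) (fineK fin_at).
  apply: ge0_subset_integral; [exact: mD|exact: mD|..].
  - by case/integrableP: iga.
  - by move=> s _; rewrite lee_fin.
  - by apply: subset_itv; rewrite bnd_simp.
apply: drift_bound => //; first exact: v_time.
apply: (@filterS _ _ (ae_filter_ringOfSetsType mu) _ _ _ hg) => s hs sab.
exact/hs/tT.
Qed.

Let ae_le2 (f g h : Omega -> \bar R) :
  measurable_fun setT f -> measurable_fun setT g -> measurable_fun setT h ->
  (forall w, 0 <= f w)%E -> (forall w, 0 <= g w)%E -> (forall w, 0 <= h w)%E ->
  {ae P, forall w, h w <= 2%:E * f w + 2%:E * g w}%E ->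
  (\int[P]_w h w <= 2%:E * \int[P]_w f w + 2%:E * \int[P]_w g w)%E.
Proof.
move=> mf mg mh f0 g0 h0' hfg.
have m2 : measurable_fun setT (fun w => 2%:E * f w + 2%:E * g w)%E.
  by apply: emeasurable_funD; exact: measurable_funeM.
have p2 w : (0 <= 2%:E * f w + 2%:E * g w)%E by rewrite adde_ge0// mule_ge0.
apply: (@le_trans _ _ (\int[P]_w (2%:E * f w + 2%:E * g w))%E).
  by apply: ae_ge0_le_integral => //; apply: filterS hfg.
exact: ge0_integral_le2.
Qed.

Let sqr_le2 (y z : R) (c : \bar R) : (((y - z) ^+ 2)%:E <= c)%E ->
  ((y ^+ 2)%:E <= 2%:E * (z ^+ 2)%:E + 2%:E * c)%E.
Proof.
move=> h; apply: (@le_trans _ _ (2%:E * (z ^+ 2)%:E + 2%:E * ((y - z) ^+ 2)%:E)%E).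
  by rewrite -!EFinM -EFinD lee_fin; have := sqr_ge0 (y - z - z); nra.
by apply: leeD => //; exact: lee_wpmul2l.
Qed.

(** Origin of the constants: s + V <= 12 e + 2 r <= 24 q + 26 r, while h <= 1 and 52 h K <= 1 give
    26 r <= (s + V) / 2. Hence s + V <= 48 q. *)
Let combine (s V r q e h : R) : 0 <= s -> 0 <= V -> 0 <= h -> 0 <= q -> h <= 1 ->
  52 * (h * K) <= 1 ->
  r = h * K * (h * s + V) -> s <= 8 * e + 2 * r -> e <= 2 * q + 2 * r ->
  V <= 4 * e -> s <= 48 * q.
Proof.
move=> s0 V0 h0' q0 h1' hK' rE sr er Ve.
have hs : h * s <= s by rewrite -[leRHS]mul1r ler_wpM2r.
have hs0 : 0 <= h * s + V by rewrite addr_ge0// mulr_ge0.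
have := ler_wpM2r hs0 hK'; rewrite -mulrA -rE mul1r; lra.
Qed.

Lemma one_step :
  (\int[P]_w itvsup a b (x^~ w) <= (48 * E P (fun w => x b w ^+ 2))%:E)%E.
Proof.
have aab : a <= a <= b by rewrite lexx ltW.
have bab : a <= b <= b by rewrite lexx ltW.
have L2Ub := U_L2 bab; have L2xb := x_L2 bT'.
have L2dM : L2 P (fun w => M b w - M a w) by apply: L2B; exact: M_L2.
have ms (f : Omega -> R) : measurable_fun setT f -> measurable_fun setT (fun w : Omega => (f w ^+ 2)%:E).
  by move=> mf; apply/measurable_EFinP; exact: measurable_funX.
have s20 (f : Omega -> R) w : (0 <= (f w ^+ 2)%:E)%E by rewrite lee_fin sqr_ge0.
(* Absorption subtracts s and V from both sides, so both are first shown to be real numbers. *)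
have [s sE] : exists s, (\int[P]_w S w = s%:E)%E.
  exists (fine (\int[P]_w S w)); rewrite fineK// ge0_fin_numE; first exact: itvsup_fin.
  by apply: integral_ge0.
have [V VE] : exists V, (\int[P]_w I w = V%:E)%E.
  exists (fine (\int[P]_w I w)); rewrite fineK// ge0_fin_numE;
    last by apply: integral_ge0.
  by apply: le_lt_trans (M_energy a0 (ltW ab) bT) _; rewrite ltry.
have s0 : 0 <= s by rewrite -lee_fin -sE; apply: integral_ge0.
have V0 : 0 <= V by rewrite -lee_fin -VE; apply: integral_ge0.
pose r := (b - a) * K * ((b - a) * s + V).
have RE : (\int[P]_w Rw w = r%:E)%E.
  rewrite /r EFinM EFinD (EFinM _ s) -sE -VE.
  have e1 : (\int[P]_w ((b - a)%:E * S w + I w) =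
      \int[P]_w ((b - a)%:E * S w) + \int[P]_w I w)%E.
    apply: ge0_integralD => //; last exact: measurable_funeM.
    by move=> w _; rewrite mule_ge0.
  have e2 : (\int[P]_w ((b - a)%:E * S w) = (b - a)%:E * \int[P]_w S w)%E.
    by apply: ge0_integralZl => //; rewrite lee_fin.
  rewrite -e2 -e1; apply: ge0_integralZl => //.
  - by apply: emeasurable_funD => //; exact: measurable_funeM.
  - by move=> w _; rewrite adde_ge0// mule_ge0.
  - by rewrite lee_fin mulr_ge0.
have dU := drift_ae.
have A1 : s <= 8 * E P (fun w => U b w ^+ 2) + 2 * r.
  have mU t : a <= t <= b -> measurable_fun setT (U t) by move=> /U_L2[].
  have mg : measurable_fun setT (fun w => gsup a b (U^~ w)) by exact: measurable_gsup.
  have le1 : (\int[P]_w S w <= 2%:E * \int[P]_w gsup a b (U^~ w) + 2%:E * \int[P]_w Rw w)%E.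
    apply: ae_le2 => //; first by move=> w; exact: gsup_ge0.
    apply: (filterS2 _ _ dU (ae_itvsup_gsup a0 ab bT)) => w hU SE.
    (* The supremum of x is taken over grid points, so U is needed only there. *)
    rewrite /S SE; apply: gsup_le => // n k kn.
    have tab := tgrid_itv ab n k.
    apply: (@le_trans _ _ (2%:E * (U (tgrid a b n k) w ^+ 2)%:E + 2%:E * Rw w)%E).
      by apply: sqr_le2; rewrite -opprB sqrrN; exact: hU.
    apply: leeD => //; apply: lee_wpmul2l => //;
      exact: (@gsup_grid R a b (fun t => U t w) n k kn).
  have le2 := doob_gsup ab (fun t tab => G_measurable (andP (tT tab)).2) G_mono U_mwrt U_L2 U_orth.
  rewrite -lee_fin -sE; apply: le_trans le1 _; rewrite RE.
  apply: (@le_trans _ _ (2%:E * (4 * E P (fun w => U b w ^+ 2))%:E + 2%:E * r%:E)%E).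
    by rewrite leeD2r//; exact: lee_wpmul2l.
  by rewrite -!EFinM -EFinD lee_fin mulrA -natrM.
have A2 : E P (fun w => U b w ^+ 2) <= 2 * E P (fun w => x b w ^+ 2) + 2 * r.
  rewrite -lee_fin (E_EFin (L2_sqr L2Ub)).
  apply: (@le_trans _ _ (2%:E * \int[P]_w (x b w ^+ 2)%:E + 2%:E * \int[P]_w Rw w)%E); last first.
    by rewrite RE -(E_EFin (L2_sqr L2xb)) -!EFinM -EFinD.
  apply: ae_le2; [apply: ms; exact: (L2xb.1)|exact: mR|apply: ms;
    exact: L2Ub.1|exact: s20|exact: R0|exact: s20|].
  by apply: filterS dU => w hU; apply: sqr_le2; exact: hU.
have A3 : V <= 4 * E P (fun w => U b w ^+ 2).
  rewrite -lee_fin -VE; apply: le_trans (M_energy a0 (ltW ab) bT) _.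
  rewrite lee_fin; apply: ler_wpM2l => //.
  have L2xa := x_L2 aT.
  (* The cross term has mean 0, since x a is known at time a; so the second moment of the increment
     is at most that of U b. *)
  have -> : (fun w => U b w ^+ 2) = (fun w => x a w ^+ 2 +
      (2 * (x a w * (M b w - M a w)) + (M b w - M a w) ^+ 2)).
    by apply/funext => w; rewrite /U; ring.
  have L1p := L2M L2xa L2dM; have L1c := L1Z 2 L1p; have L1d := L2_sqr L2dM.
  rewrite (ED (L2_sqr L2xa) (L1D L1c L1d)) (ED L1c L1d) (EZ 2 L1p).
  rewrite (M_orth a0 (ltW ab) bT (x_mwrt aT) L2xa) mulr0 add0r lerDr.
  by apply: E_ge0 => w; exact: sqr_ge0.
rewrite -/S sE lee_fin.
apply: (combine s0 V0 h0 _ h1 hK erefl A1 A2 A3).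
by apply: E_ge0 => w; exact: sqr_ge0.
Qed.

End one_step.

(** Going one interval further back costs 48 times the second moment at the current left end, which
    the supremum already estimated controls. A supremum over two adjacent intervals is at most the
    sum of the two, hence 48 + 1. *)
Lemma bsde_estimate n : (0 < n)%N -> T / n%:R <= 1 ->
  52 * (T / n%:R * K) <= 1 ->
  (\int[P]_w itvsup 0 T (x^~ w) <= (49 ^+ n * E P (fun w => x T w ^+ 2))%:E)%E.
Proof.
move=> n0 h1 hK; set q := E P _.
have q0 : 0 <= q by apply: E_ge0 => w; exact: sqr_ge0.
have n0' : 0 < n%:R :> R by rewrite ltr0n.
set h := T / n%:R in h1 hK; have h0 : 0 < h by rewrite divr_gt0.
(* The mesh is numbered backwards from T and reaches 0 at k = n. *)
pose t k := T - k%:R * h.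
have tS k : t k - t k.+1 = h by rewrite /t -natr1; ring.
have tlt k : t k.+1 < t k by rewrite -subr_gt0 tS.
have t0 : t 0%N = T by rewrite /t mul0r subr0.
have tT k : t k <= T by rewrite /t gerBl; exact: mulr_ge0 (ler0n R k) (ltW h0).
have tn : t n = 0 by rewrite /t /h [n%:R * _]mulrC divfK ?subrr ?gt_eqF.
have tpos k : (k <= n)%N -> 0 <= t k.
  by move=> kn; rewrite -tn /t lerD2l lerN2 ler_pM2r// ler_nat.
suff key k : (k < n)%N ->
    (\int[P]_w itvsup (t k.+1) T (x^~ w) <= (49 ^+ k.+1 * q)%:E)%E.
  by have := key n.-1; rewrite prednK// tn; apply.
have step j : (j < n)%N ->
    (\int[P]_w itvsup (t j.+1) (t j) (x^~ w) <= (48 * E P (fun w => x (t j) w ^+ 2))%:E)%E.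
  by move=> jn; apply: one_step; rewrite ?tS//; exact: tpos.
elim: k => [|k IH] kn.
  have := step 0%N kn; rewrite t0 => /le_trans; apply; rewrite lee_fin expr1.
  by apply: ler_wpM2r => //; rewrite ler_nat.
have tk1T : t k.+1 < T by rewrite -t0 /t ltrD2l ltrN2 ltr_pM2r// ltr_nat.
have tk2T : t k.+2 < T := lt_trans (tlt _) tk1T.
have p2 := tpos _ kn; have p1 := tpos _ (ltnW kn).
have kn' : (k < n)%N := ltnW kn.
have t1T : 0 <= t k.+1 <= T by rewrite p1 tT.
have m1 := measurable_itvsup p2 (tlt _) (tT k.+1).
have m2 := measurable_itvsup p1 tk1T (lexx T).
have g1 w : (0 <= itvsup (t k.+2) (t k.+1) (x^~ w))%E by exact: itvsup_ge0.
have g2 w : (0 <= itvsup (t k.+1) T (x^~ w))%E by exact: itvsup_ge0.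
apply: (@le_trans _ _ (\int[P]_w (itvsup (t k.+2) (t k.+1) (x^~ w) + itvsup (t k.+1) T (x^~ w)))%E).
  apply: ge0_le_integral => //.
  - by move=> w _; exact: itvsup_ge0.
  - exact: measurable_itvsup.
  - exact: emeasurable_funD.
  move=> w _; apply: itvsup_le => // s /andP[s1 s2].
  case: (leP s (t k.+1)) => st.
    by rewrite -[leLHS]adde0; apply: leeD => //; apply: itvsup_ge => //; rewrite s1.
  by rewrite -[leLHS]add0e; apply: leeD => //; apply: itvsup_ge => //; rewrite (ltW st).
rewrite ge0_integralD//; apply: (@le_trans _ _
  ((48 * E P (fun w => x (t k.+1) w ^+ 2))%:E + (49 ^+ k.+1 * q)%:E)%E).
  by apply: leeD; [exact: step|exact: IH].
have xk : E P (fun w => x (t k.+1) w ^+ 2) <= 49 ^+ k.+1 * q.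
  rewrite -lee_fin (E_EFin (L2_sqr (x_L2 t1T))); apply: le_trans (IH kn').
  apply: ge0_le_integral => //.
  - by move=> w _; rewrite lee_fin sqr_ge0.
  - by apply/measurable_EFinP/measurable_funX; exact: x_meas.
  - by move=> w _; apply: itvsup_ge => //; rewrite lexx ltW.
rewrite -EFinD lee_fin; apply: le_trans (lerD (ler_wpM2l (ler0n R 48) xk) (lexx _)) _.
rewrite [49 ^+ k.+2]exprS -mulrA; move: (49 ^+ k.+1 * q) => z.
by rewrite (_ : 48 * z + z = 49 * z)//; ring.
Qed.

End bsde_estimate.

(** * Stability of solutions *)

Section stability_of_solutions.
Context (R : realType) (d : measure_display) (Omega : measurableType d).
Context (P : probability Omega R) (T : R) (ell : {measure set R -> \bar R}).
Variables (W B : R -> Omega -> R) (N : R.-ker Omega ~> (R * R)%type).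
Hypothesis hP : measure_is_complete P.
Hypothesis hW : brownian_motion P T W.
Hypothesis hB : brownian_motion P T B.
Hypothesis hN : poisson_random_measure P T ell N.
Hypothesis hWBN : independent_noises P T ell W B N.

Local Notation G := (filtrationG P T ell W B N).
Local Notation mu := (@lebesgue_measure R).
Hypothesis hT : 0 < T.
Hypothesis hell : (\int[ell]_(z in @R0 R) (z ^+ 2)%:E < +oo)%E.

Let G_meas t : t <= T -> G t `<=` measurable.
Proof. exact: (G_measurable hP hW hB). Qed.

Local Notation stochint := (stochint P T ell W B N).

(** The comparison of drivers is available only at arguments in [hatL2]. Finite energy places Z(s,
    .) there for almost every s, so the drift bound is an almost everywhere statement in time. *)
Lemma ae_hatL2 Z : mfield T Z -> (Eintjump2 P T ell Z < +oo)%E ->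
  {ae P, forall w, {ae mu, forall s, 0 <= s <= T -> hatL2 ell (Z s w)}}.
Proof.
move=> mZ fZ; pose F (p : R * Omega) := (\int[ell]_(z in @R0 R) (`|Z p.1 p.2 z| ^+ 2)%:E)%E.
have FE p : F p = (\int[ell]_(z in @R0 R) (Z p.1 p.2 z ^+ 2)%:E)%E.
  by apply: eq_integral => z _; rewrite real_normK ?num_real.
have mF : measurable_fun (`[0, T] `*` @setT Omega) F.
  rewrite (funext FE); exact: (mfield_sqr hell mZ).
have F0 p : (0 <= F p)%E by apply: integral_ge0 => z _; rewrite lee_fin sqr_ge0.
have mFw : measurable_fun setT (fun w => \int[mu]_(t in `[0%R, T]) F (t, w))%E.
  by apply: (@measurable_int_time _ _ _ `[0, T]).
have mFt w : measurable_fun `[0, T] (fun t => F (t, w)).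
  by apply: measurable_section mF _; exact: measurable_itv.
have FI0 w : (0 <= \int[mu]_(t in `[0%R, T]) F (t, w))%E by apply: integral_ge0.
have iF : P.-integrable setT (fun w => \int[mu]_(t in `[0%R, T]) F (t, w))%E.
  apply/integrableP; split => //; under eq_integral do rewrite gee0_abs//.
  exact: fZ.
apply: filterS (integrable_ae measurableT iF) => w /(_ I) fw.
have iFt : mu.-integrable `[0, T] (fun t => F (t, w)).
  apply/integrableP; split; first exact: mFt.
  under eq_integral do rewrite gee0_abs//.
  by rewrite -ge0_fin_numE.
have mD : measurable (`[0, T]%classic : set (measurableTypeR R)) by exact: measurable_itv.
apply: (@filterS _ _ (ae_filter_ringOfSetsType mu) _ _ _ (integrable_ae mD iFt)) => s hs sT.
have sT' : `[0, T]%classic s by rewrite /= in_itv.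
split; first exact: mfield_section mZ sT.
by have := hs sT'; rewrite ge0_fin_numE.
Qed.

(* A solution of either equation, seen as a solution driven by W, B and the
   jumps with respect to the larger filtration G. *)
Definition solves (xi : Omega -> R) (dr : Omega -> R -> R) (X : R -> Omega -> R)
    (u : integrand R Omega) (M : R -> Omega -> R) : Prop :=
  [/\ measurable_fun setT xi,
      [/\ forall t, 0 <= t <= T -> mwrt (G t) (X t),
          {ae P, forall w, cadlag T (X^~ w)} & (Esup2 P T X < +oo)%E],
      stochint u M,
      {ae P, forall w, {ae mu, forall s, 0 <= s <= T -> hatL2 ell (uz u s w)}} &
      {ae P, forall w, mu.-integrable `[0, T] (EFin \o dr w) /\
        forall t, 0 <= t <= T ->
          X t w = xi w + \int[mu]_(s in `[t, T]) dr w s - (M T w - M t w)}].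

Lemma cadlagB (x y : R -> R) : cadlag T x -> cadlag T y ->
  cadlag T (fun t => x t - y t).
Proof.
move=> [xr xl] [yr yl]; split => t tT; first exact: cvgB (xr t tT) (yr t tT).
have [l hl] := xl t tT; have [m hm] := yl t tT.
by exists (l - m); exact: cvgB.
Qed.

(** The 4 in K = 4 C0^2 is the number of summands in the Lipschitz bound. *)
Let sqr4_le (C p y n z q : R) : 0 <= C -> 0 <= p -> 0 <= y -> 0 <= n -> 0 <= z ->
  0 <= q -> q <= C * (p + y + n + z) ->
  q ^+ 2 <= 4 * C ^+ 2 * (p ^+ 2 + (y ^+ 2 + z ^+ 2 + n ^+ 2)).
Proof.
move=> C0 p0 y0 n0 z0 q0 h; apply: (@le_trans _ _ ((C * (p + y + n + z)) ^+ 2)).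
  by rewrite ler_pXn2r ?nnegrE// mulr_ge0 ?addr_ge0.
rewrite exprMn [4 * C ^+ 2]mulrC -[leRHS]mulrA; apply: ler_wpM2l; first exact: sqr_ge0.
have := sqr_ge0 (p - y); have := sqr_ge0 (p - n); have := sqr_ge0 (p - z).
have := sqr_ge0 (y - n); have := sqr_ge0 (y - z); have := sqr_ge0 (n - z).
nra.
Qed.

Section stability.
Variables (C0 : R) (xi xi' : Omega -> R) (dr dr' : Omega -> R -> R).
Variables (X X' M M' : R -> Omega -> R) (u u' : integrand R Omega).
Hypothesis C00 : 0 < C0.
Hypotheses (sol : solves xi dr X u M) (sol' : solves xi' dr' X' u' M').
Hypothesis dr_lip : forall w s, 0 <= s <= T ->
  hatL2 ell (uz u s w) -> hatL2 ell (uz u' s w) ->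
  `|dr w s - dr' w s| <= C0 * (`|X s w - X' s w| + `|uy u s w - uy u' s w| +
     norm_ell ell (uz u s w - uz u' s w) + `|ub u s w - ub u' s w|).

Let x t w := X t w - X' t w.
Let v t w := nrm ell (iadd u (iopp u')) (t, w).

Let drift_le w s : 0 <= s <= T -> hatL2 ell (uz u s w) -> hatL2 ell (uz u' s w) ->
  (((dr w s - dr' w s) ^+ 2)%:E <=
   (4 * C0 ^+ 2)%:E * ((x s w ^+ 2)%:E + v s w))%E.
Proof.
move=> sT h h'; have := dr_lip sT h h'.
set n := norm_ell _ _ => hd.
have n0 : 0 <= n by exact: sqrtr_ge0.
have i0 : (0 <= \int[ell]_(z in @R0 R) ((uz u s w z - uz u' s w z) ^+ 2)%:E)%E.
  by apply: integral_ge0 => z _; rewrite lee_fin sqr_ge0.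
(* [norm_ell] uses [fine] and would be 0 for an infinite integral; the inequality covers that case
   too. *)
have nE : ((n ^+ 2)%:E <= \int[ell]_(z in @R0 R) ((uz u s w z - uz u' s w z) ^+ 2)%:E)%E.
  have -> : n = Num.sqrt (fine (\int[ell]_(z in @R0 R) ((uz u s w z - uz u' s w z) ^+ 2)%:E)%E).
    congr (Num.sqrt (fine _)); apply: eq_integral => z _.
    by rewrite real_normK ?num_real.
  rewrite sqr_sqrtr ?fine_ge0//; move: i0.
  by case: (\int[ell]_(z in _) _)%E => //= *; rewrite leey.
apply: (@le_trans _ _ ((4 * C0 ^+ 2)%:E * ((x s w ^+ 2)%:E +
  (((uy u s w - uy u' s w) ^+ 2)%:E + ((ub u s w - ub u' s w) ^+ 2)%:E + (n ^+ 2)%:E)))%E).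
  have sq (r : R) : r ^+ 2 = `|r| ^+ 2 by rewrite real_normK ?num_real.
  rewrite -!EFinD -EFinM lee_fin (sq (dr w s - _)) (sq (x s w)) (sq (uy u s w - _)) (sq (ub u s w - _)).
  by apply: sqr4_le => //; exact: ltW.
apply: lee_wpmul2l; first by rewrite lee_fin mulr_ge0// sqr_ge0.
by apply: leeD => //; apply: leeD.
Qed.

Lemma solution_stability n : (0 < n)%N -> T / n%:R <= 1 ->
  52 * (T / n%:R * (4 * C0 ^+ 2)) <= 1 ->
  (Esup2 P T (fun t w => (X t w - X' t w)%R) <=
   (49 ^+ n)%:E * \int[P]_w (`|xi w - xi' w| ^+ 2)%:E)%E.
Proof.
move=> n0 h1 hK.
have [mxi [aX cX fX] uM hu eqX] := sol.
have [mxi' [aX' cX' fX'] uM' hu' eqX'] := sol'.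
have K0 : 0 <= 4 * C0 ^+ 2 by rewrite mulr_ge0// sqr_ge0.
pose uu := iadd u (iopp u'); pose MM t w := M t w + - M' t w.
have uuMM : stochint uu MM := stochint_add hP hW hB hN hell uM (stochint_opp uM').
have [muu mMM _] := uuMM.
have ax t : 0 <= t <= T -> mwrt (G t) (x t).
  by move=> tT; apply: mwrtB; [exact: aX|exact: aX'].
have cx : {ae P, forall w, cadlag T (x^~ w)}.
  by apply: (filterS2 _ _ cX cX') => w; exact: cadlagB.
have Gm := @G_meas.
have mX : measurable_fun setT (fun w => itvsup 0 T (X^~ w)).
  exact: (measurable_itvsup hP Gm aX cX (lexx 0) hT (lexx T)).
have mX' : measurable_fun setT (fun w => itvsup 0 T (X'^~ w)).
  exact: (measurable_itvsup hP Gm aX' cX' (lexx 0) hT (lexx T)).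
have mx : measurable_fun setT (fun w => itvsup 0 T (x^~ w)).
  exact: (measurable_itvsup hP Gm ax cx (lexx 0) hT (lexx T)).
(* Finiteness for the difference comes from (p - q)^2 <= 2 p^2 + 2 q^2 and is what permits
   absorption. *)
have fx : (\int[P]_w itvsup 0 T (x^~ w) < +oo)%E.
  apply: (@le_lt_trans _ _ (2%:E * Esup2 P T X + 2%:E * Esup2 P T X')%E); last first.
    by apply: lte_add_pinfty; apply: lte_mul_pinfty.
  apply: ge0_integral_le2 => //; try by move=> w _; exact: itvsup_ge0.
  move=> w _; apply: itvsup_le => // t tT.
  apply: (@le_trans _ _ (2%:E * (X t w ^+ 2)%:E + 2%:E * (X' t w ^+ 2)%:E)%E).
    by rewrite -!EFinM -EFinD lee_fin /x; have := sqr_ge0 (X t w + X' t w); nra.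
  by apply: leeD; apply: lee_wpmul2l => //; exact: (itvsup_ge (fun s => _ s w)).
have mIt (t : R) : measurable (`[t, T]%classic : set (measurableTypeR R)) by exact: measurable_itv.
(* At t = T the drift integral is over a single point and the martingale increment is 0. *)
have xT : {ae P, forall w, x T w = xi w - xi' w}.
  apply: (filterS2 _ _ eqX eqX') => w [_ e] [_ e'].
  have TT : 0 <= T <= T by rewrite lexx ltW.
  have z (h : R -> R) : \int[mu]_(s in `[T, T]) h s = 0.
    by rewrite set_itv1 Rintegral_set1.
  by rewrite /x (e T TT) (e' T TT) !z; ring.
have eqx : {ae P, forall w, exists g : R -> R,
  [/\ mu.-integrable `[0, T] (EFin \o g),
      forall t, 0 <= t <= T ->
        x t w = x T w + \int[mu]_(s in `[t, T]) g s - (MM T w - MM t w) &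
      {ae mu, forall s, 0 <= s <= T ->
        ((g s ^+ 2)%:E <= (4 * C0 ^+ 2)%:E * ((x s w ^+ 2)%:E + v s w))%E}]}.
  apply: (filterS2 _ _ (filterI eqX eqX') (filterI xT (filterI hu hu'))).
  move=> w [[i e] [i' e']] [ex [h h']]; exists (fun s => dr w s - dr' w s); split.
  - exact: (integrableB (mIt 0) i i').
  - move=> t tT; have sub : `[t, T] `<=` `[0, T].
      by case/andP: tT => t0 _; apply: subset_itv; rewrite bnd_simp.
    rewrite ex RintegralB; [|exact: (mIt t)|exact: integrableS (mIt 0) (mIt t) sub i|exact: integrableS (mIt 0) (mIt t) sub i'].
    by rewrite /x (e t tT) (e' t tT) /MM; ring.
  - apply: (@filterS2 _ _ (ae_filter_ringOfSetsType mu) _ _ _ _ h h') => s hs hs' sT.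
    exact: drift_le sT (hs sT) (hs' sT).
have L2M := stochint_L2 hP hW hB hN uuMM.
have orthM := stochint_orth hP hW hB hN hWBN uuMM.
have enM := stochint_energy hP hW hB hN hWBN hell uuMM.
have := bsde_estimate hP hT K0 Gm (@mwrt_G_le _ _ _ _ _ _ _ _ _) mMM L2M orthM
  (fun t w => nrm_ge0 ell uu (t, w))
  (fun a b w a0 bT => measurable_nrm_time hell w muu a0 bT)
  (fun a b a0 bT => measurable_nrm_int hell muu a0 bT)
  enM ax cx fx eqx n0 h1 hK.
have L2xT : L2 P (x T).
  by apply: (x_L2 hP hT Gm ax cx fx); rewrite lexx ltW.
rewrite EFinM (E_EFin (L2_sqr L2xT)).
have -> : (\int[P]_w (x T w ^+ 2)%:E = \int[P]_w (`|xi w - xi' w| ^+ 2)%:E)%E.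
  apply: ge0_ae_eq_integral => //.
  - by apply/measurable_EFinP; apply: measurable_funX; exact: L2xT.1.
  - apply/measurable_EFinP; apply: measurable_funX; apply: measurableT_comp => //.
    exact: measurable_funB.
  - by move=> w _; rewrite lee_fin sqr_ge0.
  - by apply: filterS xT => w -> _; rewrite real_normK ?num_real.
exact.
Qed.

End stability.
End stability_of_solutions.

(** * Solutions of the stated equations in the common form, and the choice of mesh *)

Section solutions.
Context (R : realType) (d : measure_display) (Omega : measurableType d).
Context (P : probability Omega R) (T : R) (ell : {measure set R -> \bar R}).
Variables (W B : R -> Omega -> R) (N : R.-ker Omega ~> (R * R)%type).
Hypothesis hP : measure_is_complete P.
Hypothesis hW : brownian_motion P T W.
Hypothesis hB : brownian_motion P T B.
Hypothesis hN : poisson_random_measure P T ell N.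
Hypothesis hWBN : independent_noises P T ell W B N.

Local Notation G := (filtrationG P T ell W B N).
Hypothesis hT : 0 < T.
Hypothesis hell : (\int[ell]_(z in @R0 R) (z ^+ 2)%:E < +oo)%E.

Let G_meas t : t <= T -> G t `<=` measurable.
Proof. exact: (G_measurable hP hW hB). Qed.

Local Notation F := (filtrationF P T ell W N).
Local Notation solves := (solves P T ell W B N).

Lemma filtrationF_sub t : F t `<=` G t.
Proof.
apply: smallest_gen_sub => E h; apply: sub_sigma_algebra.
by case: h => [[h|h]|h]; [left; left; left|left; right|right].
Qed.

Let mwrtFG t (g : Omega -> R) : mwrt (F t) g -> mwrt (G t) g.
Proof. by apply: mwrt_sub => E /filtrationF_sub h; exact: sub_sigma_algebra. Qed.

Let mwrtG_meas t (g : Omega -> R) : t <= T -> mwrt (G t) g -> measurable_fun setT g.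
Proof. by move=> tT; apply: mwrt_measurable; exact: G_meas. Qed.

Lemma L2T_F_measurable xi : L2T P T F xi -> measurable_fun setT xi.
Proof. by move=> [mxi _]; exact: mwrtG_meas (lexx T) (mwrtFG mxi). Qed.

Lemma L2T_G_measurable xi : L2T P T G xi -> measurable_fun setT xi.
Proof. by move=> [mxi _]; exact: mwrtG_meas (lexx T) mxi. Qed.

(** Adaptedness and the elementary approximations carry over from F to the larger G; the equation
    has no B part, so the third component is 0. The martingale is the sum of the two integral
    processes. *)
Lemma bsdej_solves xi f X Y Z : L2T P T F xi ->
  bsdej_solution P T ell F W N xi f X Y Z ->
  exists M, solves xi (fun w s => f s w (X s w) (Y s w) (Z s w)) X
    (Integrand Y Z (fun _ _ => 0)) M.
Proof.
move=> Lxi [[aX cX fX] [pY _] [pZ fZ] [IW [IN [bW jN eqX]]]].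
have FT : F 0 setT by exact: smallestT.
have sW := stochint_W hP hW hB hT hell filtrationF_sub FT pY bW.
have sN := stochint_N hP hW hB hT hell filtrationF_sub FT pZ jN.
have sM := stochint_add hP hW hB hN hell sW sN.
have uE : iadd (intW Y) (intN Z) = Integrand Y Z (fun _ _ => 0).
  rewrite /iadd /=; congr Integrand.
  - by apply/funext => t; apply/funext => w; rewrite addr0.
  - by apply/funext => t; apply/funext => w; apply/funext => z; rewrite add0r.
  - by apply/funext => t; apply/funext => w; rewrite addr0.
rewrite uE in sM; exists (fun t w => IW t w + IN t w); split => //.
- exact: L2T_F_measurable.
- by split => // t tT; apply: mwrtFG; exact: aX.
- by apply: ae_hatL2 => //; case: sM => -[].
- apply: filterS eqX => w [i e]; split => // t tT.
  by rewrite (e t tT); ring.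
Qed.

Lemma bsdej_solves1 xi f X Y Z ze : L2T P T G xi ->
  bsdej_solution1 P T ell G W B N xi f X Y Z ze ->
  exists M, solves xi (fun w s => f s w (X s w) (Y s w) (Z s w) (ze s w)) X
    (Integrand Y Z ze) M.
Proof.
move=> Lxi [[aX cX fX] [pY _] [pZ fZ] [pze _] [IW [IN [IB [bW jN bB eqX]]]]].
have GT : G 0 setT by exact: smallestT.
have GG t : G t `<=` G t by [].
have sW := stochint_W hP hW hB hT hell GG GT pY bW.
have sN := stochint_N hP hW hB hT hell GG GT pZ jN.
have sB := stochint_B hP hW hB hT hell GG GT pze bB.
have sM := stochint_add hP hW hB hN hell (stochint_add hP hW hB hN hell sW sN) sB.
have uE : iadd (iadd (intW Y) (intN Z)) (intB ze) = Integrand Y Z ze.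
  rewrite /iadd /=; congr Integrand.
  - by apply/funext => t; apply/funext => w; rewrite !addr0.
  - by apply/funext => t; apply/funext => w; apply/funext => z; rewrite add0r addr0.
  - by apply/funext => t; apply/funext => w; rewrite !add0r.
rewrite uE in sM; exists (fun t w => IW t w + IN t w + IB t w); split => //.
- exact: L2T_G_measurable.
- by apply: ae_hatL2 => //; case: sM => -[].
- apply: filterS eqX => w [i e]; split => // t tT.
  by rewrite (e t tT); ring.
Qed.

(** The mesh depends on T and K alone, whence the uniformity in eps. *)
Lemma exists_mesh (K : R) : exists2 n, (0 < n)%N & T / n%:R <= 1 /\ 52 * (T / n%:R * K) <= 1.
Proof.
pose y := Num.max T (52 * (T * K)); exists (Num.truncn y).+1 => //.
have := truncnS_gt y; set n := (Num.truncn y).+1 => hn.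
have n0 : 0 < n%:R :> R by rewrite ltr0n.
move: (ltW hn); rewrite /y ge_max => /andP[h1 h2]; split.
  by rewrite ler_pdivrMr// mul1r.
have -> : 52 * (T / n%:R * K) = 52 * (T * K) / n%:R by ring.
by rewrite ler_pdivrMr// mul1r.
Qed.
End solutions.

Unset Implicit Arguments.
Set Strict Implicit.
Theorem proposition3p6 (R : realType) (d : measure_display)
    (Omega : measurableType d) (P : probability Omega R) (T : R)
    (ell : {measure set R -> \bar R})
    (W B : R -> Omega -> R) (N : R.-ker Omega ~> (R * R)%type)
    (hP : measure_is_complete P) (hT : 0 < T)
    (hell : (\int[ell]_(z in @R0 R) (z ^+ 2)%:E < +oo)%E)
    (hW : brownian_motion P T W) (hB : brownian_motion P T B)
    (hN : poisson_random_measure P T ell N)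
    (hWBN : independent_noises P T ell W B N) :
  let F := filtrationF P T ell W N in
  let G := filtrationG P T ell W B N in
  forall (xi : Omega -> R)
    (f f0 : R -> Omega -> R -> R -> (R -> R) -> R)
    (f1 : R -> Omega -> R -> R -> (R -> R) -> R -> R)
    (hxi : L2T P T F xi) (hf : condB P T ell F f)
    (hf0 : condB P T ell F f0) (hf1 : condB1 P T ell G f1)
    (C0 : R) (hC0 : 0 < C0)
    (hff0 : forall t w x1 y1 z1 x2 y2 z2,
      0 <= t <= T -> hatL2 ell z1 -> hatL2 ell z2 ->
      `|f t w x1 y1 z1 - f0 t w x2 y2 z2| <=
        C0 * (`|x1 - x2| + `|y1 - y2| + norm_ell ell (z1 - z2)))
    (hff1 : forall t w x1 y1 z1 x2 y2 z2 zeta,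
      0 <= t <= T -> hatL2 ell z1 -> hatL2 ell z2 ->
      `|f t w x1 y1 z1 - f1 t w x2 y2 z2 zeta| <=
        C0 * (`|x1 - x2| + `|y1 - y2| + norm_ell ell (z1 - z2) + `|zeta|))
    (xi0 xi1 : R -> Omega -> R)
    (hxi0 : forall eps, 0 < eps -> L2T P T F (xi0 eps))
    (hxi1 : forall eps, 0 < eps -> L2T P T G (xi1 eps))
    (hlim0 : (\int[P]_w (`|xi0 eps w - xi w| ^+ 2)%:E)%E
               @[eps --> 0^'+] --> 0%E)
    (hlim1 : (\int[P]_w (`|xi1 eps w - xi w| ^+ 2)%:E)%E
               @[eps --> 0^'+] --> 0%E)
    (X Y : R -> Omega -> R) (Z : R -> Omega -> R -> R)
    (hX : bsdej_solution P T ell F W N xi f X Y Z)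
    (X0 Y0 : R -> R -> Omega -> R) (Z0 : R -> R -> Omega -> R -> R)
    (hX0 : forall eps, 0 < eps ->
      bsdej_solution P T ell F W N (xi0 eps) f0 (X0 eps) (Y0 eps) (Z0 eps))
    (X1 Y1 zeta1 : R -> R -> Omega -> R) (Z1 : R -> R -> Omega -> R -> R)
    (hX1 : forall eps, 0 < eps ->
      bsdej_solution1 P T ell G W B N (xi1 eps) f1
        (X1 eps) (Y1 eps) (Z1 eps) (zeta1 eps)),
  exists C : R, 0 < C /\
    forall eps, 0 < eps ->
      (Esup2 P T (fun t w => (X t w - X0 eps t w)%R) <=
         C%:E * \int[P]_w (`|xi w - xi0 eps w| ^+ 2)%:E)%E /\
      (Esup2 P T (fun t w => (X t w - X1 eps t w)%R) <=
         C%:E * \int[P]_w (`|xi w - xi1 eps w| ^+ 2)%:E)%E.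
Proof.
move=> F G xi f f0 f1 hxi _ _ _ C0 hC0 hff0 hff1 xi0 xi1 hxi0 hxi1 _ _.
move=> X Y Z hX X0 Y0 Z0 hX0 X1 Y1 zeta1 Z1 hX1.
(* Chosen before eps and rho, so one constant serves all cases. *)
have [n n0 [h1 hK]] := exists_mesh T (4 * C0 ^+ 2).
exists (49 ^+ n); split; first by rewrite exprn_gt0.
have [M sM] := bsdej_solves hP hW hB hN hT hell hxi hX.
move=> eps e0; split.
- have [M0 sM0] := bsdej_solves hP hW hB hN hT hell (hxi0 _ e0) (hX0 _ e0).
  apply: (solution_stability hP hW hB hN hWBN hT hell hC0 sM sM0 _ n0 h1 hK).
  (* Both third components are 0, so the B term of the Lipschitz bound disappears. *)
  move=> w s sT h h' /=; rewrite subr0 normr0 addr0; exact: hff0.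
- have [M1 sM1] := bsdej_solves1 hP hW hB hN hT hell (hxi1 _ e0) (hX1 _ e0).
  apply: (solution_stability hP hW hB hN hWBN hT hell hC0 sM sM1 _ n0 h1 hK).
  (* The original solution has B component 0, so the difference of the B components has absolute
     value |zeta|, as in the comparison with f1. *)
  move=> w s sT h h' /=; rewrite sub0r normrN; exact: hff1.
Qed.
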